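(* Let $H \in \mathscr{H}^2(Z)$. Then the predictable projection $\left(\int H\, dZ\right)^{\mathcal{P}^X}$ of the stochastic integral process $\left(\int_0^t H_s\, dZ_s\right)_{t\ge 0}$ on the filtration $\mathbb{F}^X$ exists, and for all $t \ge 0$ $$\left(\int H\, dZ\right)^{\mathcal{P}^X}_t=\int_0^t \Pi^X(H)_s \, dX_s \quad P\text{-a.s.}$$
   Context: $(\Omega,\mathcal{F},P)$ is a complete probability space; $X,Y$ are two independent $d$-dimensional Brownian motions on it (started at $0$); $Z=X+iY$ is the conformal $d$-dimensional Brownian motion. $\mathbb{F}=(\mathcal{F}_t)_{t\ge0}$ is the augmented filtration generated by $Z$, and $\mathbb{F}^X=(\mathcal{F}^X_t)_{t\ge0}$ is the filtration generated by $X$, augmented by the $P$-nullsets from $\mathbb{F}$. Stochastic integrals are defined on the filtered space $(\Omega,\mathcal{F},\mathbb{F},P)$; for $\mathbb{C}^d$-valued $H$, $\int H\,dZ=\sum_{j=1}^d\int H^j\,dZ^j$ (no conjugation), and similarly for $X$. $\mathcal{P}^{\mathbb{G}}$ denotes the predictable $\sigma$-field of a filtration $\mathbb{G}$. $\mathscr{H}^2(Z)$ is the space of processes $H:\Omega\times[0,\infty)\to\mathbb{C}^d$ that are $\mathcal{P}^{\mathbb{F}}$-measurable with $E\left[\int_0^\infty|H_t|^2\,dt\right]<\infty$ ($|\cdot|$ the Euclidean norm). $\mathscr{H}^2(X)$ is defined in the same way with $\mathcal{P}^{\mathbb{F}^X}$ in place of $\mathcal{P}^{\mathbb{F}}$.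 $\Pi^X$ is the orthogonal projection from $\mathscr{H}^2(Z)$ onto $\mathscr{H}^2(X)$ (with respect to the $L^2(dP\times dt)$ inner product). Predictable projection: for a filtration $\mathbb{G}=(\mathcal{G}_t)$ and a measurable process $L$ (positive or bounded), the predictable projection of $L$ on $\mathbb{G}$ is the unique (up to evanescent sets) $\mathcal{P}^{\mathbb{G}}$-measurable process $\widetilde L$ such that $E[L_T\mid\mathcal{G}_{T-}]=\widetilde L_T$ $P$-a.s. on $\{T<\infty\}$ for every predictable $\mathbb{G}$-stopping time $T$. For other (possibly unbounded, complex-valued) processes $L$ the same defining property is used, and the projection is said to exist when there is such a process. The predictable projection of $L$ on $\mathbb{F}^X$ is denoted $L^{\mathcal{P}^X}$. *)

(* Defs.v *)
From HB Require Import structures.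
From mathcomp Require Import all_boot all_order all_algebra.
From mathcomp Require Import all_classical all_reals all_analysis.
From mathcomp Require Import complex.
Set Implicit Arguments.
Unset Strict Implicit.
Unset Printing Implicit Defensive.
Import Order.TTheory GRing.Theory Num.Theory.
Import numFieldNormedType.Exports.
Local Open Scope classical_set_scope.
Local Open Scope ring_scope.

(* Processes are functions of (t, w) with t : R; only their values at t >= 0
   matter. Complex random variables are handled through real and imaginary
   parts, and sigma-fields are systems of sets. *)

Section complex_random_variables.
Context {R : realType} {U : Type}.
Implicit Types (D : set U) (S : set (set U)).

Definition measurable_wrt D S (f : U -> R) : Prop :=
  forall B : set R, measurable B -> S (D `&` f @^-1` B).

Definition cmeasurable_wrt D S (f : U -> R[i]) : Prop :=
  measurable_wrt D S (fun x => complex.Re (f x)) /\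
  measurable_wrt D S (fun x => complex.Im (f x)).

End complex_random_variables.

Section filtrations.
Context {d : measure_display} {T : measurableType d} {R : realType}.
Variable P : probability T R.

Definition generated_sigma {K : Type} (J : set K) (f : K -> T -> R) :
    set (set T) :=
  <<s \bigcup_(k in J) preimage_set_system setT (f k) measurable >>.

Definition coordinate {n : nat} (V : R -> T -> 'rV[R]_n) (k : 'I_n * R) :
    T -> R :=
  fun w => V k.2 w ord0 k.1.

Definition ccoordinate {n : nat} (V : R -> T -> 'rV[R[i]]_n)
    (k : 'I_n * bool * R) : T -> R :=
  fun w => if k.1.2 then complex.Re (V k.2 w ord0 k.1.1)
           else complex.Im (V k.2 w ord0 k.1.1).

Definition history {n : nat} (V : R -> T -> 'rV[R]_n) (t : R) :
    set (set T) :=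
  generated_sigma [set k | 0 <= k.2 <= t] (coordinate V).

Definition full_history {n : nat} (V : R -> T -> 'rV[R]_n) : set (set T) :=
  generated_sigma [set k | 0 <= k.2] (coordinate V).

Definition chistory {n : nat} (V : R -> T -> 'rV[R[i]]_n) (t : R) :
    set (set T) :=
  generated_sigma [set k | 0 <= k.2 <= t] (ccoordinate V).

Definition augmented_filtration {n : nat} (V : R -> T -> 'rV[R[i]]_n)
    (t : R) : set (set T) :=
  <<s chistory V t `|` P.-negligible >>.

Definition time_domain : set (R * T) := [set x | 0 <= x.1].

Definition predictable_sigma (G : R -> set (set T)) : set (set (R * T)) :=
  <<s time_domain,
      [set [set 0] `*` A | A in G 0] `|`
      [set C | exists s t A, [/\ 0 <= s, s <= t, G s A &
                                 C = `]s, t] `*` A]] >>.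

Definition predictable_process (G : R -> set (set T)) (L : R -> T -> R[i]) :
    Prop :=
  cmeasurable_wrt time_domain (predictable_sigma G) (fun x => L x.1 x.2).

Definition adapted (G : R -> set (set T)) (L : R -> T -> R[i]) : Prop :=
  forall t, 0 <= t -> cmeasurable_wrt setT (G t) (L t).

Definition stopping_time (G : R -> set (set T)) (tau : T -> \bar R) : Prop :=
  (forall w, (0 <= tau w)%E) /\
  (forall t, 0 <= t -> G t [set w | (tau w <= t%:E)%E]).

(* A time is predictable when the stochastic interval [[tau, oo[[ is. *)
Definition predictable_time (G : R -> set (set T)) (tau : T -> \bar R) :
    Prop :=
  stopping_time G tau /\
  predictable_sigma G [set x | 0 <= x.1 /\ (tau x.2 <= x.1%:E)%E].

(* G_{tau-} *)
Definition strict_past (G : R -> set (set T)) (tau : T -> \bar R) :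
    set (set T) :=
  <<s G 0 `|` [set C | exists t A, [/\ 0 <= t, G t A &
                         C = A `&` [set w | (t%:E < tau w)%E]]] >>.

(* L_tau 1_{tau < oo}; {tau < oo} belongs to G_{tau-}, so conditioning it on
   G_{tau-} gives E[L_tau | G_{tau-}] on {tau < oo}. *)
Definition value_at (L : R -> T -> R[i]) (tau : T -> \bar R) (w : T) : R[i] :=
  if tau w is r%:E then L r w else 0.

Definition is_cond_exp_real (S : set (set T)) (f g : T -> R) : Prop :=
  [/\ P.-integrable setT (EFin \o f),
      P.-integrable setT (EFin \o g),
      measurable_wrt setT S g &
      forall A, S A -> (\int[P]_(w in A) (f w)%:E = \int[P]_(w in A) (g w)%:E)%E].

Definition is_cond_exp (S : set (set T)) (f g : T -> R[i]) : Prop :=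
  is_cond_exp_real S (fun w => complex.Re (f w)) (fun w => complex.Re (g w)) /\
  is_cond_exp_real S (fun w => complex.Im (f w)) (fun w => complex.Im (g w)).

Definition predictable_projection (G : R -> set (set T))
    (L L' : R -> T -> R[i]) : Prop :=
  predictable_process G L' /\
  forall tau, predictable_time G tau ->
    exists g, is_cond_exp (strict_past G tau) (value_at L tau) g /\
      {ae P, forall w, (tau w < +oo)%E -> g w = value_at L' tau w}.

End filtrations.

Section brownian_motion.
Context {d : measure_display} {T : measurableType d} {R : realType}.
Variable P : probability T R.

Definition brownian_motion {n : nat} (V : R -> T -> 'rV[R]_n) : Prop :=
  [/\ forall t j, 0 <= t -> measurable_fun setT (fun w => V t w ord0 j),
      {ae P, forall w, V 0 w = 0},
      {ae P, forall w, forall j,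
         {within `[0, +oo[, continuous (fun t => V t w ord0 j)}} &
      forall s t, 0 <= s -> s < t ->
        forall (A : set T) (B : 'I_n -> set R),
        history V s A -> (forall j, measurable (B j)) ->
        P (A `&` [set w | forall j, B j (V t w ord0 j - V s w ord0 j)]) =
        (P A * \prod_(j < n) normal_prob 0 (Num.sqrt (t - s)) (B j))%E].

Definition independent_processes {n m : nat}
    (V : R -> T -> 'rV[R]_n) (W : R -> T -> 'rV[R]_m) : Prop :=
  forall A B, full_history V A -> full_history W B ->
    P (A `&` B) = (P A * P B)%E.

Definition conformal {n : nat} (V W : R -> T -> 'rV[R]_n) :
    R -> T -> 'rV[R[i]]_n :=
  fun t w => \row_j Complex (V t w ord0 j) (W t w ord0 j).

Definition complexify {n : nat} (V : R -> T -> 'rV[R]_n) :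
    R -> T -> 'rV[R[i]]_n :=
  fun t w => \row_j Complex (V t w ord0 j) 0.

End brownian_motion.

Section integrands.
Context {d : measure_display} {T : measurableType d} {R : realType}.
Variable P : probability T R.

Definition normsq {n : nat} (v : 'rV[R[i]]_n) : R :=
  \sum_j Normc.normc (v ord0 j) ^+ 2.

Definition H2 {n : nat} (G : R -> set (set T)) (H : R -> T -> 'rV[R[i]]_n) :
    Prop :=
  (forall j, predictable_process G (fun t w => H t w ord0 j)) /\
  (\int[P]_w \int[lebesgue_measure]_(t in `[0%R, +oo[) (normsq (H t w))%:E
     < +oo)%E.

Definition inner {n : nat} (u v : 'rV[R[i]]_n) : R[i] :=
  \sum_j u ord0 j * conjc (v ord0 j).

Definition L2inner {n : nat} (H K : R -> T -> 'rV[R[i]]_n) : R[i] :=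
  Complex
    (\int[(lebesgue_measure \x P)%E]_(x in time_domain)
       complex.Re (inner (H x.1 x.2) (K x.1 x.2)))
    (\int[(lebesgue_measure \x P)%E]_(x in time_domain)
       complex.Im (inner (H x.1 x.2) (K x.1 x.2))).

(* A representative of the orthogonal projection of the class of H on S; the
   default 0 of xget plays no role when the projection exists. *)
Definition orthogonal_projection {n : nat} (S : set (R -> T -> 'rV[R[i]]_n))
    (H : R -> T -> 'rV[R[i]]_n) : R -> T -> 'rV[R[i]]_n :=
  xget (fun _ _ => 0)
    [set K | S K /\
             forall G, S G -> L2inner (fun t w => H t w - K t w) G = 0].

End integrands.

Section stochastic_integral.
Context {d : measure_display} {T : measurableType d} {R : realType}.
Variables (P : probability T R) (G : R -> set (set T)).

(* \sum_k coef_k 1_{]lo_k, hi_k]} *)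
Record simple_integrand : Type := SimpleIntegrand {
  pieces : nat;
  lo : 'I_pieces -> R;
  hi : 'I_pieces -> R;
  coef : 'I_pieces -> T -> R[i] }.

Definition adapted_simple (e : simple_integrand) : Prop :=
  forall k : 'I_(pieces e),
    [/\ 0 <= lo k, lo k <= hi k,
        cmeasurable_wrt setT (G (lo k)) (coef k) &
        exists M : R, forall w, Normc.normc (coef k w) <= M].

Definition simple_process (e : simple_integrand) (t : R) (w : T) : R[i] :=
  \sum_(k < pieces e) if lo k < t <= hi k then coef k w else 0.

Definition simple_integral (e : simple_integrand) (W : R -> T -> R[i])
    (t : R) (w : T) : R[i] :=
  \sum_(k < pieces e)
    coef k w * (W (Num.min (hi k) t) w - W (Num.min (lo k) t) w).

(* M is a continuous version of the Ito integral of h with respect to W, for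
   h predictable in L^2(dP x dt): the L^2-extension from simple integrands. *)
Definition is_ito_integral (W h M : R -> T -> R[i]) : Prop :=
  [/\ adapted G M,
      {ae P, forall w,
         {within `[0, +oo[, continuous (fun t => complex.Re (M t w))} /\
         {within `[0, +oo[, continuous (fun t => complex.Im (M t w))}} &
      exists e : nat -> simple_integrand,
        [/\ forall n, adapted_simple (e n),
            (fun n => \int[P]_w \int[lebesgue_measure]_(t in `[0%R, +oo[)
               (Normc.normc (h t w - simple_process (e n) t w) ^+ 2)%:E)%E
              @ \oo --> (0 : \bar R)%E &
            forall t, 0 <= t ->
            (fun n => \int[P]_w
               (Normc.normc (M t w - simple_integral (e n) W t w) ^+ 2)%:E)%E
              @ \oo --> (0 : \bar R)%E]].

Definition ito_integral (W h : R -> T -> R[i]) : R -> T -> R[i] :=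
  xget (fun _ _ => 0) [set M | is_ito_integral W h M].

Definition stochastic_integral {n : nat} (W H : R -> T -> 'rV[R[i]]_n) :
    R -> T -> R[i] :=
  fun t w => \sum_j ito_integral (fun s v => W s v ord0 j)
                                 (fun s v => H s v ord0 j) t w.

End stochastic_integral.

(* Main.v *)
Require Import Defs.
From HB Require Import structures.
From mathcomp Require Import all_boot all_order all_algebra.
From mathcomp Require Import all_classical all_reals all_analysis.
From mathcomp Require Import measurable_realfun.
From mathcomp Require Import complex ring lra.

(** For an event B of the path of X, a real integrand h predictable for (X, Y)
    and its orthogonal projection k on the integrands predictable for X,

      E[1_B int_0^t h dX^j] = E[1_B int_0^t k dX^j]  and
      E[1_B int_0^t h dY^j] = 0,

    because conditionally on the path of X the process Y is still a Brownian
    motion. Both sides are continuous in h by the Ito isometry, so it is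
    enough to look at h = 1_]a, b] 1_(A and C) with A in the past of X and C
    in the past of Y at time a. Then k = P(C) 1_]a, b] 1_A; the first identity
    says that 1_C - P(C) is centred given the path of X, the second one that
    increments of Y after a are centred given the past of Y and the path of X
    (lemmas X_unseen, Y_unseen, joint_density).

    Expanding (h1 + i h2) d(X + i Y) into four real integrals, the integral M
    of H along Z and the integral L of the projected integrand along X satisfy
    E[1_B (M_t - L_t)] = 0 for every t and every event B of the path of X.
    The difference is a continuous martingale bounded in L2, so by Doob's
    inequality its supremum is integrable. A predictable time tau of X being a
    function of the path of X, one may round tau up to dyadic times, apply the
    identity on each level set, and pass to the limit by dominated convergence
    (optional_sampling_zero): E[1_B (M_tau - L_tau); tau < oo] = 0. Finally L
    has a version adapted to X all of whose paths are continuous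
    (component_projection). It is predictable, so its value at tau is
    measurable for the strict past of tau, and it is the predictable projection
    of M. Deterministic times being predictable, any other projection agrees
    with it almost surely at each time (projection_unique_at).

    The Ito integral is constructed for real integrators whose increments have
    mean zero and the variance of Brownian motion over events of the past
    (is_BM); the augmented filtrations of X and of (X, Y) both satisfy this by
    independence (brownian_is_BM). Simple integrands are dense by a projection
    argument: a closed subspace of L2 containing the indicators of a pi-system
    is the whole of L2 (density). Continuity of the integral in time comes from
    Doob's inequality along a rapidly converging approximating sequence
    (ito_process_exists). *)

Set Implicit Arguments.
Unset Strict Implicit.
Unset Printing Implicit Defensive.
Import Order.TTheory GRing.Theory Num.Theory.
Import numFieldNormedType.Exports.
Local Open Scope classical_set_scope.
Local Open Scope ring_scope.

(** * Measurability with respect to a sub-sigma-field *)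

Section relative_sigma.
Context {d : measure_display} {U : measurableType d} {R : realType}.
Variables (D : set U) (S : set (set U)).
Hypothesis sS : sigma_algebra D S.

(** Measurability relative to a system S of subsets of D is measurability on D
    for the sigma-field of all sets whose trace on D belongs to S; closure
    properties of measurable functions are inherited through it. *)
Definition trace_system : set (set U) := [set A | S (D `&` A)].

Lemma trace_system_sigma : sigma_algebra setT trace_system.
Proof.
case: sS => S0 SC SU; split.
- by rewrite /trace_system /= setI0.
- move=> A SA; rewrite /trace_system /=.
  have -> : D `&` (setT `\` A) = D `\` (D `&` A) by rewrite setDIr setDv set0U setTD setDE.
  exact: SC.
- by move=> A SA; rewrite /trace_system /= setI_bigcupr; apply: SU.
Qed.

Notation US := (g_sigma_algebraType trace_system).

Lemma measurable_traceE (A : set U) : measurable (A : set US) <-> S (D `&` A).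
Proof.
have -> : measurable (A : set US) = <<s trace_system >> A by [].
by rewrite sigma_algebra_id //; exact: trace_system_sigma.
Qed.

Lemma measurable_trace_D : measurable (D : set US).
Proof. by apply/measurable_traceE; rewrite setIid -(setD0 D); case: sS => S0 + _; apply. Qed.

Lemma measurable_wrtE (f : U -> R) :
  measurable_wrt D S f <-> measurable_fun (D : set US) (f : US -> R).
Proof.
split=> mf.
  move=> _ B mB; apply/measurable_traceE; rewrite setIA setIid; exact: mf.
move=> B mB; have /measurable_traceE := mf measurable_trace_D _ mB.
by rewrite setIA setIid.
Qed.

Lemma wrt_cst (c : R) : measurable_wrt D S (fun=> c).
Proof. by apply/measurable_wrtE. Qed.

Lemma wrt_add (f g : U -> R) : measurable_wrt D S f -> measurable_wrt D S g ->
  measurable_wrt D S (fun x => f x + g x).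
Proof.
move=> /measurable_wrtE mf /measurable_wrtE mg; apply/measurable_wrtE.
exact: measurable_funD.
Qed.

Lemma wrt_mul (f g : U -> R) : measurable_wrt D S f -> measurable_wrt D S g ->
  measurable_wrt D S (fun x => f x * g x).
Proof.
move=> /measurable_wrtE mf /measurable_wrtE mg; apply/measurable_wrtE.
exact: measurable_funM.
Qed.

Lemma wrt_comp (h : R -> R) (f : U -> R) : measurable_fun setT h ->
  measurable_wrt D S f -> measurable_wrt D S (fun x => h (f x)).
Proof.
move=> mh /measurable_wrtE mf; apply/measurable_wrtE.
exact: measurableT_comp.
Qed.

Lemma wrt_opp (f : U -> R) : measurable_wrt D S f ->
  measurable_wrt D S (fun x => - f x).
Proof. by move=> mf; apply: (wrt_comp (h := -%R)) => //; exact: oppr_measurable. Qed.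

Lemma wrt_sub (f g : U -> R) : measurable_wrt D S f -> measurable_wrt D S g ->
  measurable_wrt D S (fun x => f x - g x).
Proof. by move=> mf mg; apply: wrt_add => //; exact: wrt_opp. Qed.

Lemma wrt_lin (a : R) (f g : U -> R) : measurable_wrt D S f ->
  measurable_wrt D S g -> measurable_wrt D S (fun x => f x + a * g x).
Proof. by move=> mf mg; apply: wrt_add => //; apply: wrt_mul => //; exact: wrt_cst. Qed.

Lemma wrt_sum (I : Type) (r : seq I) (f : I -> U -> R) :
  (forall i, measurable_wrt D S (f i)) ->
  measurable_wrt D S (fun x => \sum_(i <- r) f i x).
Proof.
move=> mf; elim: r => [|i r IH].
  under eq_fun do rewrite big_nil; exact: wrt_cst.
under eq_fun do rewrite big_cons; exact: wrt_add.
Qed.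

Lemma wrt_indic (A : set U) : S (D `&` A) -> measurable_wrt D S (\1_A : U -> R).
Proof.
move=> SA; apply/measurable_wrtE; apply: (measurable_funS measurableT) => //.
by apply: (measurable_indic (T := US)); apply/measurable_traceE.
Qed.

Lemma wrt_eq (f g : U -> R) : (forall x, D x -> f x = g x) ->
  measurable_wrt D S f -> measurable_wrt D S g.
Proof.
move=> fg mf B mB; have -> : D `&` g @^-1` B = D `&` f @^-1` B; last exact: mf.
by apply/seteqP; split=> x [Dx /=] Bx; split=> //=; rewrite ?(fg _ Dx) // -(fg _ Dx).
Qed.

Lemma wrt_lim (f : nat -> U -> R) (g : U -> R) :
  (forall n, measurable_wrt D S (f n)) ->
  (forall x, D x -> f n x @[n --> \oo] --> g x) -> measurable_wrt D S g.
Proof.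
move=> mf fg; apply/measurable_wrtE.
apply: (@measurable_fun_cvg _ US R D f g) => [n|x Dx].
  by apply/measurable_wrtE.
exact: fg.
Qed.

End relative_sigma.

(** * Rapidly converging sequences *)

Section fast_sequences.
Context {R : realType}.

(** The bounds C 2^-m for m >= n add up to 2 C 2^-n. *)
Lemma fast_increments (u : nat -> R) (C : R) :
  (forall n, `|u n.+1 - u n| <= C / 2 ^+ n) ->
  forall n k, `|u (n + k)%N - u n| <= 2 * C / 2 ^+ n.
Proof.
move=> uC n k.
have C0 : 0 <= C by have := le_trans (normr_ge0 _) (uC 0%N); rewrite expr0 divr1.
have p2 m : 0 < 2 ^+ m :> R by rewrite exprn_gt0.
suff : `|u (n + k)%N - u n| <= 2 * C / 2 ^+ n - 2 * C / 2 ^+ (n + k).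
  move/le_trans; apply; rewrite gerBl divr_ge0 ?mulr_ge0 //; exact: ltW.
elim: k => [|k IH]; first by rewrite addn0 !subrr normr0.
have -> : u (n + k.+1)%N - u n = (u (n + k).+1 - u (n + k)%N) + (u (n + k)%N - u n).
  by rewrite addnS; ring.
apply: le_trans (ler_normD _ _) _.
apply: le_trans (lerD (uC _) IH) _.
rewrite addnS exprS; have := p2 (n + k)%N; have := p2 n.
set a := 2 ^+ n; set b := 2 ^+ (n + k) => a0 b0.
by rewrite le_eqVlt; apply/orP; left; apply/eqP; field; rewrite !gt_eqF.
Qed.

Lemma cvg_inv2X (C : R) : C / 2 ^+ n @[n --> \oo] --> (0 : R).
Proof.
have := @cvg_geometric R C (2^-1).
rewrite normfV ger0_norm // invf_lt1 // ltr1n => /(_ erefl).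
by rewrite /geometric /=; under eq_fun do rewrite exprVn.
Qed.

Lemma fast_cvg (u : nat -> R) (C : R) :
  (forall n, `|u n.+1 - u n| <= C / 2 ^+ n) ->
  cvgn u /\ forall n, `|limn u - u n| <= 2 * C / 2 ^+ n.
Proof.
move=> uC; have uF := fast_increments uC.
have cu : cvgn u.
  apply/cauchy_cvgP/cauchy_exP => e e0.
  have /cvgrPdist_lt /(_ e e0) [N _ NH] := cvg_inv2X (2 * C).
  exists (u N), N => // n /= /subnKC <-; rewrite /ball /= distrC.
  apply: le_lt_trans (uF _ _) _.
  have := NH N (leqnn _); rewrite /= sub0r normrN; apply: le_lt_trans; exact: ler_norm.
split=> // n.
have cd : `|u k - u n| @[k --> \oo] --> `|limn u - u n|.
  by apply: cvg_norm; apply: cvgB => //; exact: cvg_cst.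
apply: (cvgr_to_le cd); exists n => // k /= /subnKC <-; exact: uF.
Qed.

End fast_sequences.

(** * Square-integrable functions and orthogonal projections *)

Section L2_spaces.
Context {d : measure_display} {U : measurableType d} {R : realType}.
Variables (mu : {measure set U -> \bar R}) (D : set U).
Hypothesis mD : measurable D.
Implicit Types (S : set (set U)) (f g h : U -> R).

Definition sqint f : \bar R := (\int[mu]_(x in D) ((f x) ^+ 2)%:E)%E.
Definition L2 S f : Prop := measurable_wrt D S f /\ (sqint f < +oo)%E.
Definition ip f g : R := \int[mu]_(x in D) (f x * g x).

Notation M := (@measurable _ U).
Notation L2m := (L2 M).

Lemma wrt_measurable_fun f : measurable_wrt D M f <-> measurable_fun D f.
Proof. by split=> [mf _ B mB|mf B mB]; exact: mf. Qed.

Lemma sigma_algebra_M : sigma_algebra D M.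
Proof.
split=> [|A mA|A mA]; [exact: measurable0|exact: measurableD|exact: bigcupT_measurable].
Qed.

Lemma L2_sub S S' f : S `<=` S' -> L2 S f -> L2 S' f.
Proof. by move=> SS' [mf f2]; split=> // B mB; apply: SS'; exact: mf. Qed.

Lemma L2_meas S f : S `<=` M -> L2 S f -> L2m f.
Proof. exact: L2_sub. Qed.

Lemma integrable_sqr f : L2m f -> mu.-integrable D (EFin \o (fun x => f x ^+ 2)).
Proof.
move=> [/wrt_measurable_fun mf f2]; apply/integrableP; split.
  by apply/measurable_EFinP; exact: measurable_funX.
by under eq_integral => x _ do rewrite /= ger0_norm ?sqr_ge0 //.
Qed.

Lemma integrable_mul f g : L2m f -> L2m g ->
  mu.-integrable D (EFin \o (fun x => f x * g x)).
Proof.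
move=> lf lg; have [/wrt_measurable_fun mf f2] := lf; have [/wrt_measurable_fun mg g2] := lg.
have := integrableD mD (integrable_sqr lf) (integrable_sqr lg).
apply: le_integrable => //.
  by apply/measurable_EFinP; exact: measurable_funM.
move=> x Dx; rewrite /= lee_fin [leRHS]ger0_norm ?addr_ge0 ?sqr_ge0 //.
by rewrite ler_norml; apply/andP; split; nra.
Qed.

Lemma sqintE f : L2m f -> sqint f = (ip f f)%:E.
Proof.
move=> lf; rewrite /ip /Rintegral fineK; first by apply: eq_integral => x _; rewrite expr2.
by apply: integrable_fin_num => //; exact: integrable_mul.
Qed.

Lemma ip_ge0 f : 0 <= ip f f.
Proof. by apply: Rintegral_ge0 => x _; rewrite -expr2 sqr_ge0. Qed.

Lemma ipC f g : ip f g = ip g f.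
Proof. by apply: eq_Rintegral => x _; rewrite mulrC. Qed.

Lemma eq_ip f f' g g' : (forall x, D x -> f x = f' x) -> (forall x, D x -> g x = g' x) ->
  ip f g = ip f' g'.
Proof. by move=> ff gg; apply: eq_Rintegral => x /set_mem Dx; rewrite ff ?gg. Qed.

Lemma ip_lin (a : R) f g h : L2m f -> L2m g -> L2m h ->
  ip (fun x => f x + a * g x) h = ip f h + a * ip g h.
Proof.
move=> lf lg lh; rewrite -RintegralZl //; last exact: integrable_mul.
rewrite /ip -RintegralD //; first by apply: eq_Rintegral => x _; ring.
- exact: integrable_mul.
- have := integrableZl mD a (integrable_mul lg lh).
  by apply: eq_integrable => // x _ /=; rewrite EFinM.
Qed.

Lemma ip_linr (a : R) f g h : L2m f -> L2m g -> L2m h ->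
  ip h (fun x => f x + a * g x) = ip h f + a * ip h g.
Proof. by move=> *; rewrite ipC ip_lin // (ipC f) (ipC g). Qed.

Lemma L2_eq S f g : (forall x, D x -> f x = g x) -> L2 S f -> L2 S g.
Proof.
move=> fg [mf f2]; split; first exact: wrt_eq mf.
suff -> : sqint g = sqint f by [].
by apply: eq_integral => x /set_mem Dx; rewrite fg.
Qed.

Lemma ip_ae f f' g : measurable_fun D f -> measurable_fun D f' -> measurable_fun D g ->
  {ae mu, forall x, D x -> f x = f' x} -> ip f g = ip f' g.
Proof.
move=> mf mf' mg ff; congr fine; apply: ae_eq_integral => //.
- by apply/measurable_EFinP; exact: measurable_funM.
- by apply/measurable_EFinP; exact: measurable_funM.
- by apply: filterS ff => x /[apply] ->.
Qed.

Section with_S.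
Variable S : set (set U).
Hypotheses (sS : sigma_algebra D S) (SM : S `<=` M).

Lemma sqint_le (f g : U -> R) : (forall x, D x -> f x ^+ 2 <= g x ^+ 2) ->
  measurable_fun D f -> measurable_fun D g -> (sqint f <= sqint g)%E.
Proof.
move=> fg mf mg; apply: ge0_le_integral => //.
- by move=> x _; rewrite lee_fin sqr_ge0.
- by apply/measurable_EFinP; exact: measurable_funX.
- by apply/measurable_EFinP; exact: measurable_funX.
Qed.

Lemma L2_lin (a : R) f g : L2 S f -> L2 S g -> L2 S (fun x => f x + a * g x).
Proof.
move=> lf lg; split; first by apply: wrt_lin => //; [case: lf|case: lg].
have [/wrt_measurable_fun mf f2] := L2_meas SM lf.
have [/wrt_measurable_fun mg g2] := L2_meas SM lg.
have i : mu.-integrable D (EFin \o (fun x => 2 * f x ^+ 2 + 2 * a ^+ 2 * g x ^+ 2)).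
  have := integrableD mD (integrableZl mD 2 (integrable_sqr (L2_meas SM lf)))
    (integrableZl mD (2 * a ^+ 2) (integrable_sqr (L2_meas SM lg))).
  by apply: eq_integrable => // x _ /=; rewrite -!EFinM -EFinD.
have /integrableP[_ /le_lt_trans] := i; apply.
apply: ge0_le_integral => //.
- by move=> x _; rewrite lee_fin sqr_ge0.
- apply/measurable_EFinP; apply: measurable_funX; apply: measurable_funD => //.
  by apply: measurable_funM.
- by apply: measurableT_comp => //; have /integrableP[] := i.
- move=> x Dx; rewrite /= lee_fin; apply: le_trans (ler_norm _).
  have := sqr_ge0 (f x - a * g x).
  by nra.
Qed.

Lemma L2_0 : L2 S (fun=> 0).
Proof.
split; first exact: wrt_cst.
by rewrite /sqint; under eq_integral do rewrite expr0n; rewrite integral0.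
Qed.

Lemma L2_scale (a : R) f : L2 S f -> L2 S (fun x => a * f x).
Proof.
move=> lf; apply: (L2_eq _ (L2_lin a L2_0 lf)) => x _; by rewrite add0r.
Qed.

Lemma L2_add f g : L2 S f -> L2 S g -> L2 S (fun x => f x + g x).
Proof.
move=> lf lg; apply: (L2_eq _ (L2_lin 1 lf lg)) => x _; by rewrite mul1r.
Qed.

Lemma L2_subr f g : L2 S f -> L2 S g -> L2 S (fun x => f x - g x).
Proof.
move=> lf lg; apply: (L2_eq _ (L2_lin (-1) lf lg)) => x _; by rewrite mulN1r.
Qed.

End with_S.

Lemma ip_sub f g h : L2m f -> L2m g -> L2m h ->
  ip (fun x => f x - g x) h = ip f h - ip g h.
Proof.
move=> lf lg lh; rewrite -(mulN1r (ip g h)) -ip_lin //.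
by apply: eq_ip => // x _; rewrite mulN1r.
Qed.

Lemma ip_add f g h : L2m f -> L2m g -> L2m h ->
  ip (fun x => f x + g x) h = ip f h + ip g h.
Proof.
move=> lf lg lh; rewrite -(mul1r (ip g h)) -ip_lin //.
by apply: eq_ip => // x _; rewrite mul1r.
Qed.

Lemma ip_scale a f h : L2m f -> L2m h -> ip (fun x => a * f x) h = a * ip f h.
Proof.
move=> lf lh; rewrite /ip -RintegralZl //; last exact: integrable_mul.
by apply: eq_Rintegral => x _; rewrite mulrA.
Qed.

Lemma ip0l f : ip (fun=> 0) f = 0.
Proof.
by rewrite /ip /Rintegral; under eq_integral do rewrite mul0r; rewrite integral0.
Qed.

Let sM := sigma_algebra_M.
Let MM : M `<=` M. Proof. by []. Qed.

Lemma nsq_lin (a : R) f g : L2m f -> L2m g ->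
  ip (fun x => f x + a * g x) (fun x => f x + a * g x) =
  ip f f + 2 * a * ip f g + a ^+ 2 * ip g g.
Proof.
move=> lf lg; have l := L2_lin sM MM a lf lg.
by rewrite ip_lin // !ip_linr // (ipC g f); ring.
Qed.

Lemma CauchySchwarz f g : L2m f -> L2m g -> ip f g ^+ 2 <= ip f f * ip g g.
Proof.
move=> lf lg.
have H a : 0 <= ip f f + 2 * a * ip f g + a ^+ 2 * ip g g.
  by rewrite -nsq_lin // ip_ge0.
have := ip_ge0 g; have := ip_ge0 f; have := H.
move: (ip f f) (ip f g) (ip g g) => A B C {}H A0.
rewrite le_eqVlt => /orP[/eqP C0|C0]; last first.
  have := H (- B / C); have -> : A + 2 * (- B / C) * B + (- B / C) ^+ 2 * C = (A * C - B ^+ 2) / C.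
    by field; rewrite gt_eqF.
  by rewrite pmulr_lge0 ?invr_gt0 // subr_ge0.
have [->|B0] := eqVneq B 0; first by rewrite expr0n mulr_ge0 // -C0.
have := H (- (A + 1) / (2 * B)); rewrite -C0.
have -> : A + 2 * (- (A + 1) / (2 * B)) * B + (- (A + 1) / (2 * B)) ^+ 2 * 0 = - 1.
  by field.
by rewrite lerNr oppr0 ler10.
Qed.

Lemma nsq_add_le f g : L2m f -> L2m g ->
  ip (fun x => f x + g x) (fun x => f x + g x) <= 2 * ip f f + 2 * ip g g.
Proof.
move=> lf lg; have := ip_ge0 (fun x => f x + (-1) * g x).
rewrite nsq_lin //; have := nsq_lin 1 lf lg.
have -> : (fun x => f x + 1 * g x) = (fun x => f x + g x) by apply/funext => x; rewrite mul1r.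
by move=> ->; move: (ip f f) (ip f g) (ip g g) => *; nra.
Qed.

Lemma nsq_sub_le f g h : L2m f -> L2m g -> L2m h ->
  ip (fun x => f x - h x) (fun x => f x - h x) <=
  2 * ip (fun x => f x - g x) (fun x => f x - g x) +
  2 * ip (fun x => g x - h x) (fun x => g x - h x).
Proof.
move=> lf lg lh; apply: le_trans (nsq_add_le (L2_subr sM MM lf lg) (L2_subr sM MM lg lh)).
by rewrite le_eqVlt; apply/orP; left; apply/eqP; apply: eq_ip => x _; ring.
Qed.

Lemma nsq_subC f g : ip (fun x => f x - g x) (fun x => f x - g x) =
  ip (fun x => g x - f x) (fun x => g x - f x).
Proof. by apply: eq_Rintegral => x _; ring. Qed.

Lemma nsq0_ae f : L2m f -> ip f f = 0 -> {ae mu, forall x, D x -> f x = 0}.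
Proof.
move=> lf f0; have [/wrt_measurable_fun mf _] := lf.
have mf2 : measurable_fun D (fun x => (f x ^+ 2)%:E).
  by apply/measurable_EFinP; exact: measurable_funX.
have /(ae_eq_integral_abs mu mD mf2) : (\int[mu]_(x in D) `|(f x ^+ 2)%:E|)%E = 0%E.
  transitivity (sqint f); last by rewrite sqintE // f0.
  by apply: eq_integral => x _; rewrite /= ger0_norm ?sqr_ge0.
apply: filterS => x /[apply] -[/eqP]; rewrite sqrf_eq0 => /eqP //.
Qed.

Lemma ip_cvg (k : nat -> U -> R) g h : (forall n, L2m (k n)) -> L2m g -> L2m h ->
  ip (fun x => k n x - g x) (fun x => k n x - g x) @[n --> \oo] --> 0 ->
  ip (k n) h @[n --> \oo] --> ip g h.
Proof.
move=> lk lg lh kg; apply/subr_cvg0.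
have kg2 : (ip (k n) h - ip g h) ^+ 2 @[n --> \oo] --> 0.
  apply: (@squeeze_cvgr _ _ _ _ (fun=> 0) (fun n =>
    ip (fun x => k n x - g x) (fun x => k n x - g x) * ip h h)).
  - near=> n; rewrite sqr_ge0 /= -ip_sub //; apply: CauchySchwarz => //.
    exact: L2_subr.
  - exact: cvg_cst.
  - by rewrite -(mul0r (ip h h)); apply: cvgM => //; exact: cvg_cst.
apply/norm_cvg0P.
have := cvg_comp _ _ kg2 (@sqrt_continuous R 0); rewrite sqrtr0.
by apply: cvg_trans; apply: near_eq_cvg; near=> n; rewrite /= sqrtr_sqr.
Unshelve. all: by end_near. Qed.

Lemma fatou_nsq (k : nat -> U -> R) g (C : R) : (forall n, L2m (k n)) ->
  measurable_fun D g ->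
  {ae mu, forall x, D x -> k n x @[n --> \oo] --> g x} ->
  (\forall n \near \oo, ip (k n) (k n) <= C) -> (sqint g <= C%:E)%E.
Proof.
move=> lk mg kg kC.
have mk n : measurable_fun D (k n) by apply/wrt_measurable_fun; case: (lk n).
pose F n x := (k n x ^+ 2)%:E.
have mF n : measurable_fun D (F n) by apply/measurable_EFinP; exact: measurable_funX.
have F0 n x : D x -> (0 <= F n x)%E by rewrite lee_fin sqr_ge0.
have -> : sqint g = (\int[mu]_(x in D) limn_einf (F ^~ x))%E.
  apply: ae_eq_integral => //.
  - by apply/measurable_EFinP; exact: measurable_funX.
  - have -> : (fun x => limn_einf (F ^~ x)) = (fun x => - limn_esup (fun n => - F n x))%E.
      by apply/funext => x; rewrite -limn_einfN; congr limn_einf; apply/funext => n;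
        rewrite /F /= opprK.
    apply: measurableT_comp => //; apply: measurable_fun_limn_esup => n.
    exact: measurableT_comp.
  - apply: filterS kg => x /[apply] kx; apply/esym.
    have := @cvg_limn_einf_sup _ (F ^~ x) (g x ^+ 2)%:E; case=> //.
    by apply: cvg_EFin; [near=> n|rewrite expr2; under eq_fun do rewrite /F /= expr2; exact: cvgM].
apply: le_trans (fatou mu mD mF F0) _.
rewrite limn_einf_lim; apply: lime_le; first exact: is_cvg_einfs.
case: kC => N _ NC; exists N => // n /= Nn.
apply: (@ereal_inf_le _ _ _); exists (\int[mu]_(x in D) F n x)%E; first by exists n => /=.
rewrite -[X in (X <= _)%E]/(sqint (k n)) sqintE // lee_fin.
exact: NC.
Unshelve. all: by end_near. Qed.

(** With weights 4^n the integrals still sum up, so the weighted series is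
    almost everywhere finite and its value bounds every term. *)
Lemma ae_fast (f : nat -> U -> \bar R) : (forall n, measurable_fun D (f n)) ->
  (forall n x, D x -> (0 <= f n x)%E) ->
  (forall n, (\int[mu]_(x in D) f n x <= ((8 ^+ n)^-1)%:E)%E) ->
  {ae mu, forall x, D x -> exists C : R, 0 <= C /\ forall n, (f n x <= (C / 4 ^+ n)%:E)%E}.
Proof.
move=> mf f0 fi.
pose F n x := ((4 ^+ n)%:E * f n x)%E.
have F0 n x : D x -> (0 <= F n x)%E by move=> Dx; rewrite mule_ge0 ?f0 // lee_fin exprn_ge0.
have mF n : measurable_fun D (F n) by apply: emeasurable_funM.
pose s x := (\sum_(0 <= n <oo) F n x)%E.
have s0 x : D x -> (0 <= s x)%E by move=> Dx; apply: nneseries_ge0 => n _ _; exact: F0.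
have ms : measurable_fun D s by apply: ge0_emeasurable_sum => // n x Dx _; exact: F0.
have is_ : mu.-integrable D s.
  apply/integrableP; split => //.
  under eq_integral => x /set_mem Dx do rewrite gee0_abs ?s0 //.
  rewrite integral_nneseries //.
  have /le_lt_trans : (\sum_(0 <= n <oo) (\int[mu]_(x in D) F n x) <= \sum_(0 <= n <oo) (2 / (2 ^
    n.+1)%:R)%:E)%E.
    apply: lee_nneseries => [n _ _|n _]; first by apply: integral_ge0 => x Dx; exact: F0.
    rewrite ge0_integralZl // ?lee_fin ?exprn_ge0 //; last by move=> x Dx; exact: f0.
    apply: le_trans (lee_wpmul2l _ (fi n)) _; first by rewrite lee_fin exprn_ge0.
    rewrite -EFinM lee_fin natrX exprS.
    have -> : 8 = 4 * 2 :> R by ring.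
    rewrite exprMn; have := exprn_gt0 n (ltr0n R 2); have := exprn_gt0 n (ltr0n R 4).
    set a := 4 ^+ n; set b := 2 ^+ n => a0 b0.
    by rewrite le_eqVlt; apply/orP; left; apply/eqP; field; rewrite !gt_eqF.
  by apply; apply: le_lt_trans (epsilon_trick0 _ _) _; rewrite ?ltry.
apply: filterS (integrable_ae mD is_) => x + Dx => /(_ Dx) sfin.
exists (fine (s x)); split; first by apply: fine_ge0; exact: s0.
move=> n; have p4 : 0 < 4 ^+ n :> R by rewrite exprn_gt0.
rewrite mulrC EFinM fineK // -[X in (X <= _)%E](@mul1e _ (f n x)).
have -> : 1%E = ((4 ^+ n)^-1%:E * (4 ^+ n)%:E)%E :> \bar R by rewrite -EFinM mulVf ?gt_eqF.
rewrite -muleA; apply: lee_wpmul2l; first by rewrite lee_fin invr_ge0 ltW.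
rewrite -[X in (X <= _)%E]/(F n x).
have := @nneseries_lim_ge _ (F ^~ x) xpredT 0 n.+1 (fun m _ _ => F0 m x Dx).
apply: le_trans; rewrite big_nat_recr //= leeDr //.
by apply: sume_ge0 => i _; exact: F0.
Qed.

Section complete.
Variable S : set (set U).
Hypotheses (sS : sigma_algebra D S) (SM : S `<=` M).

(** The superior limit is an S-measurable function that agrees with the limit
    wherever the latter exists. *)
Lemma wrt_ae_lim (k : nat -> U -> R) : (forall n, measurable_wrt D S (k n)) ->
  exists g, measurable_wrt D S g /\ forall x, D x -> cvgn (k ^~ x) -> k n x @[n --> \oo] --> g x.
Proof.
move=> mk.
exists (fun x => fine (limn_esup (fun n => (k n x)%:E))); split; last first.
  move=> x Dx cx; have := @cvg_limn_einf_sup _ (fun n => (k n x)%:E) (limn (k ^~ x))%:E.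
  by case=> [|_ ->] //; apply: cvg_EFin => //; near=> n.
apply/(measurable_wrtE sS).
pose US := g_sigma_algebraType (trace_system D S).
apply: (@measurableT_comp _ _ _ US (\bar R) R) => //.
apply: (@measurable_fun_limn_esup _ US R D (fun n x => (k n x)%:E)) => n.
by apply/measurable_EFinP/(measurable_wrtE sS).
Unshelve. all: by end_near. Qed.

(** The Riesz-Fischer theorem for geometrically decreasing increments: such a
    sequence converges almost everywhere, and Fatou's lemma turns the pointwise
    limit into a limit in L2. *)
Lemma L2_complete (k : nat -> U -> R) : (forall n, L2 S (k n)) ->
  (forall n, ip (fun x => k n.+1 x - k n x) (fun x => k n.+1 x - k n x) <= (8 ^+ n)^-1) ->
  exists g, L2 S g /\
    ip (fun x => k n x - g x) (fun x => k n x - g x) @[n --> \oo] --> 0.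
Proof.
move=> lk kf.
have lkm n : L2m (k n) by exact: L2_meas (lk n).
have mk n : measurable_fun D (k n) by apply/wrt_measurable_fun; case: (lkm n).
have ldm n m : L2m (fun x => k m x - k n x) by exact: L2_subr.
have [g [mg kg]] : exists g, measurable_wrt D S g /\
    forall x, D x -> cvgn (k ^~ x) -> k n x @[n --> \oo] --> g x.
  by apply: wrt_ae_lim => n; case: (lk n).
have mgD : measurable_fun D g by apply/wrt_measurable_fun => B mB; apply: SM; exact: mg.
have kcvg : {ae mu, forall x, D x -> k n x @[n --> \oo] --> g x}.
  have := @ae_fast (fun n x => ((k n.+1 x - k n x) ^+ 2)%:E).
  case=> [n|n x Dx|n|N [mN N0 HN]].
  - by apply/measurable_EFinP; apply: measurable_funX; exact: measurable_funB.
  - by rewrite lee_fin sqr_ge0.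
  - rewrite -[X in (X <= _)%E]/(sqint (fun x => k n.+1 x - k n x)) sqintE //.
    by rewrite lee_fin.
  exists N; split=> // x /= nx; apply: HN => /= Hx; apply: nx => Dx.
  apply: kg => //; have [C [C0 HC]] := Hx Dx.
  apply: (fast_cvg (C := Num.sqrt C) _).1 => n.
  rewrite -(@ler_pXn2r _ 2) ?nnegrE ?divr_ge0 ?sqrtr_ge0 ?exprn_ge0 //.
  have := HC n; rewrite lee_fin real_normK ?num_real // expr_div_n sqr_sqrtr //.
  by rewrite -exprM mulnC exprM; congr (_ <= _ / _ ^+ n); ring.
have L n m : ip (fun x => k (n + m)%N x - k n x) (fun x => k (n + m)%N x - k n x) <= 4 / 2 ^+ n.
  suff : ip (fun x => k (n + m)%N x - k n x) (fun x => k (n + m)%N x - k n x) <= 4 / 8 ^+ n.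
    move/le_trans; apply; apply: ler_wpM2l => //.
    by rewrite lef_pV2 ?posrE ?exprn_gt0 // lerXn2r ?nnegrE // ler_nat.
  elim: m n => [|m IH] n.
    rewrite addn0 (@eq_ip _ (fun=> 0) _ (fun=> 0)) ?ip0l ?divr_ge0 ?exprn_ge0 // => x _;
      exact: subrr.
  have := @nsq_sub_le (k (n + m.+1)%N) (k n.+1) (k n) (lkm _) (lkm _) (lkm _).
  move/le_trans; apply; have := kf n; have := IH n.+1.
  rewrite addSnnS exprS invfM => h1 h2.
  have p : 0 < (8 ^+ n)^-1 :> R by rewrite invr_gt0 exprn_gt0.
  move: (ip _ _) (ip _ _) h1 h2 => a b h1 h2.
  set q := (8 ^+ n)^-1 in h1 h2 p *.
  lra.
have Lg n : (sqint (fun x => (k n x - g x)%R) <= (4 / 2 ^+ n)%:E)%E.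
  apply: (@fatou_nsq (fun m x => k n x - k (n + m)%N x)) => //.
  - exact: measurable_funB.
  - apply: filterS kcvg => x /[apply] kx; apply: cvgB; first exact: cvg_cst.
    by under eq_fun do rewrite addnC; rewrite -(cvg_shiftn n) in kx.
  - by near=> m; rewrite nsq_subC.
have lg : L2 S g.
  have lkg : L2m (fun x => k 0 x - g x).
    split; first by apply/wrt_measurable_fun; exact: measurable_funB.
    exact: le_lt_trans (Lg 0%N) (ltry _).
  split=> //; suff [] : L2m g by [].
  apply: (L2_eq _ (L2_subr sM MM (lkm 0%N) lkg)).
  by move=> x _; rewrite opprB addrC subrK.
exists g; split=> //.
have lgm : L2m g by exact: L2_meas lg.
apply: (@squeeze_cvgr _ _ _ _ (fun=> 0) (fun n => 4 / 2 ^+ n)).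
- near=> n; rewrite ip_ge0 /= -lee_fin -sqintE //; exact: L2_subr.
- exact: cvg_cst.
- exact: cvg_inv2X.
Unshelve. all: by end_near. Qed.

(** Elements are functions rather than classes; closedness under L2 limits
    makes K stable under almost everywhere equality of S-measurable functions
    (closed_subspace_ae). *)
Definition closed_subspace (K : set (U -> R)) : Prop :=
  [/\ K `<=` L2 S, K (fun=> 0),
      forall a f g, K f -> K g -> K (fun x => f x + a * g x) &
      forall k g, (forall n, K (k n)) -> L2 S g ->
        ip (fun x => k n x - g x) (fun x => k n x - g x) @[n --> \oo] --> 0 -> K g].

(** The projection is the limit of a minimising sequence, chosen to converge
    fast. *)
Lemma projection_exists (K : set (U -> R)) f : closed_subspace K -> L2m f ->
  exists g, K g /\ forall k, K k -> ip (fun x => f x - g x) k = 0.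
Proof.
move=> [KL K0 Klin Kcl] lf.
have KLm k : K k -> L2m k by move=> /KL; exact: L2_meas.
pose E := [set r | exists2 k, K k & r = ip (fun x => f x - k x) (fun x => f x - k x)].
have E0 : has_inf E.
  split; first by exists (ip (fun x => f x - 0) (fun x => f x - 0)); exists (fun=> 0).
  by exists 0 => _ [k _ ->]; exact: ip_ge0.
pose del := inf E.
have delE k : K k -> del <= ip (fun x => f x - k x) (fun x => f x - k x).
  by move=> Kk; apply: ge_inf; [case: E0|exists k].
have Hk n : exists k, K k /\ ip (fun x => f x - k x) (fun x => f x - k x) <= del + (4 * 8 ^+ n)^-1.
  have e0 : 0 < (4 * 8 ^+ n)^-1 :> R by rewrite invr_gt0 mulr_gt0 // exprn_gt0.
  have [r [k Kk ->] rk] := inf_adherent e0 E0.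
  by exists k; split=> //; exact: ltW.
pose k n := sval (cid (Hk n)).
have Kk n : K (k n) by case: (svalP (cid (Hk n))).
have kd n : ip (fun x => f x - k n x) (fun x => f x - k n x) <= del + (4 * 8 ^+ n)^-1.
  by case: (svalP (cid (Hk n))).
have lfk h : K h -> L2m (fun x => f x - h x) by move=> /KLm; exact: L2_subr.
(* the parallelogram identity makes a minimising sequence Cauchy *)
have par h1 h2 : K h1 -> K h2 ->
    ip (fun x => h1 x - h2 x) (fun x => h1 x - h2 x) =
    2 * ip (fun x => f x - h1 x) (fun x => f x - h1 x) +
    2 * ip (fun x => f x - h2 x) (fun x => f x - h2 x) -
    4 * ip (fun x => f x - (2^-1 * h1 x + 2^-1 * h2 x)) (fun x =>
      f x - (2^-1 * h1 x + 2^-1 * h2 x)).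
  move=> K1 K2.
  have l1 := lfk _ K1; have l2 := lfk _ K2.
  have := nsq_lin (-1) l1 l2; have := nsq_lin 1 l1 l2.
  rewrite (@eq_ip _ (fun x => 2 * (f x - (2^-1 * h1 x + 2^-1 * h2 x))) _
     (fun x => 2 * (f x - (2^-1 * h1 x + 2^-1 * h2 x)))); try by move=> x _; field.
  have lm : L2m (fun x => (f x - (2^-1 * h1 x + 2^-1 * h2 x))).
    by apply: L2_subr => //; apply: L2_add => //; apply: L2_scale => //; exact: KLm.
  rewrite ip_scale //; last exact: L2_scale.
  rewrite ipC ip_scale // => h3.
  rewrite (@eq_ip _ (fun x => -1 * (h1 x - h2 x)) _ (fun x => -1 * (h1 x - h2 x)));
    try by move=> x _; ring.
  have ld : L2m (fun x => (h1 x - h2 x)) by apply: L2_subr => //; exact: KLm.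
  rewrite ip_scale //; last exact: L2_scale.
  rewrite ipC ip_scale // => h4.
  by nra.
have kf n : ip (fun x => k n.+1 x - k n x) (fun x => k n.+1 x - k n x) <= (8 ^+ n)^-1.
  rewrite par //.
  have Kmid : K (fun x => 2^-1 * k n.+1 x + 2^-1 * k n x).
    have := Klin (2^-1) _ _ (Klin (2^-1) _ _ K0 (Kk n.+1)) (Kk n).
    by congr K; apply/funext => x; rewrite add0r.
  have := delE _ Kmid; have := kd n; have := kd n.+1.
  rewrite exprS !invfM; move: (ip _ _) (ip _ _) (ip _ _) => a b c h1 h2 h3.
  have p : 0 < (8 ^+ n)^-1 :> R by rewrite invr_gt0 exprn_gt0.
  set q := (8 ^+ n)^-1 in h1 h2 h3 p *; nra.
have [g [lg kg]] := L2_complete (fun n => KL _ (Kk n)) kf.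
have lgm : L2m g by exact: L2_meas lg.
have Kg : K g by exact: Kcl kg.
exists g; split=> // h Kh.
have lh := KLm _ Kh.
have kgf : ip (fun x => f x - k n x) h @[n --> \oo] --> ip (fun x => f x - g x) h.
  apply: ip_cvg => // [n||]; [exact: lfk|exact: lfk|].
  apply: cvg_trans kg; apply: near_eq_cvg; near=> n.
  by rewrite nsq_subC; apply: eq_ip => x _; ring.
(* minimality compared with g + t h, in the limit *)
have key t : 2 * t * ip (fun x => f x - g x) h <= t ^+ 2 * ip h h.
  have c1 : del + (4 * 8 ^+ n)^-1 - 2 * t * ip (fun x => f x - k n x) h + t ^+ 2 * ip h h
      @[n --> \oo] --> del + 0 - 2 * t * ip (fun x => f x - g x) h + t ^+ 2 * ip h h.
    apply: cvgD; last exact: cvg_cst.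
    apply: cvgB; last by apply: cvgM => //; exact: cvg_cst.
    apply: cvgD; first exact: cvg_cst.
    have := @cvg_geometric R (4^-1) (8^-1).
    rewrite normfV ger0_norm // invf_lt1 // ltr1n => /(_ erefl).
    by rewrite /geometric /=; under eq_fun do rewrite exprVn -invfM.
  have : del <= del + 0 - 2 * t * ip (fun x => f x - g x) h + t ^+ 2 * ip h h.
    apply: (cvgr_to_ge c1); near=> n.
    have := delE _ (Klin t _ _ (Kk n) Kh).
    move/le_trans; apply; have := nsq_lin (- t) (lfk _ (Kk n)) lh.
    rewrite (@eq_ip _ (fun x => f x - (k n x + t * h x)) _ (fun x => f x - (k n x + t * h x)));
      try by move=> x _; ring.
    by move=> ->; have := kd n; nra.
  by lra.
have := key 1; have := ip_ge0 h.
move: (ip _ h) (ip h h) key => b c key c0 _.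
have [//|b0] := eqVneq b 0.
have [c00|c00] := eqVneq c 0.
  by have := key b; rewrite c00; nra.
have cp : 0 < c by rewrite lt_neqAle eq_sym c00.
have b2 : 0 < b ^+ 2 by rewrite exprn_even_gt0.
have := key (b / c).
have -> : 2 * (b / c) * b = 2 * b ^+ 2 / c by field.
have -> : (b / c) ^+ 2 * c = b ^+ 2 / c by field.
by rewrite ler_pM2r ?invr_gt0 //; lra.
Unshelve. all: by end_near. Qed.

(** A constant sequence converges in L2 to every S-measurable function almost
    everywhere equal to its value. *)
Lemma closed_subspace_ae (K : set (U -> R)) f g : closed_subspace K -> K g -> L2 S f ->
  {ae mu, forall x, D x -> f x = g x} -> K f.
Proof.
move=> [KL K0 Klin Kcl] Kg lf fg; apply: (Kcl (fun=> g)) => //.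
have lg : L2m g by apply: L2_meas (KL _ Kg).
have lfm : L2m f by apply: L2_meas lf.
have l0 : L2m (fun=> 0) by exact: L2_0.
suff -> : (fun n : nat => ip (fun x => g x - f x) (fun x =>
  g x - f x)) = (fun=> 0) by exact: cvg_cst.
apply/funext => _.
have ld : L2m (fun x => g x - f x) by exact: L2_subr.
have [/wrt_measurable_fun md _] := ld.
rewrite -[RHS](ip0l (fun x => g x - f x)); apply: ip_ae => //.
by apply: filterS fg => x /[apply] ->; rewrite subrr.
Qed.

Lemma integrable_mul_set f (A : set U) : measurable A -> (mu (D `&` A) < +oo)%E -> L2m f ->
  mu.-integrable (D `&` A) (EFin \o f).
Proof.
move=> mA muA lf.
have l1 : L2m (\1_A : U -> R).
  split; first by apply: wrt_indic => //; exact: measurableI.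
  rewrite /sqint (_ : (fun x => _) = (EFin \o \1_A)); last first.
    by apply/funext => x /=; rewrite indicE; case: (_ \in _); rewrite ?expr1n ?expr0n.
  by rewrite integral_indic // setIC.
have := integrable_mul lf l1.
move/(integrableS mD (measurableI _ _ mD mA) (@subIsetl _ _ _)).
apply: eq_integrable; first exact: measurableI.
by move=> x /set_mem [_ Ax]; rewrite /= indicE mem_set // mulr1.
Qed.

Lemma ip_indic f (A : set U) : measurable A -> L2m f ->
  ip f (\1_A) = \int[mu]_(x in D `&` A) f x.
Proof.
move=> mA lf; rewrite Rintegral_mkcondr; apply: eq_Rintegral => x _.
by rewrite patchE indicE; case: (x \in A); rewrite ?mulr1 ?mulr0.
Qed.

End complete.
End L2_spaces.

(** * Monotone class arguments *)

Section pi_lambda_integral.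
Context {d : measure_display} {U : measurableType d} {R : realType}.
Variables (mu : {measure set U -> \bar R}) (D : set U).
Hypothesis mD : measurable D.

Lemma g_sigma_sub (G : set (set U)) : (forall A, G A -> A `<=` D) ->
  forall A, <<s D, G>> A -> A `<=` D.
Proof.
move=> GD A sA; apply: (sA [set X | X `<=` D]); split => //; split.
- by move=> x [].
- by move=> B _ x [].
- by move=> F FD x [n _ Fx]; exact: FD Fx.
Qed.

Lemma g_sigma_measurable (G : set (set U)) : G `<=` measurable ->
  <<s D, G>> `<=` measurable.
Proof. by move=> GM; apply: smallest_sub => //; exact: sigma_algebra_M. Qed.

Lemma EFin_Rint0 (A : set U) (r : U -> R) : measurable A -> mu.-integrable A (EFin \o r) ->
  \int[mu]_(x in A) r x = 0 -> (\int[mu]_(x in A) (r x)%:E = 0)%E.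
Proof.
by move=> mA ir r0; rewrite -(fineK (integrable_fin_num mA ir)) -[fine _]/(Rintegral mu A r) r0.
Qed.

(** The sets over which a given integrable function has integral zero are
    stable under proper differences and increasing unions. *)
Lemma integral0_pi_lambda (G : set (set U)) (r : U -> R) :
  setI_closed G -> (forall A, G A -> A `<=` D) -> G `<=` measurable ->
  mu.-integrable D (EFin \o r) ->
  \int[mu]_(x in D) r x = 0 -> (forall A, G A -> \int[mu]_(x in A) r x = 0) ->
  forall A, <<s D, G>> A -> \int[mu]_(x in A) r x = 0.
Proof.
move=> IG GD GM ir rD rG A sA.
pose H := [set A | [/\ A `<=` D, measurable A & \int[mu]_(x in A) r x = 0]].
suff : H A by case.
apply: (@lambda_system_subset _ G IG D H) => //; last exact: g_sigma_sub.
- split.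
  + by move=> B [].
  + by split.
  + move=> B C CB [BD mB rB] [CD mC rC].
    have mBC : measurable (B `\` C) by exact: measurableD.
    split=> //; first by move=> x [/BD].
    have BE : B = C `|` (B `\` C) by rewrite setDUK.
    have := @Rintegral_setU _ _ _ mu C (B `\` C) r mC mBC.
    rewrite -BE rB rC add0r => -> //.
      by apply: (integrableS mD).
    by apply/disj_setPS => x [? []].
  + move=> F ndF HF.
    have FD n : F n `<=` D by case: (HF n).
    have mF n : measurable (F n) by case: (HF n).
    have rF n : \int[mu]_(x in F n) r x = 0 by case: (HF n).
    split; [by move=> x [n _ /FD]|exact: bigcupT_measurable|].
    rewrite /Rintegral -eq_bigcup_seqD integral_bigcup //.
    * rewrite eseries0 // => n _ _.
      case: n => [|n]; rewrite /seqD.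
        by apply: EFin_Rint0 => //; exact: (integrableS mD).
      have ? : measurable (F n.+1 `\` F n) by exact: measurableD.
      apply: EFin_Rint0 => //; first by apply: (integrableS mD) => // x [/FD].
      have BE : F n.+1 = F n `|` (F n.+1 `\` F n) by rewrite setDUK //; exact/subsetPset/ndF.
      have := @Rintegral_setU _ _ _ mu (F n) (F n.+1 `\` F n) r (mF n).
      rewrite -BE !rF add0r => -> //.
        by apply: (integrableS mD).
      by apply/disj_setPS => x [? []].
    * exact: trivIset_seqD.
    * move=> [|n]; rewrite /seqD //; exact: measurableD.
    * rewrite eq_bigcup_seqD; apply: (integrableS mD) => //; first exact: bigcupT_measurable.
      by move=> x [n _ /FD].
- by move=> B GB; split; [exact: GD|exact: GM|exact: rG].
Qed.

(** It suffices to integrate over the sets where r is nonnegative and where r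
    is negative. *)
Lemma ae0_of_integral0 (S : set (set U)) (r : U -> R) :
  sigma_algebra D S -> S `<=` measurable -> (forall A, S A -> A `<=` D) ->
  mu.-integrable D (EFin \o r) -> measurable_wrt D S r ->
  (forall A, S A -> \int[mu]_(x in A) r x = 0) -> {ae mu, forall x, D x -> r x = 0}.
Proof.
move=> sS SM SD ir mr rS.
have mrD : measurable_fun D (fun x => (r x)%:E) by case/integrableP : (ir).
pose A := D `&` r @^-1` `[0, +oo[%classic.
have SA : S A by apply: mr.
have SB : S (D `\` A) by case: sS => _ + _; apply.
have mA := SM _ SA; have mB := SM _ SB.
have iA : mu.-integrable A (EFin \o r) by apply: (integrableS mD) => //; exact: SD.
have iB : mu.-integrable (D `\` A) (EFin \o r) by apply: (integrableS mD) => // x [].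
suff : (\int[mu]_(x in D) `|(r x)%:E|)%E = 0%E.
  by move/(ae_eq_integral_abs mu mD mrD); apply: filterS => x /[apply] -[].
have DE : D = A `|` (D `\` A) by rewrite setDUK // => x [].
have rA0 : (\int[mu]_(x in A) `|(r x)%:E|)%E = 0%E.
  rewrite -(EFin_Rint0 mA iA (rS _ SA)); apply: eq_integral => x /set_mem [_ /=].
  by rewrite in_itv /= andbT => r0; rewrite ger0_norm.
have rB0 : (\int[mu]_(x in D `\` A) `|(r x)%:E|)%E = 0%E.
  have : (\int[mu]_(x in D `\` A) - (r x)%:E)%E = 0%E.
    by rewrite integralN ?(EFin_Rint0 mB iB (rS _ SB)) ?oppe0 //; exact: integrable_add_def.
  move=> <-; apply: eq_integral => x /set_mem [Dx nA].
  have r0 : r x < 0 by rewrite ltNge; apply/negP => r0; apply: nA; split => //=;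
    rewrite in_itv /= r0.
  by rewrite /= ltr0_norm.
rewrite DE ge0_integral_setU //.
- by rewrite rA0 rB0 adde0.
- by rewrite -DE; apply: measurableT_comp.
- by apply/disj_setPS => x [? []].
Qed.

End pi_lambda_integral.

Section density.
Context {d : measure_display} {U : measurableType d} {R : realType}.
Variables (mu : {measure set U -> \bar R}) (D : set U).
Hypothesis mD : measurable D.

(** If f is in L2 and g is its projection on K, then f - g is orthogonal to
    the indicators in K; on each E n it integrates to zero over a pi-system,
    hence it vanishes almost everywhere. *)
Lemma density (G : set (set U)) (E : nat -> set U) (K : set (U -> R)) :
  let S := <<s D, G>> in
  setI_closed G -> (forall A, G A -> A `<=` D) -> G `<=` measurable ->
  closed_subspace mu D S K ->
  (forall n, S (E n)) -> (forall n, (mu (E n) < +oo)%E) -> D `<=` \bigcup_n E n ->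
  (forall n A, G A -> K (\1_(A `&` E n))) -> (forall n, K (\1_(E n))) ->
  L2 mu D S `<=` K.
Proof.
move=> S IG GD GM Kc SE muE DE KG KE f lf; have [KL K0 Klin Kcl] := Kc.
have SD : forall A, S A -> A `<=` D by exact: g_sigma_sub.
have sS : sigma_algebra D S by exact: smallest_sigma_algebra.
have SM : S `<=` measurable by exact: g_sigma_measurable.
have lfm : L2 mu D measurable f by apply: L2_meas lf.
have [g [Kg gK]] := projection_exists mD sS SM Kc lfm.
have lgm : L2 mu D measurable g by apply: L2_meas (KL _ Kg).
pose r x := f x - g x.
have lr : L2 mu D S r by apply: L2_subr => //; exact: KL.
have lrm : L2 mu D measurable r by apply: L2_meas lr.
have mE n : measurable (E n) by exact: SM.
have ED n : D `&` E n = E n by apply/setIidPr; exact: SD.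
have l1 A n : measurable A -> L2 mu D measurable (\1_(A `&` E n) : U -> R).
  move=> mA; split; first by apply: wrt_indic; [exact: sigma_algebra_M|do ! apply: measurableI].
  rewrite /sqint (_ : (fun x => _) = (EFin \o \1_(A `&` E n))); last first.
    by apply/funext => x /=; rewrite indicE; case: (_ \in _); rewrite ?expr1n ?expr0n.
  rewrite integral_indic //; last exact: measurableI.
  apply: le_lt_trans (muE n); apply: le_measure; rewrite ?inE //; last by move=> x [[]].
  by do ! apply: measurableI.
have rE n : {ae mu, forall x, D x -> r x * \1_(E n) x = 0}.
  have irE : mu.-integrable D (EFin \o (fun x => r x * \1_(E n) x)).
    by apply: integrable_mul => //; rewrite -(setTI (E n)); exact: l1.
  apply: (ae0_of_integral0 mD sS SM SD irE).
    apply: wrt_mul => //; first by case: lr.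
    by apply: wrt_indic => //; rewrite ED.
  have E0 A : A `<=` D -> K (\1_(A `&` E n)) -> \int[mu]_(x in A) (r x * \1_(E n) x) = 0.
    move=> AD KA; rewrite -(gK _ KA) /ip -{1}(setIidr AD) Rintegral_mkcondr.
    apply: eq_Rintegral => x _; rewrite patchE !indicE in_setI.
    by case: (x \in A); rewrite ?andbF //= mulr0.
  apply: (integral0_pi_lambda mD IG GD GM irE).
    by apply: E0 => //; rewrite ED.
  by move=> A GA; apply: E0; [exact: GD|exact: KG].
apply: (closed_subspace_ae mD SM Kc Kg lf).
have := ae_foralln rE; apply: filterS => x Hx Dx.
have [n _ En] := DE x Dx.
by have := Hx n Dx; rewrite indicE mem_set // mulr1 => /eqP; rewrite subr_eq0 => /eqP.
Qed.

End density.

(** * Gaussian moments *)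

Section gaussian_moments.
Context {R : realType}.
Notation leb := (@lebesgue_measure R).
Variable s : R.
Hypothesis s0 : 0 < s.
Notation phi := (normal_pdf 0 s).

Lemma phiE x : phi x = normal_peak s * expR (- (x ^+ 2 / (s ^+ 2 *+ 2))).
Proof. by rewrite normal_pdfE ?gt_eqF // /normal_fun subr0 mulNr. Qed.

Lemma phi_even x : phi (- x) = phi x.
Proof. by rewrite !phiE sqrrN. Qed.

Lemma is_derive_phi (x : R) : is_derive x 1 phi (- (x / s ^+ 2) * phi x).
Proof.
rewrite (_ : phi = fun x => normal_peak s * expR (- (x ^+ 2 / (s ^+ 2 *+ 2)))); last first.
  by apply/funext => y; exact: phiE.
apply: is_derive_eq.
rewrite /GRing.scale /= !mulr0 add0r !mulr1.
set e := expR _; set p := normal_peak s.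
have s2 : s != 0 by rewrite gt_eqF.
by field.
Qed.

Variable b : R.
Let F x := - (s ^+ 2) * (x + b) * phi x.
Let f x := (x ^+ 2 + b * x - s ^+ 2) * phi x.

Lemma is_derive_F (x : R) : is_derive x 1 F (f x).
Proof.
have := is_derive_phi x => dp.
apply: is_derive_eq.
rewrite /f /GRing.scale /=.
by field; rewrite gt_eqF.
Qed.

Lemma continuous_phi : continuous phi.
Proof. by apply: continuous_normal_pdf; rewrite gt_eqF. Qed.

Lemma continuous_f : continuous f.
Proof.
move=> x; apply: cvgM; last exact: continuous_phi.
apply: cvgB; last exact: cvg_cst.
apply: cvgD; first exact: exprn_continuous.
by apply: cvgM; [exact: cvg_cst|exact: cvg_id].
Qed.

(** F is a primitive of f. *)
Lemma integral_f n : 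
  (\int[leb]_(x in `[(- n.+1%:R)%R, n.+1%:R]) (f x)%:E = (- (2 * s ^+ 2 * n.+1%:R * phi
    n.+1%:R))%:E)%E.
Proof.
have dF x : derivable F x 1 by case: (is_derive_F x).
have cF x : {for x, continuous F} by apply/differentiable_continuous/derivable1_diffP.
rewrite (@continuous_FTC2 _ f F) //.
- by rewrite -EFinB /F phi_even; congr EFin; ring.
- by rewrite -subr_gt0 opprK addr_gt0.
- by apply: continuous_subspaceT; exact: continuous_f.
- split=> //; [exact: cvg_at_right_filter (cF _)|exact: cvg_at_left_filter (cF _)].
- by move=> x _; rewrite derive1E; apply/derive_val; exact: is_derive_F.
Qed.

Lemma cvg_phi : n.+1%:R * phi n.+1%:R @[n --> \oo] --> (0 : R).
Proof.
apply: (@squeeze_cvgr _ _ _ _ (fun=> 0) (fun n => normal_peak s * (s ^+ 2 *+ 2) * (n.+1%:R)^-1)).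
- near=> n; rewrite mulr_ge0 ?normal_pdf_ge0 //= phiE mulrCA -mulrA.
  apply: ler_wpM2l; first exact: normal_peak_ge0.
  rewrite expRN; set y := n.+1%:R; have y0 : 0 < y :> R by [].
  rewrite ler_pdivrMr ?expR_gt0 // -mulrA.
  have := expR_ge1Dx (y ^+ 2 / (s ^+ 2 *+ 2)).
  have c0 : 0 < s ^+ 2 *+ 2 by rewrite pmulrn_lgt0 // exprn_gt0.
  set c := s ^+ 2 *+ 2 in c0 *; set e := expR _ => h.
  have : y ^+ 2 / c <= e by apply: le_trans h; rewrite lerDr.
  rewrite ler_pdivrMr // => h2.
  by rewrite mulrCA ler_pdivlMl //; move: h2; rewrite expr2 [e * c]mulrC.
- exact: cvg_cst.
- rewrite -[X in _ --> X](mulr0 (normal_peak s * (s ^+ 2 *+ 2))); apply: cvgM; first exact: cvg_cst.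
  exact: cvg_harmonic.
Unshelve. all: by end_near. Qed.

(** The quadratic form times the density is f plus a multiple of the density,
    and the integral of f over [-n, n] tends to zero. Since
    x^2 + b x + b^2 >= 0, monotone convergence gives both the integrability
    and the value. *)
Lemma normal_quadratic :
  (\int[leb]_x ((x ^+ 2 + b * x + b ^+ 2) * phi x)%:E = (s ^+ 2 + b ^+ 2)%:E)%E.
Proof.
pose h x := (x ^+ 2 + b * x + b ^+ 2) * phi x.
pose I n : set R := `[- n.+1%:R, n.+1%:R]%classic.
have h0 x : 0 <= h x.
  by rewrite mulr_ge0 ?normal_pdf_ge0 //; have := sqr_ge0 (x + b); have := sqr_ge0 x; nra.
have mphi : measurable_fun setT phi by exact: measurable_normal_pdf.
have mh : measurable_fun setT h.
  by apply: measurable_funM => //; apply: measurable_funD => //; apply: measurable_funD => //;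
    apply: measurable_funM.
have ndI : {homo I : n m / (n <= m)%N >-> (n <= m)%O}.
  move=> n m nm; apply/subsetPset => x; rewrite /I /= !in_itv /= => /andP[a1 a2].
  have : n.+1%:R <= m.+1%:R :> R by rewrite ler_nat.
  by move=> nm'; apply/andP; split; lra.
have UI : \bigcup_n I n = setT.
  apply/seteqP; split=> // x _; exists (Num.truncn `|x|) => //.
  rewrite /I /= in_itv /= -ler_norml ltW //; exact: truncnS_gt.
have c1 : (\int[leb]_(x in I n) (h x)%:E)%E @[n --> \oo] --> (\int[leb]_x (h x)%:E)%E.
  rewrite -UI; apply: ge0_nondecreasing_set_cvg_integral => //.
  - by move=> n; exact: measurable_itv.
  - by move=> n; apply/measurable_EFinP; exact: measurable_funTS.
  - by move=> n x _; rewrite lee_fin.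
have c2 : (\int[leb]_(x in I n) (phi x)%:E)%E @[n --> \oo] --> 1%E.
  rewrite -(integral_normal_pdf 0 s) -UI; apply: ge0_nondecreasing_set_cvg_integral => //.
  - by move=> n; exact: measurable_itv.
  - by move=> n; apply/measurable_EFinP; exact: measurable_funTS.
  - by move=> n x _; rewrite lee_fin normal_pdf_ge0.
have iphi n : leb.-integrable (I n) (EFin \o phi).
  by apply: (integrableS measurableT _ _ (integrable_normal_pdf 0 s)) => //; exact: measurable_itv.
have if_ n : leb.-integrable (I n) (EFin \o f).
  apply: continuous_compact_integrable; first exact: segment_compact.
  by apply: continuous_subspaceT; exact: continuous_f.
have E n : (\int[leb]_(x in I n) (h x)%:E =
    (- (2 * s ^+ 2 * n.+1%:R * phi n.+1%:R))%:E + (s ^+ 2 + b ^+ 2)%:E * \int[leb]_(x in I n) (phi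
      x)%:E)%E.
  have mI : measurable (I n : set (measurableTypeR R)) by exact: measurable_itv.
  have := integralD mI (if_ n) (integrableZl mI (s ^+ 2 + b ^+ 2) (iphi n)).
  rewrite integralZl // -[X in (X + _)%E](_ : (\int[leb]_(x in I n) (f x)%:E)%E = _) //.
  rewrite integral_f => <-.
  by apply: eq_integral => x _ /=; rewrite -EFinM -EFinD /h /f; congr EFin; ring.
suff c3 : (\int[leb]_(x in I n) (h x)%:E)%E @[n --> \oo] --> (s ^+ 2 + b ^+ 2)%:E.
  exact: cvg_unique c1 c3.
have -> : (fun n => \int[leb]_(x in I n) (h x)%:E)%E = (fun n =>
    (- (2 * s ^+ 2 * n.+1%:R * phi n.+1%:R))%:E + (s ^+ 2 + b ^+ 2)%:E * \int[leb]_(x in I n) (phi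
      x)%:E)%E.
  exact/funext.
have c4 : - (2 * s ^+ 2 * (n.+1%:R * phi n.+1%:R)) @[n --> \oo] --> - (2 * s ^+ 2 * (0 : R)).
  by apply: cvgN; apply: cvgM; [exact: cvg_cst|exact: cvg_phi].
have c5 : ((- (2 * s ^+ 2 * n.+1%:R * phi n.+1%:R))%:E + (s ^+ 2 + b ^+ 2)%:E * \int[leb]_(x in I
  n) (phi x)%:E)%E
    @[n --> \oo] --> ((- (2 * s ^+ 2 * (0 : R)))%:E + (s ^+ 2 + b ^+ 2)%:E * 1)%E.
  apply: cvgeD => //; last exact: cvgeZl.
  apply: cvg_EFin; first by near=> n.
  by under eq_fun do rewrite -mulrA.
by move: c5; rewrite mule1 mulr0 oppr0 add0e.
Unshelve. all: by end_near. Qed.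

End gaussian_moments.

Section density_integral.
Context {R : realType}.
Notation leb := (@lebesgue_measure R).

(** The density of the normal law is almost everywhere its Radon-Nikodym
    derivative. *)
Lemma ge0_integral_normal_prob (m s : R) (f : R -> \bar R) :
  measurable_fun setT f -> (forall x, 0 <= f x)%E ->
  (\int[normal_prob m s]_x f x = \int[leb]_x (f x * (normal_pdf m s x)%:E))%E.
Proof.
move=> mf f0.
have dom := normal_prob_dominates m s.
rewrite -(Radon_Nikodym_SigmaFinite.change_of_variables dom) //.
have mRN := measurable_int _ (Radon_Nikodym_SigmaFinite.f_integrable dom).
have mp : measurable_fun setT (fun x => (normal_pdf m s x)%:E).
  by apply/measurable_EFinP; exact: measurable_normal_pdf.
apply: ae_eq_integral => //.
- exact: emeasurable_funM.
- exact: emeasurable_funM.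
- have : ae_eq leb setT (Radon_Nikodym_SigmaFinite.f (normal_prob m s) leb) (fun x =>
  (normal_pdf m s x)%:E).
    apply: integral_ae_eq => //; first exact: Radon_Nikodym_SigmaFinite.f_integrable.
    by move=> E _ mE; rewrite -Radon_Nikodym_SigmaFinite.f_integral.
  by apply: filterS => x /[apply] ->.
Qed.

(** Restricted to A, the law of X is P(A) times a normal law. The case b = 0 is
    the second moment of X on A; comparing with b = 1 yields the first. *)
Lemma gaussian_quadratic {d} {T : measurableType d} (P : probability T R) (A : set T)
    (X : T -> R) (s b : R) : 0 < s -> measurable A -> measurable_fun setT X ->
  (forall B, measurable B -> P (A `&` X @^-1` B) = P A * normal_prob 0 s B)%E ->
  (\int[P]_(w in A) ((X w) ^+ 2 + b * X w + b ^+ 2)%:E = P A * (s ^+ 2 + b ^+ 2)%:E)%E.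
Proof.
move=> s0 mA mX XA.
pose g (x : R) : \bar R := (x ^+ 2 + b * x + b ^+ 2)%:E.
have g0 x : (0 <= g x)%E.
  by rewrite lee_fin; have := sqr_ge0 (x + b); have := sqr_ge0 x; nra.
have mg : measurable_fun setT g.
  apply/measurable_EFinP; apply: measurable_funD => //.
  by apply: measurable_funD => //; exact: measurable_funM.
have PA : fine (P A) \is Num.nneg by rewrite nnegrE fine_ge0.
have PAE : (fine (P A))%:E = P A by rewrite fineK // fin_num_measure.
transitivity (\int[P]_(w in A) (g \o X) w)%E => //.
have mgX : measurable_fun setT (g \o X) by exact: measurableT_comp.
transitivity (\int[mrestr P mA]_w (g \o X) w)%E.
  rewrite -[in RHS](setUv A) ge0_integral_setU //; last 4 first.
  - exact: measurableC.
  - by rewrite setUv.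
  - by move=> x _; exact: g0.
  - by apply/disj_setPS => x [].
  rewrite [X in (_ + X)%E]null_set_integral; last 3 first.
  - exact: measurableC.
  - exact: measurable_funTS.
  - by rewrite /= /mrestr setICl measure0.
  rewrite adde0; apply: eq_measure_integral => B mB BA.
  by rewrite /= /mrestr setIidl.
rewrite -[setT](preimage_setT X).
rewrite -(@ge0_integral_pushforward _ _ T (measurableTypeR R) R X mX) //.
transitivity (\int[mscale (NngNum PA) (normal_prob 0 s)]_y g y)%E.
  pose X' : {mfun T >-> measurableTypeR R} :=
    HB.pack X (@isMeasurableFun.Build _ _ T (measurableTypeR R) X mX).
  apply: (@eq_measure_integral _ _ _ setT _ (pushforward (mrestr P mA) X') g) => B mB _.
  transitivity (P (X @^-1` B `&` A)); first by [].
  rewrite setIC XA // -{1}PAE; by [].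
rewrite ge0_integral_mscale //= PAE ge0_integral_normal_prob //.
by congr (_ * _)%E; rewrite -normal_quadratic //; apply: eq_integral => x _; rewrite /g EFinM.
Qed.

End density_integral.

(** * Filtrations and predictable steps *)

Section filtrations_and_predictability.
Context {d : measure_display} {T : measurableType d} {R : realType}.
Variable P : probability T R.
Variable G : R -> set (set T).

Record is_filtration : Prop := IsFiltration {
  filt_sigma : forall t, 0 <= t -> sigma_algebra setT (G t);
  filt_mono : forall s t, 0 <= s -> s <= t -> G s `<=` G t;
  filt_meas : forall t, 0 <= t -> G t `<=` measurable;
  filt_null : forall t, 0 <= t -> P.-negligible `<=` G t }.

Notation Q := ((@lebesgue_measure R) \x P)%E.
Notation TD := (@time_domain d T R).

Definition predictable_rectangles : set (set (R * T)) :=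
  [set [set 0] `*` A | A in G 0] `|`
  [set C | exists s t A, [/\ 0 <= s, s <= t, G s A & C = `]s, t] `*` A]].

Lemma measurable_TD : measurable (TD : set (measurableTypeR R * T)).
Proof.
rewrite (_ : TD = `[0, +oo[%classic `*` setT); last first.
  by apply/seteqP; split=> -[t w]; rewrite /time_domain /= in_itv /= andbT // => -[].
by apply: measurableX => //; exact: measurable_itv.
Qed.

Hypothesis FG : is_filtration.

Lemma rectangles_sub A : predictable_rectangles A -> A `<=` TD.
Proof.
case=> [[B _ <-]|[s [t [B [s0 st GB ->]]]]] -[u w] /= []; first by move=> -> _;
  rewrite /time_domain /=.
by rewrite in_itv /= => /andP[su _] _; rewrite /time_domain /= ltW // (le_lt_trans s0).
Qed.

Lemma rectangles_measurable :
  predictable_rectangles `<=` (@measurable _ (measurableTypeR R * T)%type).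
Proof.
move=> A [[B GB <-]|[s [t [B [s0 st GB ->]]]]].
  by apply: measurableX; [exact: measurable_set1|exact: filt_meas GB].
by apply: measurableX; [exact: measurable_itv|exact: filt_meas GB].
Qed.

Lemma filt_I t A B : 0 <= t -> G t A -> G t B -> G t (A `&` B).
Proof.
move=> t0; have := @sigma_algebraP _ setT (G t) (fun X _ => @subsetT _ X).
by move=> [+ _] => /(_ (filt_sigma FG t0)) [_ _ _]; apply.
Qed.

Lemma filt_T t : 0 <= t -> G t setT.
Proof. by move=> t0; rewrite -(setD0 setT); have [G0 GC _] := filt_sigma FG t0; exact: GC. Qed.

Lemma filt_0 t : 0 <= t -> G t set0.
Proof. by move=> t0; have [] := filt_sigma FG t0. Qed.

Lemma filt_C t A : 0 <= t -> G t A -> G t (~` A).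
Proof. by move=> t0 GA; rewrite -setTD; have [_ GC _] := filt_sigma FG t0; exact: GC. Qed.

Lemma rectangles_setI : setI_closed predictable_rectangles.
Proof.
have empty : predictable_rectangles set0.
  right; exists 0, 0, set0; split=> //; first exact: filt_0.
  by apply/seteqP; split=> // -[u w] [].
move=> A B [[A' GA <-]|[s [t [A' [s0 st GA ->]]]]] [[B' GB <-]|[s' [t' [B' [s0' st' GB ->]]]]].
- by left; exists (A' `&` B'); [exact: filt_I|rewrite -setXI setIid].
- rewrite -setXI (_ : [set 0] `&` _ = set0) ?set0X //.
  by rewrite -subset0 => x [/= ->]; rewrite in_itv /= => /andP[]; rewrite ltNge s0'.
- rewrite -setXI (_ : _ `&` [set 0] = set0) ?set0X //.
  by rewrite -subset0 => x [/= + xE]; rewrite xE in_itv /= => /andP[]; rewrite ltNge s0.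
- rewrite -setXI; right; exists (Num.max s s'), (Num.max (Num.max s s') (Num.min t t')),
  (A' `&` B').
  have m0 : 0 <= Num.max s s' by rewrite le_max s0.
  split=> //; [by rewrite le_max lexx| |].
    by apply: filt_I => //; [apply: (filt_mono FG) GA|apply: (filt_mono FG) GB];
      rewrite // le_max lexx ?orbT.
  congr (_ `*` _); apply/seteqP; split=> x /=; rewrite !in_itv /= gt_max le_max le_min.
    by move=> [/andP[-> ->] /andP[-> ->]]; rewrite orbT.
  move=> /andP[/andP[a1 a2] /orP[|/andP[-> ->]]]; last by rewrite a1 a2.
  by rewrite le_max leNgt a1 leNgt a2.
Qed.

Notation Pred := (predictable_sigma G).

Lemma pred_sigma_algebra : sigma_algebra TD Pred.
Proof. exact: smallest_sigma_algebra. Qed.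

Lemma pred_measurable : Pred `<=` (@measurable _ (measurableTypeR R * T)%type).
Proof. apply: g_sigma_measurable; [exact: measurable_TD|exact: rectangles_measurable]. Qed.

Lemma pred_sub A : Pred A -> A `<=` TD.
Proof. by apply: g_sigma_sub => B; exact: rectangles_sub. Qed.

Lemma rect_pred s t A : 0 <= s -> s <= t -> G s A -> Pred (`]s, t] `*` A).
Proof. by move=> s0 st GA; apply: sub_sigma_algebra; right; exists s, t, A. Qed.

Lemma rect0_pred A : G 0 A -> Pred ([set 0] `*` A).
Proof. by move=> GA; apply: sub_sigma_algebra; left; exists A. Qed.

Lemma pred_D A B : Pred A -> Pred B -> Pred (A `\` B).
Proof.
move=> pA pB; have := @sigma_algebraP _ TD Pred pred_sub.
move=> [+ _] => /(_ pred_sigma_algebra) [_ _ _ PI].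
have -> : A `\` B = A `&` (TD `\` B).
  by apply/seteqP; split=> x [Ax nB]; split=> //; [split=> //; exact: pred_sub Ax|case: nB].
by apply: PI => //; have [_ + _] := pred_sigma_algebra; exact.
Qed.

Lemma pred_U A B : Pred A -> Pred B -> Pred (A `|` B).
Proof.
move=> pA pB; rewrite -bigcup2E; have [P0 _ PU] := pred_sigma_algebra.
by apply: PU => -[|[|n]].
Qed.

Lemma pred_T : Pred TD.
Proof. by rewrite -(setD0 TD); have [P0 + _] := pred_sigma_algebra; exact. Qed.

(** The process c 1_]lo, hi]. *)
Definition step (lo hi : R) (c : T -> R) (x : R * T) : R :=
  if lo < x.1 <= hi then c x.2 else 0.

Lemma stepE lo hi c x : step lo hi c x = \1_(`]lo, hi]) x.1 * c x.2.
Proof.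
rewrite /step indicE; case: ifPn => h; first by rewrite mem_set ?mul1r //= in_itv.
by rewrite memNset ?mul0r //= in_itv /=; exact/negP.
Qed.

(** A preimage is a predictable rectangle, to which the complement of
    ]lo, hi] x T is added when the value 0 is allowed. *)
Lemma step_pred lo hi c : 0 <= lo -> lo <= hi -> measurable_wrt setT (G lo) c ->
  measurable_wrt TD Pred (step lo hi c).
Proof.
move=> lo0 lohi mc B mB.
have GB : G lo (c @^-1` B) by rewrite -[_ @^-1` _]setTI; exact: mc.
have RB := rect_pred lo0 lohi GB.
have RT := rect_pred lo0 lohi (filt_T lo0).
case: (pselect (B 0)) => B0.
  rewrite (_ : _ `&` _ = (`]lo, hi] `*` (c @^-1` B)) `|` (TD `\` (`]lo, hi] `*` setT))).
    by apply: pred_U => //; apply: pred_D => //; exact: pred_T.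
  apply/seteqP; split=> [[u w] [Du /= h]|[u w] h].
    move: h; rewrite /step /=; case: ifPn => ulh h; first by left; split=> //=; rewrite in_itv.
    by right; split=> // -[/= + _]; rewrite in_itv /= (negbTE ulh).
  have Du : TD (u, w) by case: h => [|[]//]; exact: pred_sub RB _.
  split=> //; rewrite /step /=; case: h => [[/= ulh cB]|[_ nh]].
    by rewrite in_itv /= in ulh; rewrite ulh.
  by case: ifPn => // ulh; case: nh; split=> //=; rewrite in_itv.
rewrite (_ : _ `&` _ = (`]lo, hi] `*` (c @^-1` B))) //.
apply/seteqP; split=> [[u w] [Du /= h]|[u w] h].
  move: h; rewrite /step /=; case: ifPn => ulh h; last by [].
  by split=> //=; rewrite in_itv.
have Du : TD (u, w) by exact: pred_sub RB _ h.
split=> //; rewrite /step /=; case: h => [/= ulh cB].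
by rewrite in_itv /= in ulh; rewrite ulh.
Qed.

Definition bounded (c : T -> R) : Prop := exists M : R, forall w, `|c w| <= M.

Lemma Q_rect (a b : R) (A : set T) : measurable A -> a <= b ->
  (Q (`]a, b] `*` A) = (b - a)%:E * P A)%E.
Proof.
move=> mA ab; rewrite product_measure1E //.
have lI : ((@lebesgue_measure R) `]a, b] = (b - a)%:E)%E.
  rewrite lebesgue_measure_itv /= lte_fin; case: ltP => // ba.
  by have -> : b = a; [apply/eqP; rewrite eq_le ab ba|rewrite subrr].
by congr (_ * _)%E; exact: lI.
Qed.

Lemma bounded_L2 S c : measurable_wrt setT S c -> S `<=` measurable -> bounded c -> L2 P setT S c.
Proof.
move=> mc SM [M cM]; split=> //.
have mc' : measurable_fun setT c by apply/wrt_measurable_fun => // B mB; apply: SM; exact: mc.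
apply: (@le_lt_trans _ _ (\int[P]_(x in setT) (M ^+ 2)%:E)%E).
  apply: ge0_le_integral => //.
  - by move=> x _; rewrite lee_fin sqr_ge0.
  - by apply/measurable_EFinP; exact: measurable_funX.
  - move=> x _; rewrite lee_fin -(real_normK (num_real (c x))).
    by rewrite lerXn2r ?nnegrE // (le_trans _ (cM x)).
rewrite integral_cst //; apply: lte_mul_pinfty; rewrite ?lee_fin ?sqr_ge0 //.
exact: le_lt_trans (probability_le1 P measurableT) (ltry 1).
Qed.

Lemma L2_mul_bounded S c f : sigma_algebra setT S -> S `<=` measurable ->
  measurable_wrt setT S c -> bounded c -> L2 P setT S f -> L2 P setT S (fun w => c w * f w).
Proof.
move=> sS SM mc [M cM] lf; split; first by apply: wrt_mul => //; case: lf.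
have lf' := L2_meas SM lf; have [/wrt_measurable_fun mf _] := lf'.
have mc' : measurable_fun setT c by apply/wrt_measurable_fun => // B mB; apply: SM; exact: mc.
have [_] : L2 P setT measurable (fun w => M * f w) by apply: L2_scale => //; exact: sigma_algebra_M.
apply: le_lt_trans; apply: sqint_le => //.
- move=> x _; rewrite !exprMn; apply: ler_wpM2r; first exact: sqr_ge0.
  rewrite -(real_normK (num_real (c x))) lerXn2r ?nnegrE // (le_trans _ (cM x)) //.
- by apply: measurable_funM => //; exact: mf.
- by apply: measurable_funM => //; exact: mf.
Qed.

Lemma step_L2 lo hi c : 0 <= lo -> lo <= hi -> measurable_wrt setT (G lo) c -> bounded c ->
  L2 Q TD Pred (step lo hi c).
Proof.
move=> lo0 lohi mc [M cM]; have ms := step_pred lo0 lohi mc; split=> //.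
have mR : measurable (`]lo, hi] `*` setT : set (measurableTypeR R * T)).
  by apply: measurableX => //; exact: measurable_itv.
have M0 : 0 <= M by apply: le_trans (cM point).
apply: (@le_lt_trans _ _ (\int[Q]_(x in TD) ((M ^+ 2)%:E * (\1_(`]lo, hi] `*` setT) x)%:E))%E).
  apply: ge0_le_integral => //.
  - exact: measurable_TD.
  - by move=> x _; rewrite lee_fin sqr_ge0.
  - apply/measurable_EFinP/measurable_funX/wrt_measurable_fun; first exact: measurable_TD.
    by move=> B mB; apply: pred_measurable; exact: ms.
  - by apply/measurable_EFinP; apply: measurable_funM => //; apply: measurable_funTS;
    exact: measurable_indic.
  - move=> [u w] _; rewrite -EFinM lee_fin /step /= indicE; case: ifPn => h; last first.
      by rewrite expr0n mulr_ge0 ?sqr_ge0.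
    rewrite mem_set ?mulr1; last by split=> //=; rewrite in_itv.
    by rewrite -(real_normK (num_real (c w))) lerXn2r ?nnegrE.
rewrite ge0_integralZl //.
- rewrite integral_indic //; last exact: measurable_TD.
  rewrite lte_mul_pinfty ?lee_fin ?sqr_ge0 //.
  apply: (@le_lt_trans _ _ (Q (`]lo, hi] `*` setT))).
    apply: le_measure; rewrite ?inE //.
    by apply: measurableI => //; exact: measurable_TD.
  by rewrite Q_rect // probability_setT mule1 ltry.
- exact: measurable_TD.
- by apply/measurable_EFinP; apply: measurable_funTS; exact: measurable_indic.
- by rewrite lee_fin sqr_ge0.
Qed.

(** By Fubini's theorem the pairing factors into the length of the common time
    interval and the pairing of the coefficients. *)
Lemma ip_step a b c a' b' c' : 0 <= a -> 0 <= a' -> measurable_fun setT c ->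
  measurable_fun setT c' ->
  bounded c -> bounded c' ->
  ip Q TD (step a b c) (step a' b' c') =
  Num.max 0 (Num.min b b' - Num.max a a') * ip P setT c c'.
Proof.
move=> a0 a0' mc mc' [M cM] [M' cM'].
set al := Num.max a a'; set be := Num.min b b'.
pose f (x : measurableTypeR R * T) := \1_(`]al, be]) x.1 * (c x.2 * c' x.2).
have icc : P.-integrable setT (EFin \o (fun w => c w * c' w)).
  apply: integrable_mul => //; apply: bounded_L2 => //; by [exact/wrt_measurable_fun|exists
    M|exists M'].
have E : ip Q TD (step a b c) (step a' b' c') = \int[Q]_x f x.
  rewrite /ip Rintegral_mkcond; apply: eq_Rintegral => -[u w] _.
  rewrite patchE; have -> : ((u, w) \in TD) = (0 <= u) by apply/idP/idP; rewrite inE.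
  rewrite /f /= !stepE /= !indicE /= !mem_setE !in_itv /= gt_max le_min.
  case: (leP 0 u) => u0.
    by case: (a < u); case: (a' < u); case: (u <= b); case: (u <= b'); rewrite /=; ring.
  by rewrite [a < u]ltNge (le_trans (ltW u0) a0) /= mul0r.
have mI : measurable (`]al, be]%classic : set (measurableTypeR R)) by exact: measurable_itv.
have mf : measurable_fun setT (EFin \o f).
  apply/measurable_EFinP; apply: measurable_funM.
    apply: measurableT_comp => //; exact: measurable_indic.
  by apply: measurable_funM; exact: measurableT_comp.
have F1 u : (\int[P]_w `|(EFin \o f) (u, w)| = (\1_(`]al,
  be]) u)%:E * \int[P]_w `|(c w * c' w)%:E|)%E.
  rewrite -ge0_integralZl //.
    by apply: eq_integral => w _; rewrite /f /= normrM ger0_norm // EFinM.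
  by apply/measurable_EFinP; apply: measurableT_comp => //; exact: measurable_funM.
have lI : ((@lebesgue_measure R) `]al, be] = (Num.max 0 (be - al))%:E)%E.
  rewrite lebesgue_measure_itv /= lte_fin; case: ltP => h.
    by rewrite max_r // subr_ge0 ltW.
  by rewrite max_l // subr_le0.
have if_ : Q.-integrable setT (EFin \o f).
  apply/integrable12ltyP => //.
  under eq_integral => x _ do rewrite F1.
  rewrite ge0_integralZr //; last 2 first.
  - by apply/measurable_EFinP; exact: measurable_indic.
  - exact: integral_ge0.
  rewrite integral_indic // setIT [X in (X * _)%E](_ : _ = (Num.max 0 (be - al))%:E);
    last exact: lI.
  apply: lte_mul_pinfty.
  - by rewrite lee_fin le_max lexx.
  - by [].
  - by have /integrableP[] := icc.
rewrite E /Rintegral -fubini1 //.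
have F2 u : (fubini_F P (EFin \o f) u = (\1_(`]al, be]) u)%:E * (ip P setT c c')%:E)%E.
  rewrite /ip /Rintegral fineK; last by apply: integrable_fin_num.
  by rewrite -integralZl.
under eq_integral => x _ do rewrite F2.
rewrite integralZr //; last exact: integrable_indic_itv.
by rewrite integral_indic // setIT [X in (X * _)%E](_ : _ = (Num.max 0 (be - al))%:E) //; exact: lI.
Qed.

End filtrations_and_predictability.

(** * Orthogonality to a sub-sigma-field *)

Section conditional_orthogonality.
Context {d : measure_display} {T : measurableType d} {R : realType}.

Lemma orth_closed {U : measurableType d} (mu : {measure set U -> \bar R}) (D : set U)
    (S : set (set U)) (f : U -> R) :
  measurable D -> sigma_algebra D S -> S `<=` measurable -> L2 mu D measurable f ->
  closed_subspace mu D S [set k | L2 mu D S k /\ ip mu D f k = 0].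
Proof.
move=> mD sS SM lf; split=> /=.
- by move=> k [].
- by split; [exact: L2_0|rewrite ipC ip0l].
- move=> a g h [lg fg] [lh fh]; split; first exact: L2_lin.
  by rewrite ip_linr ?fg ?fh ?mulr0 ?addr0 //; apply: (L2_meas SM).
- move=> k g Hk lg kg; split=> //.
  have lk n : L2 mu D measurable (k n) by apply: (L2_meas SM); case: (Hk n).
  have := @ip_cvg _ _ _ mu D mD k g f lk (L2_meas SM lg) lf kg.
  have -> : (fun n => ip mu D (k n) f) = (fun=> 0).
    by apply/funext => n; rewrite ipC; case: (Hk n).
  by move/(cvg_unique _ (cvg_cst 0)) => ->; [rewrite ipC|].
Qed.

Variable P : probability T R.

Lemma indic_L2 (S : set (set T)) A : sigma_algebra setT S -> S `<=` measurable -> S A ->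
  L2 P setT S (\1_A : T -> R).
Proof.
move=> sS SM SA; apply: bounded_L2 => //; first by apply: wrt_indic => //; rewrite setTI.
by exists 1 => w; rewrite indicE; case: (_ \in _); rewrite ?normr1 ?normr0.
Qed.

Lemma orth_pi (G : set (set T)) (f : T -> R) : setI_closed G -> G `<=` measurable ->
  L2 P setT measurable f -> ip P setT f (fun=> 1) = 0 ->
  (forall A, G A -> ip P setT f (\1_A) = 0) ->
  forall k, L2 P setT <<s G>> k -> ip P setT f k = 0.
Proof.
move=> IG GM lf f1 fG k lk.
have GT A : G A -> A `<=` setT by [].
have SM : <<s G>> `<=` measurable by exact: g_sigma_measurable.
have sS : sigma_algebra setT <<s G>> by exact: smallest_sigma_algebra.
have ST : <<s G>> setT.
  by have [S0 SC _] := sS; have := SC _ S0; rewrite setD0.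
have := @density _ _ _ P setT measurableT G (fun=> setT) [set k | L2 P setT <<s G>> k /\
  ip P setT f k = 0].
case/(_ IG GT GM (orth_closed measurableT sS SM lf) _ _ _ _ _ k lk) => //.
- by move=> _; exact: fin_num_fun_lty.
- by move=> x _; exists 0%N.
- move=> _ A GA; rewrite /= setIT; split; last exact: fG.
  by apply: indic_L2 => //; exact: sub_sigma_algebra.
- move=> _; split; first exact: indic_L2.
  by rewrite -f1; apply: eq_ip => // x _; rewrite indicE in_setT.
Qed.

(** By density, orthogonality to a sub-sigma-field can be tested on its
    events. *)
Lemma orth_sigma (S : set (set T)) (f : T -> R) : sigma_algebra setT S -> S `<=` measurable ->
  L2 P setT measurable f -> (forall A, S A -> ip P setT f (\1_A) = 0) ->
  forall k, L2 P setT S k -> ip P setT f k = 0.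
Proof.
move=> sS SM lf fS k lk.
have ST : S setT by rewrite -(setD0 setT); have [? + _] := sS; apply.
have SE : <<s S>> = S by exact: sigma_algebra_id.
apply: (@orth_pi S f) => //; last by rewrite SE.
- move=> A B SA SB; have := @sigma_algebraP _ setT S (fun X _ => @subsetT _ X).
  by move=> [+ _] => /(_ sS) [_ _ _]; apply.
- by rewrite -(fS _ ST); apply: eq_ip => // x _; rewrite indicE in_setT.
Qed.

(** The sum counts the integers between 1 and x, so it is the integer part
    of x. *)
Lemma layer_cake (x : R) n : 0 <= x -> x <= n%:R ->
  `|x - \sum_(k < n) (k.+1%:R <= x)%R%:R| <= 1.
Proof.
move=> x0 xn.
have -> : \sum_(k < n) (k.+1%:R <= x)%R%:R = (minn n (Num.truncn x))%:R :> R.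
  elim: n {xn} => [|n IH]; first by rewrite big_ord0 min0n.
  rewrite big_ord_recr /= IH -truncn_gt_nat.
  rewrite /minn; case: (ltnP n (Num.truncn x)) => h.
    by rewrite natr1; case: ltnP => // h'; congr _%:R; apply/eqP; rewrite eqn_leq h h'.
  by rewrite addr0 ltnNge (leq_trans h (leqnSn _)).
have tn : (Num.truncn x <= n)%N by rewrite -(ler_nat R) (le_trans _ xn) // truncn_le.
rewrite (minn_idPr tn) ger0_norm ?subr_ge0 ?truncn_le //.
by have := truncnS_gt x; rewrite -natr1 => ?; lra.
Qed.

Section bounded_multiplier.
Variables (S : set (set T)) (D : T -> R).
Hypotheses (sS : sigma_algebra setT S) (SM : S `<=` measurable).
Hypotheses (iD : P.-integrable setT (EFin \o D))
  (SD : forall A, S A -> \int[P]_(w in A) D w = 0).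

Lemma integrable_bounded_mul (xi : T -> R) : measurable_fun setT xi -> bounded xi ->
  P.-integrable setT (EFin \o (fun w => xi w * D w)).
Proof.
move=> mx [M xM]; have /integrableP[/measurable_EFinP mD _] := iD.
have iM := integrableZl measurableT M iD.
apply: le_integrable iM => //.
  by apply/measurable_EFinP; exact: measurable_funM.
move=> w _; rewrite /= lee_fin !normrM; apply: ler_wpM2r => //.
exact: le_trans (xM w) (ler_norm _).
Qed.

Let unit_interval (xi : T -> R) : measurable_wrt setT S xi -> (forall w, 0 <= xi w <= 1) ->
  \int[P]_w (xi w * D w) = 0.
Proof.
move=> mx x01.
have mx' : measurable_fun setT xi by apply/wrt_measurable_fun => // B mB; apply: SM; exact: mx.
have bx : bounded xi by exists 1 => w; have /andP[? ?] := x01 w; rewrite ger0_norm.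
have /integrableP[/measurable_EFinP mD _] := iD.
pose C := \int[P]_w `|D w|.
have C0 : 0 <= C by apply: Rintegral_ge0.
have key n : `|\int[P]_w (xi w * D w)| <= C / n.+1%:R.
  have n0 : 0 < n.+1%:R :> R by [].
  pose A k := [set w | k.+1%:R <= n.+1%:R * xi w].
  have SA k : S (A k).
    have := wrt_comp sS (h := fun x => n.+1%:R * x) (mulrl_measurable _ ) mx.
    move=> /(_ `[k.+1%:R, +oo[%classic (measurable_itv _)); rewrite setTI; congr S.
    by apply/seteqP; split=> w; rewrite /A /= in_itv /= andbT.
  pose st w : R := n.+1%:R^-1 * \sum_(k < n.+1) \1_(A k) w.
  have mst : measurable_fun setT st.
    apply: measurable_funM => //; apply: measurable_sum => k.
    by apply: measurable_indic; exact: SM.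
  have xst w : `|xi w - st w| <= n.+1%:R^-1.
    have /andP[x0 x1] := x01 w.
    have := @layer_cake (n.+1%:R * xi w) n.+1.
    rewrite mulr_ge0 // ler_piMr // => /(_ isT isT).
    have -> : \sum_(k < n.+1) (k.+1%:R <= n.+1%:R * xi w)%R%:R = n.+1%:R * st w.
      rewrite /st mulrA divff ?gt_eqF // mul1r; apply: eq_bigr => k _; rewrite indicE.
      by have -> : (w \in A k) = (k.+1%:R <= n.+1%:R * xi w) by apply/idP/idP; rewrite inE.
    by rewrite -mulrBr normrM (ger0_norm (ltW n0)) mulrC -ler_pdivlMr // mul1r.
  have bst : bounded st.
    exists (1 + n.+1%:R^-1) => w; have := xst w; have /andP[? ?] := x01 w.
    rewrite distrC => h; have -> : st w = xi w + (st w - xi w) by ring.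
    by apply: le_trans (ler_normD _ _) _; rewrite ger0_norm ?lerD.
  have st0 : \int[P]_w (st w * D w) = 0.
    transitivity (\int[P]_w (n.+1%:R^-1 * \sum_(k < n.+1) (\1_(A k) w * D w))).
      by apply: eq_Rintegral => w _; rewrite /st -mulrA mulr_suml.
    have i1 k : P.-integrable setT (EFin \o (fun w => \1_(A k) w * D w)).
      apply: integrable_bounded_mul; first by apply: measurable_indic; exact: SM.
      by exists 1 => w; rewrite indicE; case: (_ \in _); rewrite ?normr1 ?normr0.
    rewrite RintegralZl //; last first.
      rewrite (_ : EFin \o _ = fun x => (\sum_(k < n.+1) (\1_(A k) x * D x)%:E)%E); last first.
        by apply/funext => w /=; rewrite sumEFin.
      by apply: integrable_sum => // k _; exact: i1.
    rewrite /Rintegral; under eq_integral do rewrite -sumEFin.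
    rewrite integral_sum //; last by move=> k; exact: i1.
    rewrite big1 ?mulr0 //= => k _; rewrite -[RHS]/(0%:E) -(SD (SA k)).
    rewrite Rintegral_mkcond /Rintegral fineK.
      apply: eq_integral => w _; rewrite patchE indicE.
      by case: (w \in A k); rewrite ?mul1r ?mul0r.
    apply: integrable_fin_num => //.
    have := i1 k; apply: eq_integrable => // w _ /=.
    by rewrite patchE indicE; case: (w \in A k); rewrite ?mul1r ?mul0r.
  have -> : \int[P]_w (xi w * D w) = \int[P]_w (xi w * D w - st w * D w).
    by rewrite RintegralB ?st0 ?subr0 //; exact: integrable_bounded_mul.
  have ixs : P.-integrable setT (EFin \o (fun w => (xi w - st w) * D w)).
    apply: integrable_bounded_mul; first exact: measurable_funB.
    by exists (n.+1%:R^-1).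
  under eq_Rintegral do rewrite -mulrBl.
  apply: le_trans (le_normr_Rintegral _ ixs) _ => //.
  rewrite mulrC -RintegralZl //; last exact: integrable_norm iD.
  apply: le_Rintegral => //.
  - exact: integrable_norm ixs.
  - exact: integrableZl (integrable_norm iD).
  - by move=> w _; rewrite normrM; apply: ler_wpM2r.
apply/eqP; rewrite -normr_le0.
have c : C / n.+1%:R @[n --> \oo] --> C * 0 by apply: cvgM; [exact: cvg_cst|exact: cvg_harmonic].
by rewrite mulr0 in c; apply: (cvgr_to_ge c); near=> n.
Unshelve. all: by end_near. Qed.

(** Bounded S-measurable multipliers are uniform limits of finite sums of
    indicators. Only the integrability of D is required: D will be a squared
    increment, not known to be in L2. *)
Lemma orth_bounded (xi : T -> R) : measurable_wrt setT S xi -> bounded xi ->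
  \int[P]_w (xi w * D w) = 0.
Proof.
move=> mx [M xM].
pose N := `|M| + 1.
have N0 : 0 < N by rewrite /N ltr_wpDl.
have xN w : `|xi w| <= N by apply: le_trans (xM w) _; rewrite /N (le_trans (ler_norm M)) // lerDl.
have mx' : measurable_fun setT xi by apply/wrt_measurable_fun => // B mB; apply: SM; exact: mx.
pose y w := (xi w + N) / (2 * N).
have my : measurable_wrt setT S y.
  by apply: wrt_mul => //; [apply: wrt_add => //|]; exact: wrt_cst.
have y01 w : 0 <= y w <= 1.
  have := xN w; rewrite ler_norml => /andP[a b].
  by rewrite /y divr_ge0 /= ?ler_pdivrMr; lra.
have my' : measurable_fun setT y by apply/wrt_measurable_fun => // B mB; apply: SM; exact: my.
have iy : P.-integrable setT (EFin \o (fun w => y w * D w)).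
  apply: integrable_bounded_mul => //; exists 1 => w; have /andP[? ?] := y01 w;
    by rewrite ger0_norm.
have ST : S setT by rewrite -(setD0 setT); have [S0 + _] := sS; apply; exact: S0.
transitivity (2 * N * \int[P]_w (y w * D w) - N * \int[P]_w D w); last first.
  by rewrite (unit_interval my) // SD // !mulr0 subr0.
rewrite -!RintegralZl // -RintegralB //.
- by apply: eq_Rintegral => w _; rewrite /y; field; rewrite gt_eqF.
- exact: integrableZl iy.
- exact: integrableZl iD.
Qed.

End bounded_multiplier.
End conditional_orthogonality.

(** * Simple integrals and their isometry *)

Section brownian_integrators.
Context {d : measure_display} {T : measurableType d} {R : realType}.
Variable P : probability T R.
Notation Q := ((@lebesgue_measure R) \x P)%E.
Notation TD := (@time_domain d T R).

(** The properties of Brownian motion relative to a filtration on which the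
    integral depends; integrals over events of the past replace conditional
    expectations. *)
Record is_BM (G : R -> set (set T)) (W : R -> T -> R) : Prop := IsBM {
  bm_adapted : forall t, 0 <= t -> measurable_wrt setT (G t) (W t);
  bm_cont : {ae P, forall w, {within `[0, +oo[%classic, continuous (fun t => W t w)}};
  bm_L2 : forall s t, 0 <= s -> s <= t -> L2 P setT measurable (fun w => W t w - W s w);
  bm_mean : forall s t A, 0 <= s -> s <= t -> G s A ->
    ip P setT (fun w => W t w - W s w) (\1_A) = 0;
  bm_var : forall s t A, 0 <= s -> s <= t -> G s A ->
    \int[P]_(w in A) ((W t w - W s w) ^+ 2 - (t - s)) = 0 }.

(** A piece stands for the process pcf 1_]plo, phi]; simple integrands are
    lists of pieces, so that sums are concatenations. *)
Record piece : Type := Piece { plo : R; phi : R; pcf : T -> R }.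

Section fixed.
Variables (G : R -> set (set T)) (W : R -> T -> R).
Hypotheses (FG : is_filtration P G) (BW : is_BM G W).
Notation Pred := (predictable_sigma G).
Notation L2P := (L2 P setT measurable).
Notation ipP := (ip P setT).
Notation ipQ := (ip Q TD).

Let sM := @sigma_algebra_M d T setT measurableT.
Let MM : (@measurable d T) `<=` measurable. Proof. by []. Qed.

Definition increment s t w := W t w - W s w.

Lemma increment_L2 s t u : 0 <= s -> s <= t -> t <= u -> L2 P setT (G u) (increment s t).
Proof.
move=> s0 st tu; have t0 := le_trans s0 st; have u0 := le_trans t0 tu.
split; last by have [] := bm_L2 BW s0 st.
apply: wrt_sub; first exact: (filt_sigma FG).
  by move=> B mB; apply: (filt_mono FG t0 tu); exact: (bm_adapted BW).
by move=> B mB; apply: (filt_mono FG s0 (le_trans st tu)); exact: (bm_adapted BW).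
Qed.

Lemma orth_increment s t xi : 0 <= s -> s <= t -> L2 P setT (G s) xi -> ipP xi (increment s t) = 0.
Proof.
move=> s0 st lx; rewrite ipC; apply: (orth_sigma (filt_sigma FG s0) (filt_meas FG s0)) lx.
  exact: (bm_L2 BW).
by move=> A GA; exact: (bm_mean BW).
Qed.

Lemma integrable_sqr_increment s t : 0 <= s -> s <= t ->
  P.-integrable setT (EFin \o (fun w => increment s t w ^+ 2)).
Proof. by move=> s0 st; apply: integrable_sqr => //; exact: (bm_L2 BW). Qed.

Lemma integrable_bounded c S : measurable_wrt setT S c -> S `<=` measurable -> bounded c ->
  P.-integrable setT (EFin \o c).
Proof.
move=> mc SM bc; have lc : L2P c.
  by apply: (@L2_meas _ _ _ P setT S) => //; exact: bounded_L2.
have l1 : L2P (fun=> 1).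
  by apply: bounded_L2 => //; [apply: wrt_cst|exists 1 => w; rewrite normr1].
have := integrable_mul measurableT lc l1.
by apply: eq_integrable => // w _ /=; rewrite mulr1.
Qed.

Lemma var_increment s t xi : 0 <= s -> s <= t -> measurable_wrt setT (G s) xi -> bounded xi ->
  \int[P]_w (xi w * increment s t w ^+ 2) = (t - s) * \int[P]_w xi w.
Proof.
move=> s0 st mx bx.
have sG := filt_sigma FG s0; have SM := filt_meas FG s0.
have mx' : measurable_fun setT xi by apply/wrt_measurable_fun => // B mB; apply: SM; exact: mx.
have ii := integrable_sqr_increment s0 st.
have ic : P.-integrable setT (EFin \o (fun=> t - s)).
  apply: (@integrable_bounded _ measurable) => //; first exact: wrt_cst.
  by exists `|t - s|.
have iD : P.-integrable setT (EFin \o (fun w => increment s t w ^+ 2 - (t - s))).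
  by have := integrableB measurableT ii ic.
have := orth_bounded sG SM iD (fun A GA => bm_var BW s0 st GA) mx bx.
have ix : P.-integrable setT (EFin \o xi) by exact: integrable_bounded mx SM bx.
have i1 := integrable_bounded_mul ii mx' bx.
under eq_Rintegral do rewrite mulrBr.
rewrite RintegralB // ?RintegralZr // => [/eqP|]; last exact: integrable_bounded_mul.
by rewrite subr_eq0 mulrC => /eqP.
Qed.

Definition adapted_piece (p : piece) : Prop :=
  [/\ 0 <= plo p, plo p <= phi p, measurable_wrt setT (G (plo p)) (pcf p) & bounded (pcf p)].

Lemma adapted_piece_measurable p : adapted_piece p -> measurable_fun setT (pcf p).
Proof.
move=> [l0 lh mc _]; apply/wrt_measurable_fun => // B mB.
by apply: (filt_meas FG l0); exact: mc.
Qed.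

Lemma wrt_mono s t (c : T -> R) : 0 <= s -> s <= t -> measurable_wrt setT (G s) c ->
  measurable_wrt setT (G t) c.
Proof. by move=> s0 st mc B mB; apply: (filt_mono FG s0 st); exact: mc. Qed.

Lemma L2_mono s t c : 0 <= s -> s <= t -> L2 P setT (G s) c -> L2 P setT (G t) c.
Proof. by move=> s0 st; apply: L2_sub; exact: (filt_mono FG). Qed.

Lemma L2G_meas t c : 0 <= t -> L2 P setT (G t) c -> L2P c.
Proof. by move=> t0; apply: L2_meas; exact: (filt_meas FG). Qed.

Definition full_increment p w := pcf p w * increment (plo p) (phi p) w.

Lemma bounded_mul (c c' : T -> R) : bounded c -> bounded c' -> bounded (fun w => c w * c' w).
Proof.
move=> [M cM] [M' cM']; exists (M * M') => w; rewrite normrM.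
by apply: ler_pM.
Qed.

Lemma full_increment_L2 p u : adapted_piece p -> phi p <= u -> L2 P setT (G u) (full_increment p).
Proof.
move=> [l0 lh mc bc] hu; have u0 : 0 <= u by apply: le_trans hu; apply: le_trans lh.
apply: L2_mul_bounded => //; [exact: (filt_sigma FG)|exact: (filt_meas FG)| |exact: increment_L2].
by apply: wrt_mono mc => //; exact: le_trans lh hu.
Qed.

(** Past the later starting point a, the product of the two increments splits
    into variables known at time a times a later increment, products of
    increments over disjoint intervals, and the square of the increment over
    the common interval. *)
Let ip_full_increment_le p q : adapted_piece p -> adapted_piece q -> plo p <= plo q ->
  ipP (full_increment p) (full_increment q) = Num.max 0 (Num.min (phi p) (phi q) - Num.max (plo p)
    (plo q)) * ipP (pcf p) (pcf q).
Proof.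
move=> okp_ okq ll; have [l0 lh mc bc] := okp_; have [l0' lh' mc' bc'] := okq.
rewrite (max_r ll); set a := plo q.
have Ga c : measurable_wrt setT (G a) c -> bounded c -> forall f u, a <= u ->
    L2 P setT (G u) f -> L2 P setT (G u) (fun w => c w * f w).
  move=> mcc bcc f u au lf; have u0 : 0 <= u := le_trans l0' au.
  apply: L2_mul_bounded => //; [exact: (filt_sigma FG)|exact: (filt_meas FG)|].
  exact: wrt_mono mcc.
have mca : measurable_wrt setT (G a) (pcf p) by apply: wrt_mono mc.
have [hl|lh2] := leP (phi p) a.
  rewrite max_l ?mul0r; last by rewrite subr_le0 ge_min hl.
  have lx : L2 P setT (G a) (fun w => pcf q w * full_increment p w).
    by apply: Ga => //; exact: full_increment_L2.
  rewrite -(orth_increment l0' lh' lx); apply: eq_Rintegral => w _; rewrite /full_increment; ring.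
set m := Num.min (phi p) (phi q).
have am : a <= m by rewrite le_min (ltW lh2).
have m0 : 0 <= m := le_trans l0' am.
have mh : m <= phi p by rewrite ge_min lexx.
have mh' : m <= phi q by rewrite ge_min lexx orbT.
rewrite max_r ?subr_ge0 //.
pose cc w := pcf p w * pcf q w.
have mcc : measurable_wrt setT (G a) cc by apply: wrt_mul => //; exact: (filt_sigma FG).
have bcc : bounded cc by exact: bounded_mul.
have z1 : L2 P setT (G a) (fun w => cc w * increment (plo p) a w).
  by apply: Ga => //; apply: increment_L2.
have z2 : L2 P setT (G m) (fun w => cc w * increment a m w).
  by apply: Ga => //; apply: increment_L2.
have E1 := orth_increment l0' lh' z1; have E2 := orth_increment m0 mh' z2;
  have E3 := orth_increment m0 mh z2.
have E4 := var_increment l0' am mcc bcc.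
have L1 := L2G_meas l0' z1; have L2' := L2G_meas m0 z2.
have i1 := integrable_mul measurableT L1 (bm_L2 BW l0' lh').
have i2 := integrable_mul measurableT L2' (bm_L2 BW m0 mh').
have i3 := integrable_mul measurableT L2' (bm_L2 BW m0 mh).
have i4 := integrable_mul measurableT L2' (bm_L2 BW l0' am).
transitivity (\int[P]_w ((cc w * increment (plo p) a w * increment a (phi q) w + cc w * increment
  a m w * increment m (phi q) w) +
   (cc w * increment a m w * increment m (phi p) w + cc w * increment a m w * increment a m w))).
  apply: eq_Rintegral => w _; rewrite /full_increment /cc /increment -/a.
  have : phi p = m \/ phi q = m by rewrite /m; case: leP => _; [left|right].
  by case=> ->; ring.
rewrite RintegralD //; last 2 first.
- by have := integrableD measurableT i1 i2.
- by have := integrableD measurableT i3 i4.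
rewrite RintegralD // RintegralD //.
rewrite -[X in (X + _) + _]/(ipP _ _) E1 -[X in (_ + X) + _]/(ipP _ _) E2.
rewrite -[X in _ + (X + _)]/(ipP _ _) E3 !add0r.
under eq_Rintegral do rewrite -mulrA -expr2.
by rewrite E4.
Qed.

(** The isometry for two pieces. *)
Lemma ip_full_increment p q : adapted_piece p -> adapted_piece q ->
  ipP (full_increment p) (full_increment q) = ipQ (step (plo p) (phi p) (pcf p)) (step (plo q)
    (phi q) (pcf q)).
Proof.
move=> okp_ okq; have [l0 lh mc bc] := okp_; have [l0' lh' mc' bc'] := okq.
rewrite ip_step //; try exact: adapted_piece_measurable.
have [ll|/ltW ll] := leP (plo p) (plo q); first by rewrite ip_full_increment_le // (max_r ll).
by rewrite ipC ip_full_increment_le // (max_r ll) minC (ipC P setT (pcf q)).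
Qed.

Fixpoint adapted_pieces (e : seq piece) : Prop := if e is p :: e' then adapted_piece p /\
  adapted_pieces e' else True.

Definition pieces_process (e : seq piece) (x : R * T) : R :=
  \sum_(p <- e) step (plo p) (phi p) (pcf p) x.

Definition simple_int (e : seq piece) (t : R) (w : T) : R :=
  \sum_(p <- e) pcf p w * (W (Num.min (phi p) t) w - W (Num.min (plo p) t) w).

Lemma pieces_process_L2 e : adapted_pieces e -> L2 Q TD Pred (pieces_process e).
Proof.
have sP := @pred_sigma_algebra d T R G; have PM := pred_measurable FG.
elim: e => [_|p e IH [okp_ se]].
  apply: (@L2_eq _ _ _ Q TD Pred (fun=> 0)); last exact: L2_0.
  by move=> x _; rewrite /pieces_process big_nil.
apply: (L2_eq _ (L2_add (@measurable_TD d T R) sP PM _ (IH se))); last first.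
  have [l0 lh mc bc] := okp_; exact: step_L2 l0 lh mc bc.
by move=> x _; rewrite /pieces_process big_cons.
Qed.

Lemma pieces_process_L2m e : adapted_pieces e -> L2 Q TD measurable (pieces_process e).
Proof.
move=> /pieces_process_L2; apply: (@L2_meas _ (measurableTypeR R * T)%type R Q TD Pred).
exact: (pred_measurable FG).
Qed.

Lemma pieces_process_cat e e' x : pieces_process (e ++ e') x = pieces_process e x + pieces_process
  e' x.
Proof. by rewrite /pieces_process big_cat. Qed.

Lemma simple_int_cat e e' t w : simple_int (e ++ e') t w = simple_int e t w + simple_int e' t w.
Proof. by rewrite /simple_int big_cat. Qed.

Lemma adapted_cat e e' : adapted_pieces e -> adapted_pieces e' -> adapted_pieces (e ++ e').
Proof. by elim: e => //= p e IH [okp_ se] se'; split=> //; exact: IH. Qed.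

Definition scale_pieces (a : R) (e : seq piece) : seq piece :=
  [seq Piece (plo p) (phi p) (fun w => a * pcf p w) | p <- e].

Lemma adapted_scale a e : adapted_pieces e -> adapted_pieces (scale_pieces a e).
Proof.
elim: e => //= p e IH [[l0 lh mc [M cM]] se]; split; last exact: IH.
split=> //=; first by apply: wrt_mul => //; [exact: (filt_sigma FG)|apply: wrt_cst;
  exact: (filt_sigma FG)].
by exists (`|a| * M) => w; rewrite normrM ler_wpM2l.
Qed.

Lemma pieces_process_scale a e x : pieces_process (scale_pieces a e) x = a * pieces_process e x.
Proof.
rewrite /pieces_process big_map mulr_sumr; apply: eq_bigr => p _.
by rewrite /step /=; case: ifP; rewrite ?mulr0.
Qed.

Lemma simple_int_scale a e t w : simple_int (scale_pieces a e) t w = a * simple_int e t w.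
Proof.
by rewrite /simple_int big_map mulr_sumr; apply: eq_bigr => p _; rewrite /= mulrA.
Qed.

Definition sub_pieces e e' := e ++ scale_pieces (-1) e'.

Lemma adapted_sub e e' : adapted_pieces e -> adapted_pieces e' -> adapted_pieces (sub_pieces e e').
Proof. by move=> se se'; apply: adapted_cat => //; exact: adapted_scale. Qed.

Lemma pieces_process_sub e e' x : pieces_process (sub_pieces e e') x = pieces_process e x -
  pieces_process e' x.
Proof. by rewrite pieces_process_cat pieces_process_scale mulN1r. Qed.

Lemma simple_int_sub e e' t w :
  simple_int (sub_pieces e e') t w = simple_int e t w - simple_int e' t w.
Proof. by rewrite simple_int_cat simple_int_scale mulN1r. Qed.

Lemma piece_int_L2G p t : adapted_piece p -> 0 <= t ->
  L2 P setT (G t) (fun w => pcf p w * (W (Num.min (phi p) t) w - W (Num.min (plo p) t) w)).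
Proof.
move=> [l0 lh mc bc] t0.
have sG := filt_sigma FG t0; have SM := filt_meas FG t0.
have [lt|tl] := leP (plo p) t; last first.
  apply: L2_eq (L2_0 _ sG) => w _.
  by rewrite (min_r (le_trans (ltW tl) lh)) subrr mulr0.
apply: L2_mul_bounded => //; first by apply: wrt_mono mc.
by apply: increment_L2 => //; [rewrite le_min lh lt|rewrite ge_min lexx orbT].
Qed.

Lemma simple_int_L2G e t : adapted_pieces e -> 0 <= t -> L2 P setT (G t) (simple_int e t).
Proof.
move=> + t0; have sG := filt_sigma FG t0; have SM := filt_meas FG t0.
elim: e => [_|p e IH [okp_ se]].
  by apply: L2_eq (L2_0 _ sG) => x _; rewrite /simple_int big_nil.
apply: (L2_eq _ (L2_add measurableT sG SM (piece_int_L2G okp_ t0) (IH se))).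
by move=> x _; rewrite /simple_int big_cons.
Qed.

(** Over ]s, t] a piece moves by an increment of the integrator that begins
    after s: this makes simple integrals martingales. *)
Lemma piece_increment p s t : adapted_piece p -> 0 <= s -> s <= t -> exists a b,
  [/\ s <= a, plo p <= a, a <= b & forall w,
   (W (Num.min (phi p) t) w - W (Num.min (plo p) t) w) -
   (W (Num.min (phi p) s) w - W (Num.min (plo p) s) w) = increment a b w].
Proof.
move=> [l0 lh mc bc] s0 st.
have [hs|sh] := leP (phi p) s.
  exists s, s; split=> //; first exact: le_trans hs.
  move=> w; rewrite (min_l (le_trans hs st)) (min_l (le_trans lh (le_trans hs st))).
  by rewrite (min_l (le_trans lh hs)) /increment !subrr.
have [tl|lt] := leP t (plo p).
  exists (plo p), (plo p); split=> //; first exact: le_trans tl.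
  by move=> w; rewrite /increment (min_r (le_trans tl lh)) (min_r (le_trans st tl)); ring.
have [ls|sl] := leP (plo p) s.
  exists s, (Num.min (phi p) t); split=> //; first by rewrite le_min (ltW sh).
  by move=> w; rewrite /increment; ring.
exists (plo p), (Num.min (phi p) t); split=> //; [exact: ltW|by rewrite le_min lh ltW|].
by move=> w; rewrite /increment; ring.
Qed.

Lemma simple_int_mart e s t xi : adapted_pieces e -> 0 <= s -> s <= t -> L2 P setT (G s) xi ->
  bounded xi -> ipP (fun w => simple_int e t w - simple_int e s w) xi = 0.
Proof.
move=> + s0 st lx bx; have t0 := le_trans s0 st.
elim: e => [_|p e IH [okp_ se]].
  rewrite -[RHS](ip0l P setT xi); apply: eq_ip => // w _.
  by rewrite /simple_int !big_nil subrr.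
have [a [b [sa la ab ibE]]] := piece_increment okp_ s0 st.
have a0 := le_trans s0 sa; have [l0 lh mc bc] := okp_.
have lm u : 0 <= u -> L2P (simple_int e u) by move=> u0; apply: (L2G_meas u0);
  exact: simple_int_L2G.
have lxm : L2P xi by exact: L2G_meas lx.
rewrite (@eq_ip _ _ _ _ _ _ (fun w => pcf p w * increment a b w + (simple_int e t w - simple_int e
  s w)) _ xi) //; last first.
  by move=> w _; rewrite /simple_int !big_cons -ibE; ring.
have mca : measurable_wrt setT (G a) (pcf p) by apply: wrt_mono mc.
have lpi : L2P (fun w => pcf p w * increment a b w).
  have b0 := le_trans a0 ab.
  apply: (L2G_meas b0); apply: L2_mul_bounded => //; [exact: (filt_sigma FG)|exact: (filt_meas
    FG)| |exact: increment_L2].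
  by apply: wrt_mono mca.
rewrite ip_add //; last by apply: L2_subr => //; exact: lm.
rewrite IH // addr0.
have lz : L2 P setT (G a) (fun w => pcf p w * xi w).
  apply: L2_mul_bounded => //; [exact: (filt_sigma FG)|exact: (filt_meas FG)|].
  exact: L2_mono lx.
rewrite -(orth_increment a0 ab lz); apply: eq_Rintegral => w _; ring.
Qed.

(** It suffices to test against indicators, which are bounded. *)
Lemma simple_int_mart_L2 e s t xi : adapted_pieces e -> 0 <= s -> s <= t -> L2 P setT (G s) xi ->
  ipP (fun w => simple_int e t w - simple_int e s w) xi = 0.
Proof.
move=> se s0 st; apply: (orth_sigma (filt_sigma FG s0) (filt_meas FG s0)).
  apply: L2_subr => //; [apply: (L2G_meas (le_trans s0 st))|apply: (L2G_meas s0)];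
    apply: simple_int_L2G => //; exact: le_trans st.
move=> A GA; apply: simple_int_mart => //.
  by apply: indic_L2 => //; [exact: (filt_sigma FG)|exact: (filt_meas FG)].
by exists 1 => w; rewrite indicE; case: (_ \in _); rewrite ?normr1 ?normr0.
Qed.

Lemma ip_full_increment_sum e e' : adapted_pieces e -> adapted_pieces e' ->
  ipP (fun w => \sum_(p <- e) full_increment p w) (fun w =>
    \sum_(p <- e') full_increment p w) = ipQ (pieces_process e) (pieces_process e').
Proof.
have lf p : adapted_piece p -> L2P (full_increment p).
  move=> okp_; have [l0 lh mc bc] := okp_; apply: (L2G_meas (le_trans l0 lh)).
  exact: full_increment_L2.
have ls e0 : adapted_pieces e0 -> L2P (fun w => \sum_(p <- e0) full_increment p w).
  elim: e0 => [_|p e0 IH [okp_ se]].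
    by apply: L2_eq (L2_0 _ sM) => x _; rewrite big_nil.
  apply: (L2_eq _ (L2_add measurableT sM MM (lf _ okp_) (IH se))).
  by move=> x _; rewrite big_cons.
have lst p : adapted_piece p -> L2 Q TD measurable (step (plo p) (phi p) (pcf p)).
  move=> [l0 lh mc bc]; apply: (@L2_meas _ (measurableTypeR R * T)%type R Q TD Pred).
    exact: (pred_measurable FG).
  exact: step_L2.
move=> + se'; elim: e => [_|p e IH [okp_ se]].
  rewrite (@eq_ip _ _ _ P setT _ (fun=> 0) _ (fun w => \sum_(p <- e') full_increment p w)) //;
    last first.
    by move=> w _; rewrite big_nil.
  rewrite ip0l (@eq_ip _ _ _ Q TD _ (fun=> 0) _ (pieces_process e')) ?ip0l //.
  by move=> w _; rewrite /pieces_process big_nil.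
rewrite (@eq_ip _ _ _ P setT _ (fun w => full_increment p w + \sum_(p <- e) full_increment p w) _
  (fun w => \sum_(p <- e') full_increment p w)) //; last first.
  by move=> w _; rewrite big_cons.
rewrite (@eq_ip _ _ _ Q TD _ (fun x => step (plo p) (phi p) (pcf p) x + pieces_process e x) _
  (pieces_process e')) //; last first.
  by move=> w _; rewrite /pieces_process big_cons.
have mTD := @measurable_TD d T R.
have lfp := lf _ okp_; have lse := ls _ se; have lse' := ls _ se'.
have lsp := lst _ okp_; have lpe := pieces_process_L2m se; have lpe' := pieces_process_L2m se'.
rewrite (ip_add measurableT lfp lse lse') (ip_add mTD lsp lpe lpe').
rewrite IH //; congr (_ + _).
elim: e' se' {IH lse' lpe'} => [_|q e' IH [okq se']].
  rewrite ipC (@eq_ip _ _ _ P setT _ (fun=> 0) _ (full_increment p)) //; last first.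
    by move=> w _; rewrite big_nil.
  rewrite ip0l ipC (@eq_ip _ _ _ Q TD _ (fun=> 0) _ (step (plo p) (phi p) (pcf p))) ?ip0l //.
  by move=> w _; rewrite /pieces_process big_nil.
rewrite ipC (@eq_ip _ _ _ P setT _ (fun w => full_increment q w + \sum_(p <- e') full_increment p
  w) _ (full_increment p)) //; last first.
  by move=> w _; rewrite big_cons.
rewrite [RHS]ipC (@eq_ip _ _ _ Q TD _ (fun x => step (plo q) (phi q) (pcf q) x + pieces_process e'
  x) _ (step (plo p) (phi p) (pcf p))) //; last first.
  by move=> w _; rewrite /pieces_process big_cons.
rewrite (ip_add measurableT (lf _ okq) (ls _ se') lfp) (ip_add mTD (lst _ okq) (pieces_process_L2m
  se') lsp).
by rewrite ip_full_increment // (ipC P setT _ (full_increment p)) IH // (ipC Q TD (pieces_process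
  e')).
Qed.

(** Equality holds for t beyond all pieces; before that the martingale
    property makes the second moment smaller. *)
Lemma simple_int_le e t : adapted_pieces e -> 0 <= t ->
  ipP (simple_int e t) (simple_int e t) <= ipQ (pieces_process e) (pieces_process e).
Proof.
move=> se t0.
have [u [tu hu]] : exists u, t <= u /\ forall w, simple_int e u w = \sum_(p <- e) full_increment p
  w.
  have [u [tu hu]] : exists u, t <= u /\ forall v w, u <= v ->
    simple_int e v w = \sum_(p <- e) full_increment p w.
    elim: e se => [_|p e IH [okp_ se]].
      by exists t; split=> // v w _; rewrite /simple_int !big_nil.
    have [u [tu hu]] := IH se; exists (Num.max u (phi p)); split; first by rewrite le_max tu.
    move=> v w; rewrite ge_max => /andP[uv pv]; have [l0 lh _ _] := okp_.
    rewrite /simple_int !big_cons -[X in _ + X]/(simple_int e v w) hu //.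
    by rewrite (min_l pv) (min_l (le_trans lh pv)).
  by exists u; split=> // w; exact: hu.
have u0 := le_trans t0 tu.
have lt := simple_int_L2G se t0; have lu := simple_int_L2G se u0.
have ltm := L2G_meas t0 lt; have lum := L2G_meas u0 lu.
have ld : L2P (fun w => simple_int e u w - simple_int e t w) by exact: L2_subr.
have := nsq_lin measurableT 1 ltm ld.
have -> : ipP (simple_int e t) (fun w => simple_int e u w - simple_int e t w) = 0.
  by rewrite ipC; exact: simple_int_mart_L2.
pose sumE x := simple_int e t x + 1 * (simple_int e u x - simple_int e t x).
rewrite -/sumE (@eq_ip _ _ _ P setT sumE (fun w => \sum_(p <- e) full_increment p w) sumE (fun w
  => \sum_(p <- e) full_increment p w)); last 2 first.
- by move=> w _; rewrite /sumE mul1r addrC subrK hu.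
- by move=> w _; rewrite /sumE mul1r addrC subrK hu.
rewrite ip_full_increment_sum // => ->.
by rewrite mulr0 addr0 expr1n mul1r lerDl ip_ge0.
Qed.

End fixed.
End brownian_integrators.

(** * Doob's inequality for continuous martingales *)

Section running_maximum.
Context {R : realType}.
Implicit Types (x y : nat -> R) (n : nat).

Fixpoint running_max x n : R := if n is m.+1 then Num.max (running_max x m) (x m.+1) else Num.max
  0 (x 0).

Lemma rmax_ge0 x n : 0 <= running_max x n.
Proof. by elim: n => [|n IH] /=; rewrite le_max ?lexx ?IH. Qed.

Lemma rmax_ge x n k : (k <= n)%N -> x k <= running_max x n.
Proof.
elim: n => [|n IH]; first by rewrite leqn0 => /eqP -> /=; rewrite le_max lexx orbT.
rewrite leq_eqVlt => /orP[/eqP ->|kn] /=; rewrite le_max ?lexx ?orbT //.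
by rewrite IH.
Qed.

Lemma rmax_le x n C : 0 <= C -> (forall k, (k <= n)%N -> x k <= C) -> running_max x n <= C.
Proof.
move=> C0; elim: n => [|n IH] xC /=; rewrite ge_max ?C0 ?xC // IH // => k kn.
by apply: xC; exact: leqW.
Qed.

(** Doob's maximal inequality holds path by path up to a sum which, for a
    martingale, has expectation zero. *)
Lemma doob_pathwise x n :
  running_max x n ^+ 2 <= 4 * x n ^+ 2 - 4 * \sum_(k < n) running_max x k * (x k.+1 - x k).
Proof.
suff : \sum_(k < n) running_max x k * (x k.+1 - x k) <= running_max x n * x n - running_max x n ^+
  2 / 2.
  have := sqr_ge0 (running_max x n - 2 * x n); nra.
elim: n => [|n IH].
  rewrite big_ord0 /=; have := sqr_ge0 (x 0%N).
  by rewrite maxEle; case: ifP => _; nra.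
rewrite big_ord_recr /=; move: IH (rmax_ge0 x n).
set s := \sum_(k < n) _; set a := running_max x n; set b := x n.+1.
by have := sqr_ge0 (a - b); case: (leP a b) => h ? IH a0; nra.
Qed.

End running_maximum.

Section paths.
Context {R : realType}.
Implicit Types f g : R -> R.

(** Continuity on [0, +oo[, expressed for the extension that is constant on
    negative times in order to avoid subspace topologies. *)
Definition cpath f : Prop := continuous (fun t : R => f (Num.max 0 t)).

Lemma continuous_max0 : continuous (fun t : R => Num.max 0 t).
Proof. by move=> t; apply: continuous_max; [exact: cvg_cst|exact: cvg_id]. Qed.

Lemma within_cpath f : {within `[0, +oo[%classic, continuous f} <-> cpath f.
Proof.
have A (t : R) : 0 <= t -> `[0, +oo[%classic t by rewrite /= in_itv /= andbT.
split=> [/subspace_continuousP cf x|cf].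
  have m0 : 0 <= Num.max 0 x by rewrite le_max lexx.
  have c := cf _ (A _ m0) => B /c nB.
  have nB2 : nbhs (Num.max 0 x) (fun z => `[0, +oo[%classic z -> B (f z)) := nB.
  suff : nbhs x ((fun t : R => f (Num.max 0 t)) @^-1` B) by [].
  have nx : nbhs x (fun y : R => `[0, +oo[%classic (Num.max 0 y) -> B (f (Num.max 0 y))).
    exact: (@continuous_max0 x _ nB2).
  apply: (filterS _ nx) => y /= h; apply: h.
  by apply: A; rewrite le_max lexx.
apply/subspace_continuousP => x /=; rewrite in_itv /= andbT => x0 B.
have := cf x; rewrite /continuous_at max_r // => c nB.
have nx : nbhs x (fun y : R => B (f (Num.max 0 y))) := c B nB.
suff : nbhs x (fun y : R => `[0, +oo[%classic y -> B (f y)) by [].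
apply: (filterS _ nx) => y fy; rewrite /= in_itv /= andbT => y0.
by move: fy; rewrite max_r.
Qed.

Lemma cpath_lim (f : nat -> R -> R) g (e : nat -> R) : (forall n, cpath (f n)) ->
  e n @[n --> \oo] --> 0 -> (forall n t, 0 <= t -> `|g t - f n t| <= e n) -> cpath g.
Proof.
move=> cf e0 fg t; apply/cvgrPdist_lt => eps eps0.
have e3 : 0 < eps / 3 by rewrite divr_gt0.
have /cvgrPdist_lt/(_ _ e3) [N _ HN] := e0.
have eN : e N < eps / 3.
  by have := HN N (leqnn _); rewrite /= sub0r normrN; apply: le_lt_trans; exact: ler_norm.
have m0 s : 0 <= Num.max 0 s :> R by rewrite le_max lexx.
have /cvgrPdist_lt/(_ _ e3) := cf N t; apply: filterS => s hs.
have -> : g (Num.max 0 t) - g (Num.max 0 s) = (g (Num.max 0 t) - f N (Num.max 0 t)) +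
   (f N (Num.max 0 t) - f N (Num.max 0 s)) + (f N (Num.max 0 s) - g (Num.max 0 s)) by ring.
have h1 := fg N _ (m0 t); have h2 := fg N _ (m0 s); rewrite distrC in h2.
apply: le_lt_trans (ler_normD _ _) _; apply: le_lt_trans (lerD (ler_normD _ _) (lexx _)) _.
by lra.
Qed.

Lemma cpath_lin (f g : R -> R) (a b : R) : cpath f -> cpath g -> cpath (fun t => a * f t + b * g t).
Proof.
move=> cf cg t; apply: cvgD; apply: cvgM; try exact: cvg_cst; [exact: cf|exact: cg].
Qed.

Lemma cpath0 (c : R) : cpath (fun=> c).
Proof. by move=> t; exact: cvg_cst. Qed.

Lemma cpath_min (f : R -> R) (a : R) : 0 <= a -> cpath f -> cpath (fun t => f (Num.min a t)).
Proof.
move=> a0 cf t.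
have -> : (fun t : R => f (Num.min a (Num.max 0 t))) = (fun t => f (Num.max 0 t)) \o (fun t =>
  Num.min a t).
  apply/funext => s /=; congr f.
  have [h1|h1] := leP 0 s; have [h2|h2] := leP a s; rewrite ?(max_r a0) ?(max_r h1) ?(max_l (ltW
    h1)) ?(min_r a0) //.
  by have := lt_le_trans h1 a0; rewrite ltNge h2.
apply: continuous_comp; last exact: cf.
by apply: continuous_min; [exact: cvg_cst|exact: cvg_id].
Qed.

Definition dyadic (k m : nat) : R := k%:R / 2 ^+ m.

Lemma dyadic_ge0 k m : 0 <= dyadic k m.
Proof. by rewrite divr_ge0 // exprn_ge0. Qed.

(** Dyadic times are dense. *)
Lemma cpath_dyadic_le (f : R -> R) (C : R) : cpath f -> (forall k m, `|f (dyadic k m)| <= C) ->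
  forall t, 0 <= t -> `|f t| <= C.
Proof.
move=> cf fC t t0.
pose q m := dyadic (Num.truncn (t * 2 ^+ m)) m.
have qt : q m @[m --> \oo] --> t.
  apply/subr_cvg0/norm_cvg0P.
  apply: (@squeeze_cvgr _ _ _ _ (fun=> 0) (fun m => 1 / 2 ^+ m)).
  - near=> m; rewrite normr_ge0 /=.
    have p : 0 < 2 ^+ m :> R by rewrite exprn_gt0.
    have [a b] : (Num.truncn (t * 2 ^+ m))%:R <= t * 2 ^+ m /\
      t * 2 ^+ m < (Num.truncn (t * 2 ^+ m)).+1%:R.
      by split; [rewrite truncn_le mulr_ge0 // ltW|exact: truncnS_gt].
    rewrite -natr1 in b.
    rewrite distrC ger0_norm; last by rewrite subr_ge0 /q /dyadic ler_pdivrMr.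
    rewrite /q /dyadic ler_pdivlMr // mulrBl divfK ?gt_eqF //; lra.
  - exact: cvg_cst.
  - exact: cvg_inv2X.
have fq : f (q m) @[m --> \oo] --> f t.
  have := cvg_comp _ _ qt (cf t); rewrite (max_r t0).
  apply: cvg_trans; apply: near_eq_cvg; near=> m; rewrite /= max_r //.
  exact: dyadic_ge0.
by apply: (cvgr_to_le (cvg_norm fq)); near=> m; exact: fC.
Unshelve. all: by end_near. Qed.

End paths.

Section Doob.
Context {d : measure_display} {T : measurableType d} {R : realType}.
Variable P : probability T R.
Variable G : R -> set (set T).
Hypothesis FG : is_filtration P G.
Notation L2P := (L2 P setT measurable).
Notation ipP := (ip P setT).

Definition L2_martingale (S : R -> T -> R) : Prop :=
  (forall t, 0 <= t -> L2 P setT (G t) (S t)) /\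
  (forall s t xi, 0 <= s -> s <= t -> L2 P setT (G s) xi ->
    ipP (fun w => S t w - S s w) xi = 0).

Lemma L2_martingaleN S : L2_martingale S -> L2_martingale (fun t w => - S t w).
Proof.
move=> [lS mS].
have E : (fun t w => - S t w) = (fun t w => -1 * S t w).
  by apply/funext => t; apply/funext => w; rewrite mulN1r.
rewrite E; split=> [t t0|s t xi s0 st lx].
  by apply: L2_scale => //; [exact: (filt_sigma FG)|exact: (filt_meas FG)|exact: lS].
have t0 := le_trans s0 st.
rewrite (@eq_ip _ _ _ _ _ _ (fun w => -1 * (S t w - S s w)) _ xi) //; last by move=> w _; ring.
rewrite ip_scale ?mS ?mulr0 //; last exact: (L2G_meas FG) lx.
apply: L2_subr => //; first exact: sigma_algebra_M.
  exact: (L2G_meas FG t0) (lS _ t0).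
exact: (L2G_meas FG s0) (lS _ s0).
Qed.

Lemma L2_max S f g : sigma_algebra setT S -> S `<=` measurable -> L2 P setT S f -> L2 P setT S g ->
  L2 P setT S (fun w => Num.max (f w) (g w)).
Proof.
move=> sS SM lf lg.
have mfg : measurable_wrt setT S (fun w => Num.max (f w) (g w)).
  apply/(measurable_wrtE sS); apply: measurable_maxr; apply/(measurable_wrtE sS).
    by case: lf.
  by case: lg.
split=> //.
have lfm := L2_meas SM lf; have lgm := L2_meas SM lg.
have := integrableD measurableT (integrable_sqr measurableT lfm) (integrable_sqr measurableT lgm).
move=> /integrableP[mi]; apply: le_lt_trans; apply: ge0_le_integral => //.
- by move=> w _; rewrite lee_fin sqr_ge0.
- apply/measurable_EFinP/measurable_funX/wrt_measurable_fun => // B mB; apply: SM; exact: mfg.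
- exact: measurableT_comp.
- move=> w _; rewrite /= lee_fin ger0_norm ?addr_ge0 ?sqr_ge0 //.
  by rewrite maxEle; case: ifP => _; rewrite ?lerDl ?lerDr sqr_ge0.
Qed.

Section running.
Variable S : R -> T -> R.
Hypothesis mS : L2_martingale S.
Variable tau : nat -> R.
Hypotheses (tau0 : forall k, 0 <= tau k) (tauM : forall k, tau k <= tau k.+1).

Let r n w := running_max (fun k => S (tau k) w) n.

Lemma rmax_L2 n : L2 P setT (G (tau n)) (r n).
Proof.
have [lS _] := mS.
have sG k := filt_sigma FG (tau0 k); have SM k := filt_meas FG (tau0 k).
elim: n => [|n IH]; first by apply: L2_max => //; [exact: L2_0|exact: lS].
apply: L2_max => //; last exact: lS.
by apply: (L2_mono FG (tau0 n) (tauM n)).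
Qed.

(** Expectation of the pathwise inequality: the running maximum up to tau k is
    known before the increment that follows. *)
Lemma doob_maximal n : ipP (r n) (r n) <= 4 * ipP (S (tau n)) (S (tau n)).
Proof.
have [lS oS] := mS.
have lr k : L2P (r k) by apply: (L2G_meas FG (tau0 k)); exact: rmax_L2.
have lSm k : L2P (S (tau k)) by apply: (L2G_meas FG (tau0 k)); exact: lS.
have ld k : L2P (fun w => S (tau k.+1) w - S (tau k) w).
  by apply: L2_subr => //; exact: sigma_algebra_M.
have ii k := integrable_mul measurableT (ld k) (lr k).
have iS := integrable_mul measurableT (lSm n) (lSm n).
have isum : P.-integrable setT (EFin \o (fun w => \sum_(k < n) (S (tau k.+1) w - S (tau k) w) * r
  k w)).
  rewrite (_ : EFin \o _ = fun w => (\sum_(k < n) ((S (tau k.+1) w - S (tau k) w) * r k w)%:E)%E);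
    last first.
    by apply/funext => w /=; rewrite sumEFin.
  by apply: integrable_sum => // k _; exact: ii.
have sum0 : \int[P]_w (\sum_(k < n) (S (tau k.+1) w - S (tau k) w) * r k w) = 0.
  rewrite /Rintegral; under eq_integral do rewrite -sumEFin.
  rewrite integral_sum //; last by move=> k; exact: ii.
  rewrite big1 // => k _.
  have := oS _ _ _ (tau0 k) (tauM k) (rmax_L2 k).
  rewrite /ip => /(@EFin_Rint0 _ _ _ P setT _ measurableT); apply; exact: ii.
have i4 : P.-integrable setT (EFin \o (fun w => 4 * (S (tau n) w * S (tau n) w))).
  by have := integrableZl measurableT 4 iS.
have i5 : P.-integrable setT (EFin \o (fun w => 4 * \sum_(k < n) (S (tau k.+1) w - S (tau k) w) *
  r k w)).
  by have := integrableZl measurableT 4 isum.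
have -> : 4 * ipP (S (tau n)) (S (tau n)) =
    \int[P]_w (4 * (S (tau n) w * S (tau n) w) - 4 * \sum_(k < n) (S (tau k.+1) w - S (tau k) w) *
      r k w).
  by rewrite RintegralB // !RintegralZl // sum0 mulr0 subr0.
apply: le_Rintegral => //.
- exact: integrable_mul.
- by have := integrableB measurableT i4 i5.
- move=> w _; have := doob_pathwise (fun k => S (tau k) w) n.
  rewrite !expr2 => /le_trans; apply; rewrite le_eqVlt; apply/orP; left; apply/eqP.
  by congr (_ - 4 * _); apply: eq_bigr => k _; rewrite mulrC.
Qed.

End running.

(** The maxima over the dyadic grids increase when the grid is refined and
    extended, so monotone convergence bounds the supremum over all dyadic
    times. Positive and negative parts of the path are treated separately,
    whence the constant 8. *)
Lemma doob_sup (S : R -> T -> R) (C : R) : L2_martingale S ->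
  (forall t, 0 <= t -> ipP (S t) (S t) <= C) ->
  exists Z : T -> \bar R, [/\ measurable_fun setT Z, forall w, (0 <= Z w)%E,
    (\int[P]_w Z w <= (8 * C)%:E)%E &
    forall w k m, ((S (dyadic k m) w ^+ 2)%:E <= Z w)%E].
Proof.
move=> mS SC.
have mN := L2_martingaleN mS.
(* the grid of level m has mesh 2^-m and covers [0, m] *)
pose N m := (m * 2 ^ m)%N.
pose b m w := running_max (fun k => S (dyadic k m) w) (N m).
pose b' m w := running_max (fun k => - S (dyadic k m) w) (N m).
pose a m w := b m w ^+ 2 + b' m w ^+ 2.
have dM m k : dyadic k m <= dyadic k.+1 m :> R by rewrite ler_pM2r ?invr_gt0 ?exprn_gt0 // ler_nat.
have d0 m k : 0 <= dyadic k m :> R by exact: dyadic_ge0.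
have lb m : L2P (b m) := L2G_meas FG (d0 m (N m)) (rmax_L2 mS (d0 m) (dM m) (N m)).
have lb' m : L2P (b' m) := L2G_meas FG (d0 m (N m)) (rmax_L2 mN (d0 m) (dM m) (N m)).
have dE k m n : (m <= n)%N -> dyadic k m = dyadic (k * 2 ^ (n - m)) n :> R.
  move=> mn; rewrite /dyadic natrM natrX -{2}(subnK mn) exprD invfM mulrA.
  by rewrite mulfK // gt_eqF // exprn_gt0.
have nda w : {homo a ^~ w : m n / (m <= n)%N >-> m <= n}.
  have kN k m n : (m <= n)%N -> (k <= N m)%N -> (k * 2 ^ (n - m) <= N n)%N.
    move=> mn kN; apply: (@leq_trans (N m * 2 ^ (n - m))); first by rewrite leq_mul2r kN orbT.
    by rewrite /N -mulnA -expnD subnKC // leq_mul2r mn orbT.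
  move=> m n mn; apply: lerD; rewrite lerXn2r ?nnegrE ?rmax_ge0 //; apply: rmax_le;
    rewrite ?rmax_ge0 // => k kn.
    by rewrite (dE _ _ _ mn); apply: (@rmax_ge _ (fun k => S (dyadic k n) w)); exact: kN.
  by rewrite (dE _ _ _ mn); apply: (@rmax_ge _ (fun k => - S (dyadic k n) w)); exact: kN.
have a0 m w : 0 <= a m w by rewrite addr_ge0 ?sqr_ge0.
have mb m : measurable_fun setT (b m) by apply/wrt_measurable_fun => //; case: (lb m).
have mb' m : measurable_fun setT (b' m) by apply/wrt_measurable_fun => //; case: (lb' m).
have ma m : measurable_fun setT (fun w => (a m w)%:E).
  by apply/measurable_EFinP; apply: measurable_funD; exact: measurable_funX.
have ndE w : {homo (fun m => (a m w)%:E) : m n / (m <= n)%N >-> (m <= n)%E}.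
  by move=> m n mn; rewrite lee_fin; exact: nda.
exists (fun w => limn (fun m => (a m w)%:E)); split.
- apply: (emeasurable_fun_cvg (fun m w => (a m w)%:E)) => // w _.
  exact: ereal_nondecreasing_is_cvgn.
- move=> w; apply: lime_ge; first exact: ereal_nondecreasing_is_cvgn.
  by near=> m; rewrite lee_fin.
- rewrite (monotone_convergence P measurableT ma) //; last by move=> m w _; rewrite lee_fin.
  apply: lime_le.
    apply: ereal_nondecreasing_is_cvgn => m n mn; apply: ge0_le_integral => //.
    * by move=> w _; rewrite lee_fin.
    * by move=> w _; exact: ndE.
  near=> m.
  rewrite /a; under eq_integral do rewrite EFinD.
  rewrite ge0_integralD //; last 4 first.
  + by move=> w _; rewrite lee_fin sqr_ge0.
  + by apply/measurable_EFinP; exact: measurable_funX.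
  + by move=> w _; rewrite lee_fin sqr_ge0.
  + by apply/measurable_EFinP; exact: measurable_funX.
  rewrite -[X in (X + _)%E]/(sqint P setT (b m)) -[X in (_ + X)%E]/(sqint P setT (b' m)) !sqintE
    // lee_fin.
  have h1 := doob_maximal mS (d0 m) (dM m) (N m); have h2 := doob_maximal mN (d0 m) (dM m) (N m).
  rewrite -/(b m) -/(b' m) in h1 h2.
  have h3 := SC _ (d0 m (N m)).
  have h4 : ipP (fun w => - S (dyadic (N m) m) w) (fun w => - S (dyadic (N m) m) w) =
     ipP (S (dyadic (N m) m)) (S (dyadic (N m) m)).
    by apply: eq_Rintegral => w _; rewrite mulrNN.
  rewrite h4 in h2; move: h1 h2 h3; rewrite /b /b'; lra.
- move=> w k m; pose n := maxn m k.
  have E : dyadic k m = dyadic (k * 2 ^ (n - m)) n :> R by apply: dE; exact: leq_maxl.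
  apply: (@le_trans _ _ (a n w)%:E).
    rewrite lee_fin E.
    have kN : (k * 2 ^ (n - m) <= N n)%N.
      by apply: leq_mul; [exact: leq_maxr|rewrite leq_exp2l // leq_subr].
    have h1 := @rmax_ge _ (fun k => S (dyadic k n) w) _ _ kN.
    have h2 := @rmax_ge _ (fun k => - S (dyadic k n) w) _ _ kN.
    have h3 := rmax_ge0 (fun k => S (dyadic k n) w) (N n).
    have h4 := rmax_ge0 (fun k => - S (dyadic k n) w) (N n).
    move: h1 h2 h3 h4; rewrite /a /b /b'; move: (running_max _ _) (running_max _ _) (S _ _) =>
      x y z.
    have [z0|z0] := leP 0 z; nra.
  have := ereal_nondecreasing_cvgn (ndE w) => /cvg_lim -> //.
  by apply: ereal_sup_ubound; exists n.
Unshelve. all: by end_near. Qed.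

End Doob.

(** * The real Ito integral *)

Section Ito.
Context {d : measure_display} {T : measurableType d} {R : realType}.
Variable P : probability T R.
Notation Q := ((@lebesgue_measure R) \x P)%E.
Notation TD := (@time_domain d T R).
Notation L2P := (L2 P setT measurable).
Notation ipP := (ip P setT).
Notation ipQ := (ip Q TD).
Notation MQ := (@measurable _ (measurableTypeR R * T)%type).

#[local] Instance ae_Q_filter : Filter (nbhs (almost_everywhere Q)).
Proof. exact: (ae_filter_ringOfSetsType Q). Qed.

Section filtration.
Variable G : R -> set (set T).
Hypothesis FG : is_filtration P G.
Notation Pred := (predictable_sigma G).

Let sP := @pred_sigma_algebra d T R G.
Let PM := pred_measurable FG.
Let mTD := @measurable_TD d T R.
Let sMQ := @sigma_algebra_M _ (measurableTypeR R * T)%type TD mTD.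
Let MMQ : MQ `<=` MQ. Proof. by []. Qed.

Lemma L2Q_meas h : L2 Q TD Pred h -> L2 Q TD MQ h.
Proof. exact: (@L2_meas _ (measurableTypeR R * T)%type R Q TD Pred). Qed.

Lemma Q_rect0 (A : set T) : measurable A -> Q ([set 0%R : R] `*` A) = 0%E.
Proof.
move=> mA; rewrite product_measure1E // [X in (X * _)%E](_ : _ = 0%E) ?mul0e //.
exact: lebesgue_measure_set1.
Qed.

Lemma indic_rect0_ae A : measurable A -> {ae Q, forall x, (\1_([set 0] `*` A) x : R) = 0}.
Proof.
move=> mA; exists ([set 0] `*` A); split.
- by apply: measurableX => //; exact: measurable_set1.
- exact: Q_rect0.
- move=> x /= nx; apply: contrapT => nA; apply: nx; rewrite indicE memNset //.
Qed.

(** The predictable rectangles form a pi-system. Those carried by time zero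
    are negligible, and the others are steps. *)
Lemma pred_density (K : set (R * T -> R)) : closed_subspace Q TD Pred K ->
  (forall s t A, 0 <= s -> s <= t -> G s A -> K (step s t (\1_A))) -> L2 Q TD Pred `<=` K.
Proof.
move=> cK Kstep.
have pI A B : Pred A -> Pred B -> Pred (A `&` B).
  move=> pA pB; have -> : A `&` B = A `\` (A `\` B).
    by rewrite setDD.
  by apply: pred_D => //; exact: pred_D.
have G0 := @filt_T _ _ _ _ _ FG 0 (lexx 0).
pose E (n : nat) : set (R * T) := ([set 0] `*` setT) `|` (`]0, n%:R] `*` setT).
have PE n : Pred (E n) by apply: pred_U => //; [exact: rect0_pred|apply: rect_pred].
have indL A : Pred A -> (Q A < +oo)%E -> L2 Q TD Pred (\1_A : _ -> R).
  move=> pA QA; split; first by apply: wrt_indic => //; apply: pI => //; exact: pred_T.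
  rewrite /sqint (_ : (fun x => _) = (EFin \o \1_A)); last first.
    by apply/funext => x /=; rewrite indicE; case: (_ \in _); rewrite ?expr1n ?expr0n.
  rewrite integral_indic //; last exact: PM.
  by apply: le_lt_trans QA; apply: le_measure; rewrite ?inE //; [apply: measurableI => //|];
    exact: PM.
have QE n : (Q (E n) < +oo)%E.
  have m1 : MQ ([set 0] `*` setT) by apply: measurableX => //; exact: measurable_set1.
  have m2 : MQ (`]0, n%:R] `*` setT) by apply: measurableX => //; exact: measurable_itv.
  apply: le_lt_trans (measureU2 _ m1 m2) _.
  have [E1 E2] := (Q_rect0 measurableT, Q_rect P measurableT (ler0n R n)).
  by rewrite [X in (X + _)%E]E1 [X in (_ + X)%E]E2 add0e probability_setT mule1 ltry.
have Kae f g : L2 Q TD Pred f -> K g -> {ae Q, forall x, TD x -> f x = g x} -> K f.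
  by move=> lf Kg; exact: (@closed_subspace_ae _ (measurableTypeR R * T)%type R Q TD mTD Pred PM K
    f g cK).
have [_ K0 _ _] := cK.
have stepIE s t A (x : R * T) : step s t (\1_A) x = \1_(`]s, t] `*` A) x :> R.
  rewrite stepE !indicE in_setX; case: (_ \in _); case: (_ \in _); rewrite /=; ring.
have GT A : predictable_rectangles G A -> A `<=` TD by exact: rectangles_sub.
have GM := rectangles_measurable FG.
apply: (@density _ (measurableTypeR R * T)%type R Q TD mTD (predictable_rectangles G) E K) => //.
- exact: (rectangles_setI FG).
- move=> [u w]; rewrite /time_domain /= le_eqVlt => /orP[/eqP <-|u0]; first by exists 0%N => //;
  left.
  exists (Num.truncn u).+1 => //; right; split=> //=.
  by rewrite in_itv /= u0 ltW // truncnS_gt.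
- move=> n _ [[B GB <-]|[s [t [B [s0 st GB ->]]]]].
    have mB : measurable B by exact: (filt_meas FG) GB.
    apply: (Kae _ (fun=> 0)) => //.
      apply: indL; first by apply: pI => //; exact: rect0_pred.
      apply: le_lt_trans (QE n); apply: le_measure; rewrite ?inE; last by move=> x [].
        by apply: measurableI; apply: PM => //; exact: rect0_pred.
      exact: PM.
    apply: filterS (indic_rect0_ae mB) => x; rewrite !indicE in_setI => + _.
    by case: (x \in _ `*` _) => //= /eqP; rewrite oner_eq0.
  have sm : s <= Num.max s (Num.min t n%:R) by rewrite le_max lexx.
  rewrite (_ : _ `&` _ = `]s, Num.max s (Num.min t n%:R)] `*` B); last first.
    apply/seteqP; split=> -[u w] /=; rewrite !in_itv /= le_max le_min.
      rewrite /E /= in_itv /=.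
      move=> [[/andP[su ut] Bw] [[u0 _]|[/andP[u0 un] _]]]; last by rewrite su ut un orbT.
      by move: su; rewrite u0 ltNge s0.
    move=> [/andP[su /orP[us|/andP[ut un]]] Bw]; first by move: su; rewrite ltNge us.
    by split; [rewrite su ut|rewrite /E /= in_itv /=; right; rewrite un (le_lt_trans s0 su)].
  rewrite (_ : \1_ _ = step s (Num.max s (Num.min t n%:R)) (\1_B)); last by apply/funext => x;
    rewrite stepIE.
  exact: Kstep.
- move=> n; apply: (Kae _ (step 0 n%:R (\1_setT))).
  + exact: indL.
  + exact: Kstep.
  + have := @indic_rect0_ae setT measurableT; apply: filterS => x + _;
    rewrite stepIE !indicE in_setU.
    by case: (x \in [set 0] `*` _) => //= /eqP; rewrite oner_eq0.
Qed.

(** The square-integrable processes orthogonal to r form a closed subspace. *)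
Lemma pred_orth r : L2 Q TD MQ r ->
  (forall s t A, 0 <= s -> s <= t -> G s A -> ipQ r (step s t (\1_A)) = 0) ->
  forall k, L2 Q TD Pred k -> ipQ r k = 0.
Proof.
move=> lr r0 k lk.
have cK := @orth_closed _ R (measurableTypeR R * T)%type Q TD Pred r mTD sP PM lr.
apply: (pred_density cK _ lk).2.
move=> s t A s0 st GA; split=> /=; last exact: r0.
apply: step_L2 => //; last by exists 1 => w; rewrite indicE; case: (_ \in _);
  rewrite ?normr1 ?normr0.
by apply: wrt_indic; [exact: (filt_sigma FG)|rewrite setTI].
Qed.

(** The processes that can be approximated by simple ones form a closed
    subspace containing the steps. *)
Lemma approx_simple h : L2 Q TD Pred h -> forall eps, 0 < eps ->
  exists e, adapted_pieces G e /\ ipQ (fun x => h x - pieces_process e x) (fun x =>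
    h x - pieces_process e x) <= eps.
Proof.
pose K := [set h | L2 Q TD Pred h /\ forall eps, 0 < eps -> exists e, adapted_pieces G e /\
  ipQ (fun x => h x - pieces_process e x) (fun x => h x - pieces_process e x) <= eps].
suff : L2 Q TD Pred `<=` K by move=> LK /LK [].
have lpm e : adapted_pieces G e -> L2 Q TD MQ (pieces_process e) by move=> se; apply: L2Q_meas;
  exact: (pieces_process_L2 FG).
have lsub f g : L2 Q TD MQ f -> L2 Q TD MQ g -> L2 Q TD MQ (fun x => f x - g x) by exact: L2_subr.
have exactK f e : L2 Q TD Pred f -> adapted_pieces G e -> {ae Q, forall x, TD x ->
  f x = pieces_process e x} -> K f.
  move=> lf se fe; split=> // eps eps0; exists e; split=> //.
  have ld : L2 Q TD MQ (fun x => f x - pieces_process e x) by apply: lsub;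
    [exact: L2Q_meas|exact: lpm].
  have md : measurable_fun TD (fun x => f x - pieces_process e x) by apply/wrt_measurable_fun =>
    //; case: ld.
  rewrite (@ip_ae _ _ _ Q TD mTD _ (fun=> 0)) //.
    by rewrite ip0l ltW.
  by apply: filterS fe => x /[apply] ->; rewrite subrr.
have cK : closed_subspace Q TD Pred K.
  split.
  - by move=> f [].
  - split; first exact: L2_0.
    move=> eps eps0; exists [::]; split=> //.
    rewrite (@eq_ip _ _ _ _ _ _ (fun=> 0) _ (fun=> 0)); first by rewrite ip0l ltW.
      by move=> x _; rewrite /pieces_process big_nil subrr.
    by move=> x _; rewrite /pieces_process big_nil subrr.
  - move=> a f g [lf Hf] [lg Hg]; split; first exact: L2_lin.
    move=> eps eps0.
    have e4 : 0 < eps / 4 by rewrite divr_gt0.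
    have a0 : 0 < 4 * (a ^+ 2 + 1) by rewrite mulr_gt0 // ltr_wpDl // sqr_ge0.
    have [e [se He]] := Hf _ e4.
    have [e' [se' He']] := Hg (eps / (4 * (a ^+ 2 + 1))) (divr_gt0 eps0 a0).
    exists (e ++ scale_pieces a e'); split; first by apply: adapted_cat => //;
      exact: (adapted_scale FG).
    have l1 : L2 Q TD MQ (fun x => f x - pieces_process e x) by apply: lsub;
      [exact: L2Q_meas|exact: lpm].
    have l2 : L2 Q TD MQ (fun x => g x - pieces_process e' x) by apply: lsub;
      [exact: L2Q_meas|exact: lpm].
    have l3 : L2 Q TD MQ (fun x => a * (g x - pieces_process e' x)) by exact: L2_scale.
    rewrite (@eq_ip _ _ _ _ _ _ (fun x => (f x - pieces_process e x) + a * (g x - pieces_process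
      e' x)) _
       (fun x => (f x - pieces_process e x) + a * (g x - pieces_process e' x))); last 2 first.
    + by move=> x _; rewrite pieces_process_cat pieces_process_scale; ring.
    + by move=> x _; rewrite pieces_process_cat pieces_process_scale; ring.
    apply: le_trans (nsq_add_le mTD l1 l3) _.
    rewrite ip_scale // ipC ip_scale //.
    rewrite ler_pdivlMr // in He'.
    have := ip_ge0 Q TD (fun x => g x - pieces_process e' x); move: He He'.
    move: (ip _ _ _ _) (ip _ _ _ _) => x y h1 h2 y0; have := sqr_ge0 a; nra.
  - move=> k g Hk lg kg; split=> // eps eps0.
    have e4 : 0 < eps / 4 by rewrite divr_gt0.
    have /cvgrPdist_lt/(_ _ e4) [N _ HN] := kg.
    have [lk Hk'] := Hk N; have [e [se He]] := Hk' _ e4.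
    exists e; split=> //.
    apply: le_trans (nsq_sub_le mTD (L2Q_meas lg) (L2Q_meas lk) (lpm _ se)) _.
    have := HN N (leqnn _); rewrite /= sub0r normrN ger0_norm ?ip_ge0 // nsq_subC.
    by move: He; lra.
have stepI s t A : 0 <= s -> s <= t -> G s A -> adapted_piece G (Piece s t (\1_A)).
  move=> s0 st GA; split=> //=.
    apply: wrt_indic; [exact: (filt_sigma FG)|by rewrite setTI].
  by exists 1 => w; rewrite indicE; case: (_ \in _); rewrite ?normr1 ?normr0.
apply: pred_density => // s t A s0 st GA.
have okA := stepI s t A s0 st GA.
apply: (exactK _ [:: Piece s t (\1_A)]) => //.
  by have [l0 lh mc bc] := okA; exact: step_L2.
by apply: aeW => x _; rewrite /pieces_process big_seq1.
Qed.

Variable W : R -> T -> R.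
Hypothesis BW : is_BM P G W.

(** M is the integral of h along W. Asking for convergence along every
    approximating sequence makes integrals of sums, or with respect to two
    filtrations, directly comparable. *)
Definition ito_process (h : R * T -> R) (M : R -> T -> R) : Prop :=
  [/\ forall t, 0 <= t -> L2 P setT (G t) (M t),
      {ae P, forall w, cpath (M ^~ w)} &
      forall e : nat -> seq piece, (forall n, adapted_pieces G (e n)) ->
        ipQ (fun x => h x - pieces_process (e n) x) (fun x =>
          h x - pieces_process (e n) x) @[n --> \oo] --> 0 ->
        forall t, 0 <= t ->
        ipP (fun w => M t w - simple_int W (e n) t w)
            (fun w => M t w - simple_int W (e n) t w) @[n --> \oo] --> 0].

Lemma simple_int_path e w : adapted_pieces G e -> cpath (W ^~ w) -> cpath (fun t =>
  simple_int W e t w).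
Proof.
move=> + cW; elim: e => [_|p e IH [okp_ se]].
  by rewrite (_ : (fun t => _) = fun=> 0); [exact: cpath0|apply/funext => t;
    rewrite /simple_int big_nil].
rewrite (_ : (fun t => _) = fun t => 1 * (pcf p w * W (Num.min (phi p) t) w + (- pcf p w) * W
  (Num.min (plo p) t) w) + 1 * simple_int W e t w); last first.
  by apply/funext => t; rewrite /simple_int big_cons; ring.
have [l0 lh _ _] := okp_.
apply: cpath_lin; last exact: IH.
by apply: cpath_lin; [apply: (@cpath_min _ (W ^~ w)) => //;
  exact: le_trans lh|exact: (@cpath_min _ (W ^~ w))].
Qed.

Lemma simple_int_martingale e : adapted_pieces G e -> L2_martingale P G (simple_int W e).
Proof.
move=> se; split; first by move=> t t0; exact: (simple_int_L2G FG BW).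
by move=> s t xi s0 st lx; exact: (simple_int_mart_L2 FG BW).
Qed.

Lemma simple_int_dist e e' t : adapted_pieces G e -> adapted_pieces G e' -> 0 <= t ->
  ipP (fun w => simple_int W e t w - simple_int W e' t w) (fun w =>
    simple_int W e t w - simple_int W e' t w)
  <= ipQ (fun x => pieces_process e x - pieces_process e' x) (fun x =>
    pieces_process e x - pieces_process e' x).
Proof.
move=> se se' t0; have := simple_int_le FG BW (adapted_sub FG se se') t0.
rewrite (@eq_ip _ _ _ P setT _ (fun w => simple_int W e t w - simple_int W e' t w) _ (fun w =>
  simple_int W e t w - simple_int W e' t w)); try by move=> x _; rewrite simple_int_sub.
by rewrite (@eq_ip _ _ _ Q TD _ (fun x => pieces_process e x - pieces_process e' x) _ (fun x =>
  pieces_process e x - pieces_process e' x)) // => x _; rewrite pieces_process_sub.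
Qed.

(** Along a rapidly converging approximating sequence the suprema of the
    successive differences are summable by Doob's inequality, so that almost
    all paths converge uniformly. *)
Lemma ito_process_exists h : L2 Q TD Pred h -> exists M, ito_process h M.
Proof.
move=> lh; have lhm := L2Q_meas lh.
(* 64 eps n = 8^-n dominates the constant 8 of doob_sup times the bound
   4 eps n on the distance of successive approximations *)
pose eps n : R := (64 * 8 ^+ n)^-1.
have eps0 n : 0 < eps n by rewrite invr_gt0 mulr_gt0 // exprn_gt0.
pose e n := sval (cid (approx_simple lh (eps0 n))).
have se n : adapted_pieces G (e n) by case: (svalP (cid (approx_simple lh (eps0 n)))).
have he n : ipQ (fun x => h x - pieces_process (e n) x) (fun x =>
  h x - pieces_process (e n) x) <= eps n.
  by case: (svalP (cid (approx_simple lh (eps0 n)))).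
have lp n : L2 Q TD MQ (pieces_process (e n)) by apply: L2Q_meas; exact: (pieces_process_L2 FG).
have dist m n : ipQ (fun x => pieces_process (e m) x - pieces_process (e n) x) (fun x =>
  pieces_process (e m) x - pieces_process (e n) x) <= 2 * eps m + 2 * eps n.
  apply: le_trans (nsq_sub_le mTD (lp m) lhm (lp n)) _.
  by rewrite (nsq_subC Q TD (pieces_process (e m))); apply: lerD; rewrite ler_pM2l.
have epsS n : eps n.+1 <= eps n.
  rewrite lef_pV2 ?posrE ?mulr_gt0 ?exprn_gt0 // ler_pM2l // exprS.
  by rewrite ler_peMl ?exprn_ge0 // ler1n.
pose S n := simple_int W (sub_pieces (e n.+1) (e n)).
have HZ n := doob_sup FG (simple_int_martingale (adapted_sub FG (se n.+1) (se n)))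
  (fun t t0 => simple_int_le FG BW (adapted_sub FG (se n.+1) (se n)) t0).
pose Z n := sval (cid (HZ n)).
have ZP n := svalP (cid (HZ n)).
have aeZ : {ae P, forall w, setT w -> exists C : R, 0 <= C /\ forall n,
  (Z n w <= (C / 4 ^+ n)%:E)%E}.
  apply: (ae_fast measurableT) => n; have [mZ Z0 IZ _] := ZP n => //; first by move=> w _;
    exact: Z0.
  apply: (le_trans IZ); rewrite lee_fin.
  have := dist n.+1 n.
  rewrite (@eq_ip _ _ _ Q TD _ (pieces_process (sub_pieces (e n.+1) (e n))) _ (pieces_process
    (sub_pieces (e n.+1) (e n)))); try by move=> x _; rewrite pieces_process_sub.
  have := epsS n; have := eps0 n.
  have -> : 8 ^- n = 64 * eps n by rewrite /eps invfM mulrA divff ?mul1r // gt_eqF.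
  move: (ip _ _ _ _) => x; lra.
have aecW := bm_cont BW.
(* the exceptional paths form a null set, which belongs to every G t *)
pose good w := cpath (W ^~ w) /\ exists C : R, 0 <= C /\ forall n, (Z n w <= (C / 4 ^+ n)%:E)%E.
have aegood : {ae P, forall w, good w}.
  apply: filterS2 aecW aeZ => w /within_cpath cw Hw; split=> //; exact: Hw.
pose Om := [set w | good w].
have GOm t : 0 <= t -> G t Om.
  by move=> t0; rewrite -(setCK Om); apply: (filt_C FG) => //; exact: (filt_null FG).
pose J n t w := \1_Om w * simple_int W (e n) t w.
have Jfast w : Om w -> exists C : R, forall n t, 0 <= t -> `|J n.+1 t w - J n t w| <= C / 2 ^+ n.
  move=> Omw; have [cw [C [C0 HC]]] := Omw; exists (Num.sqrt C) => n t t0.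
  rewrite /J indicE mem_set // !mul1r -simple_int_sub.
  have cS := simple_int_path (adapted_sub FG (se n.+1) (se n)) cw.
  apply: (cpath_dyadic_le cS) => // k m.
  have [_ _ _ ZS] := ZP n; have := le_trans (ZS w k m) (HC n); rewrite lee_fin => h1.
  rewrite -(@ler_pXn2r _ 2) ?nnegrE ?divr_ge0 ?sqrtr_ge0 ?exprn_ge0 //.
  rewrite real_normK ?num_real // expr_div_n sqr_sqrtr //.
  apply: le_trans h1 _; rewrite -exprM mulnC exprM le_eqVlt; apply/orP; left; apply/eqP.
  by congr (_ / _ ^+ n); ring.
pose M t w := limn (fun n => J n t w).
have JM w : exists C : R, forall n t, 0 <= t -> cvgn (fun n => J n t w) /\
  `|M t w - J n t w| <= 2 * C / 2 ^+ n.
  have [Omw|nOm] := pselect (Om w).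
    have [C HC] := Jfast w Omw; exists C => n t t0.
    by have [c1 c2] := fast_cvg (fun n => HC n t t0); split.
  exists 0 => n t t0; have J0 m : J m t w = 0 by rewrite /J indicE memNset ?mul0r.
  have -> : (fun n => J n t w) = fun=> 0 by apply/funext => m; rewrite J0.
  split; first exact: is_cvg_cst.
  rewrite J0 subr0 /M (_ : (fun n => J n t w) = fun=> 0); last by apply/funext => m; rewrite J0.
  by rewrite lim_cst ?normr0 ?mulr0 ?mul0r.
have JcvgM t w : 0 <= t -> J n t w @[n --> \oo] --> M t w.
  by move=> t0; have [C HC] := JM w; have [] := HC 0%N t t0.
have lJ n t : 0 <= t -> L2 P setT (G t) (simple_int W (e n) t).
  by move=> t0; exact: (simple_int_L2G FG BW).
have mM t : 0 <= t -> measurable_wrt setT (G t) (M t).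
  move=> t0; apply: (wrt_lim (filt_sigma FG t0) (f := fun n => J n t)).
    move=> n; apply: wrt_mul; [exact: (filt_sigma FG)| |by case: (lJ n t t0)].
    by apply: wrt_indic; [exact: (filt_sigma FG)|rewrite setTI; exact: GOm].
  by move=> w _; exact: JcvgM.
have Mdist n t : 0 <= t -> (sqint P setT (fun w => (M t w - simple_int W (e n) t w)%R) <= (4 * eps
  n)%:E)%E.
  move=> t0; have lm k : L2P (simple_int W (e k) t) by apply: (L2G_meas FG t0); exact: lJ.
  apply: (@fatou_nsq _ _ _ P setT measurableT (fun m w =>
    simple_int W (e (m + n)%N) t w - simple_int W (e n) t w)).
  - by move=> m; apply: L2_subr => //; exact: sigma_algebra_M.
  - apply: measurable_funB.
      by apply/wrt_measurable_fun => // B mB; apply: (filt_meas FG t0); exact: mM.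
    by apply/wrt_measurable_fun => //; case: (lm n).
  - apply: filterS aegood => w gw _; apply: cvgB; last exact: cvg_cst.
    have := JcvgM t w t0; rewrite /J indicE mem_set // => c.
    have c' : simple_int W (e n) t w @[n --> \oo] --> M t w.
      by apply: cvg_trans c; apply: near_eq_cvg; near=> k; rewrite mul1r.
    by rewrite -(cvg_shiftn n) in c'.
  - near=> m; apply: le_trans (simple_int_dist (se _) (se _) t0) _.
    apply: le_trans (dist _ _) _.
    have : eps (m + n)%N <= eps n.
      by elim: (m : nat) => [|k IH] //; rewrite addSn (le_trans (epsS _)).
    lra.
have lM t : 0 <= t -> L2 P setT (G t) (M t).
  move=> t0; split; first exact: mM.
  have lm := L2G_meas FG t0 (lJ 0%N t t0).
  have ld : L2P (fun w => M t w - simple_int W (e 0) t w).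
    split; last exact: le_lt_trans (Mdist 0%N t t0) (ltry _).
    apply: wrt_sub; [exact: sigma_algebra_M| |by case: lm].
    by move=> B mB; apply: (filt_meas FG t0); exact: mM.
  suff [] : L2P (M t) by [].
  apply: (L2_eq _ (L2_add measurableT (sigma_algebra_M measurableT) (fun _ x => x) ld lm)).
  by move=> w _; rewrite subrK.
exists M; split=> //.
- apply: filterS aegood => w gw; have [C HC] := JM w.
  apply: (@cpath_lim _ (fun n t => J n t w) _ (fun n => 2 * C / 2 ^+ n)).
  + move=> n; rewrite (_ : (fun t => _) = fun t => 1 * simple_int W (e n) t w + 0 * 0).
      apply: cpath_lin; last exact: cpath0.
      by apply: simple_int_path => //; case: gw.
    by apply/funext => t; rewrite /J indicE mem_set // mul1r mul0r addr0.
  + exact: cvg_inv2X.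
  + by move=> n t t0; have [] := HC n t t0.
- move=> e' se' he' t t0.
  have lp' n : L2 Q TD MQ (pieces_process (e' n)) by apply: L2Q_meas; exact: (pieces_process_L2 FG).
  have lMm := L2G_meas FG t0 (lM t t0).
  have lJm n := L2G_meas FG t0 (lJ n t t0).
  have lJ' n : L2P (simple_int W (e' n) t) by apply: (L2G_meas FG t0);
    exact: (simple_int_L2G FG BW).
  apply: (@squeeze_cvgr _ _ _ _ (fun=> 0) (fun n => 8 * eps n +
    2 * (2 * eps n + 2 * ipQ (fun x => h x - pieces_process (e' n) x) (fun x =>
      h x - pieces_process (e' n) x)))).
  + near=> n; rewrite ip_ge0 /=.
    apply: le_trans (nsq_sub_le measurableT lMm (lJm n) (lJ' n)) _.
    apply: lerD.
      have -> : 8 * eps n = 2 * (4 * eps n) by ring.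
      rewrite ler_pM2l // -lee_fin -sqintE ?Mdist //.
      by apply: L2_subr => //; exact: sigma_algebra_M.
    rewrite ler_pM2l //; apply: le_trans (simple_int_dist (se n) (se' n) t0) _.
    apply: le_trans (nsq_sub_le mTD (lp n) lhm (lp' n)) _.
    by rewrite (nsq_subC Q TD (pieces_process (e n))); apply: lerD => //; rewrite ler_pM2l.
  + exact: cvg_cst.
  + have ceps : eps n @[n --> \oo] --> 0.
      have := @cvg_geometric R (64^-1) (8^-1).
      rewrite normfV ger0_norm // invf_lt1 // ltr1n => /(_ erefl).
      by rewrite /geometric /=; under eq_fun do rewrite exprVn -invfM.
    have c : 8 * eps n + 2 * (2 * eps n + 2 * ipQ (fun x =>
      h x - pieces_process (e' n) x) (fun x => h x - pieces_process (e' n) x)) @[n --> \oo]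
       --> (8 * 0 + 2 * (2 * 0 + 2 * 0) : R).
      apply: cvgD; first by apply: cvgM => //; exact: cvg_cst.
      apply: cvgM; first exact: cvg_cst.
      by apply: cvgD; apply: cvgM => //; exact: cvg_cst.
    by move: c; rewrite !mulr0 !addr0 mulr0 addr0.
Unshelve. all: by end_near. Qed.

End filtration.
End Ito.

(** * Properties of the real Ito integral *)

Section L2_limits.
Context {d : measure_display} {U : measurableType d} {R : realType}.
Variables (mu : {measure set U -> \bar R}) (D : set U).
Hypothesis mD : measurable D.
Notation L2m := (L2 mu D measurable).
Notation nsq f := (ip mu D f f).

Let sM := sigma_algebra_M mD.
Let MM : (@measurable d U) `<=` measurable. Proof. by []. Qed.

Lemma L2_lim_unique (k : nat -> U -> R) f g : (forall n, L2m (k n)) -> L2m f -> L2m g ->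
  nsq (fun x => f x - k n x) @[n --> \oo] --> 0 ->
  nsq (fun x => g x - k n x) @[n --> \oo] --> 0 -> {ae mu, forall x, D x -> f x = g x}.
Proof.
move=> lk lf lg kf kg.
have lfg : L2m (fun x => f x - g x) by exact: L2_subr.
have n0 : nsq (fun x => f x - g x) = 0.
  apply/eqP; rewrite eq_le ip_ge0 andbT.
  have c : 2 * nsq (fun x => f x - k n x) + 2 * nsq (fun x =>
    g x - k n x) @[n --> \oo] --> (2 * 0 + 2 * 0 : R).
    by apply: cvgD; apply: cvgM => //; exact: cvg_cst.
  rewrite !mulr0 addr0 in c; apply: (cvgr_to_ge c); near=> n.
  by rewrite (nsq_subC mu D g); exact: nsq_sub_le.
by have := nsq0_ae mD lfg n0; apply: filterS => x /[apply] /eqP; rewrite subr_eq0 => /eqP.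
Unshelve. all: by end_near. Qed.

Lemma nsq_cvg (k : nat -> U -> R) g : (forall n, L2m (k n)) -> L2m g ->
  nsq (fun x => g x - k n x) @[n --> \oo] --> 0 -> nsq (k n) @[n --> \oo] --> nsq g.
Proof.
move=> lk lg kg.
have kg' : nsq (fun x => k n x - g x) @[n --> \oo] --> 0.
  by under eq_fun do rewrite nsq_subC.
have c1 := ip_cvg mD lk lg lg kg'.
have -> : (fun n => nsq (k n)) = fun n => nsq (fun x => g x - k n x) + 2 * ip mu D (k n) g - nsq g.
  apply/funext => n; have := nsq_lin mD (-1) lg (lk n).
  rewrite (@eq_ip _ _ _ mu D _ (fun x => g x - k n x) _ (fun x => g x - k n x));
    try by move=> x _; ring.
  by move=> ->; rewrite (ipC mu D g (k n)); ring.
have c : nsq (fun x => g x - k n x) + 2 * ip mu D (k n) g - nsq g @[n --> \oo] --> (0 + 2 * nsq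
  g - nsq g : R).
  by apply: cvgB; [apply: cvgD => //; apply: cvgM => //; exact: cvg_cst|exact: cvg_cst].
have E : 0 + 2 * nsq g - nsq g = nsq g by ring.
by rewrite E in c.
Qed.

Lemma nsq_le_lim (k : nat -> U -> R) g (c : nat -> R) C : (forall n, L2m (k n)) -> L2m g ->
  nsq (fun x => g x - k n x) @[n --> \oo] --> 0 -> c n @[n --> \oo] --> C ->
  (forall n, nsq (k n) <= c n) -> nsq g <= C.
Proof.
move=> lk lg kg cC kc.
have c1 : c n - nsq (k n) @[n --> \oo] --> C - nsq g by apply: cvgB => //; exact: nsq_cvg.
by rewrite -subr_ge0; apply: (cvgr_to_ge c1); near=> n; rewrite subr_ge0.
Unshelve. all: by end_near. Qed.

Lemma nsq_lin_cvg (k l : nat -> U -> R) f g a : (forall n, L2m (k n)) -> (forall n, L2m (l n)) ->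
  L2m f -> L2m g ->
  nsq (fun x => f x - k n x) @[n --> \oo] --> 0 ->
  nsq (fun x => g x - l n x) @[n --> \oo] --> 0 ->
  nsq (fun x => (f x + a * g x) - (k n x + a * l n x)) @[n --> \oo] --> 0.
Proof.
move=> lk ll lf lg kf kg.
apply: (@squeeze_cvgr _ _ _ _ (fun=> 0) (fun n => 2 * nsq (fun x =>
  f x - k n x) + 2 * (a ^+ 2 * nsq (fun x => g x - l n x)))).
- near=> n; rewrite ip_ge0 /=.
  have l1 : L2m (fun x => f x - k n x) by exact: L2_subr.
  have l2 : L2m (fun x => g x - l n x) by exact: L2_subr.
  have l3 : L2m (fun x => a * (g x - l n x)) by exact: L2_scale.
  have := nsq_add_le mD l1 l3.
  rewrite (@eq_ip _ _ _ mu D _ (fun x => (f x + a * g x) - (k n x + a * l n x)) _ (fun x =>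
    (f x + a * g x) - (k n x + a * l n x))); try by move=> x _; ring.
  have -> // : nsq (fun x => a * (g x - l n x)) = a ^+ 2 * nsq (fun x => g x - l n x).
  by rewrite (ip_scale mD a l2 l3) (ipC mu D (fun x => g x - l n x)) (ip_scale mD a l2 l2)
    mulrA -expr2.
- exact: cvg_cst.
- have c : 2 * nsq (fun x => f x - k n x) + 2 * (a ^+ 2 * nsq (fun x =>
  g x - l n x)) @[n --> \oo] --> (2 * 0 + 2 * (a ^+ 2 * 0) : R).
    by apply: cvgD; apply: cvgM => //; try exact: cvg_cst; apply: cvgM => //; exact: cvg_cst.
  by move: c; rewrite !mulr0 addr0.
Unshelve. all: by end_near. Qed.

End L2_limits.

Section Ito_properties.
Context {d : measure_display} {T : measurableType d} {R : realType}.
Variable P : probability T R.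
Notation Q := ((@lebesgue_measure R) \x P)%E.
Notation TD := (@time_domain d T R).
Notation L2P := (L2 P setT measurable).
Notation ipP := (ip P setT).
Notation ipQ := (ip Q TD).
Notation MQ := (@measurable _ (measurableTypeR R * T)%type).

Let mTD := @measurable_TD d T R.

Section one_filtration.
Variable G : R -> set (set T).
Hypothesis FG : is_filtration P G.
Variable W : R -> T -> R.
Hypothesis BW : is_BM P G W.
Notation Pred := (predictable_sigma G).
Notation ito := (ito_process P G W).

Definition approximates (e : nat -> seq piece) (h : R * T -> R) : Prop :=
  (forall n, adapted_pieces G (e n)) /\
  ipQ (fun x => h x - pieces_process (e n) x) (fun x => h x - pieces_process (e n) x) @[n -->
    \oo] --> 0.

Lemma approximating_pieces h : L2 Q TD Pred h -> exists e, approximates e h.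
Proof.
move=> lh; have p n : 0 < (n.+1%:R)^-1 :> R by rewrite invr_gt0.
pose e n := sval (cid (approx_simple FG lh (p n))).
have eP n := svalP (cid (approx_simple FG lh (p n))).
exists e; split=> [n|]; first by case: (eP n).
apply: (@squeeze_cvgr _ _ _ _ (fun=> 0) (fun n => n.+1%:R^-1)).
- by near=> n; rewrite ip_ge0 /=; case: (eP n).
- exact: cvg_cst.
- exact: cvg_harmonic.
Unshelve. all: by end_near. Qed.

Let lpr (e : nat -> seq piece) n : (forall n, adapted_pieces G (e n)) ->
  L2 Q TD MQ (pieces_process (e n)).
Proof. by move=> se; apply: (L2Q_meas FG); exact: (pieces_process_L2 FG). Qed.

Let lsi t (e : nat -> seq piece) n : 0 <= t -> (forall n, adapted_pieces G (e n)) ->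
  L2P (simple_int W (e n) t).
Proof. by move=> t0 se; apply: (L2G_meas FG t0); exact: (simple_int_L2G FG BW). Qed.

Lemma ito_L2 h M t : ito h M -> 0 <= t -> L2P (M t).
Proof. by move=> [lM _ _] t0; exact: (L2G_meas FG t0 (lM t t0)). Qed.

(** The limit along one approximating sequence determines the integral. *)
Lemma ito_determined h M e N t : ito h M -> approximates e h -> 0 <= t -> L2P N ->
  ipP (fun w => N w - simple_int W (e n) t w) (fun w => N w - simple_int W (e n) t w) @[n -->
    \oo] --> 0 ->
  {ae P, forall w, N w = M t w}.
Proof.
move=> hM [se he] t0 lN Ne; have [_ _ lim] := hM.
have := L2_lim_unique measurableT (fun n => lsi n t0 se) lN (ito_L2 hM t0) Ne (lim _ se he t t0).
by apply: filterS => w; exact.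
Qed.

Lemma ito_norm h M t : L2 Q TD Pred h -> ito h M -> 0 <= t -> ipP (M t) (M t) <= ipQ h h.
Proof.
move=> lh hM t0; have [e [se he]] := approximating_pieces lh; have [_ _ lim] := hM.
apply: (nsq_le_lim measurableT (fun n => lsi n t0 se) (ito_L2 hM t0) (lim _ se he t t0)).
  exact: (nsq_cvg mTD (fun n => lpr n se) (L2Q_meas FG lh) he).
by move=> n; exact: (simple_int_le FG BW).
Qed.

Lemma approximates_lin h h' e e' a : L2 Q TD Pred h -> L2 Q TD Pred h' ->
  approximates e h -> approximates e' h' ->
  approximates (fun n => e n ++ scale_pieces a (e' n)) (fun x => h x + a * h' x).
Proof.
move=> lh lh' [se he] [se' he']; split=> [n|].
  by apply: adapted_cat => //; exact: (adapted_scale FG).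
have := nsq_lin_cvg mTD a (fun n => lpr n se) (fun n => lpr n se') (L2Q_meas FG lh) (L2Q_meas FG
  lh') he he'.
apply: cvg_trans; apply: near_eq_cvg; near=> n.
by apply: eq_ip => x _; rewrite pieces_process_cat pieces_process_scale.
Unshelve. all: by end_near. Qed.

Lemma ito_lin h h' a M M' N t : L2 Q TD Pred h -> L2 Q TD Pred h' ->
  ito h M -> ito h' M' -> ito (fun x => h x + a * h' x) N -> 0 <= t ->
  {ae P, forall w, N t w = M t w + a * M' t w}.
Proof.
move=> lh lh' hM hM' hN t0.
have [e ae] := approximating_pieces lh; have [e' ae'] := approximating_pieces lh'.
have aL := approximates_lin a lh lh' ae ae'.
have [se he] := ae; have [se' he'] := ae'.
have lN : L2P (fun w => M t w + a * M' t w).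
  by apply: L2_lin => //; [exact: sigma_algebra_M|exact: ito_L2 hM t0|exact: ito_L2 hM' t0].
have := ito_determined hN aL t0 lN.
have [_ _ lim] := hM; have [_ _ lim'] := hM'.
have c := nsq_lin_cvg measurableT a (fun n => lsi n t0 se) (fun n => lsi n t0 se')
  (ito_L2 hM t0) (ito_L2 hM' t0) (lim _ se he t t0) (lim' _ se' he' t t0).
move=> H; suff /H : ipP (fun w => M t w + a * M' t w - simple_int W (e n ++ scale_pieces a (e' n))
  t w)
    (fun w => M t w + a * M' t w - simple_int W (e n ++ scale_pieces a (e' n)) t w) @[n -->
      \oo] --> 0.
  by apply: filterS => w ->.
apply: cvg_trans c; apply: near_eq_cvg; near=> n.
by apply: eq_ip => w _; rewrite simple_int_cat simple_int_scale.
Unshelve. all: by end_near. Qed.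

Lemma ito_martingale h M : L2 Q TD Pred h -> ito h M -> L2_martingale P G M.
Proof.
move=> lh hM; have [lM _ lim] := hM; split=> // s t xi s0 st lx.
have t0 := le_trans s0 st.
have [e [se he]] := approximating_pieces lh.
have lxm := L2G_meas FG s0 lx.
have cv u : 0 <= u -> ipP (simple_int W (e n) u) xi @[n --> \oo] --> ipP (M u) xi.
  move=> u0; apply: (ip_cvg measurableT (fun n => lsi n u0 se) (ito_L2 hM u0) lxm).
  by under eq_fun do rewrite nsq_subC; exact: lim.
have c : ipP (simple_int W (e n) t) xi - ipP (simple_int W (e n) s) xi @[n --> \oo] --> ipP (M t)
  xi - ipP (M s) xi.
  by apply: cvgB; exact: cv.
rewrite (ip_sub measurableT (ito_L2 hM t0) (ito_L2 hM s0) lxm).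
rewrite -(cvg_lim _ c) //; apply: cvg_lim => //.
rewrite (_ : (fun n => _) = fun=> 0); first exact: cvg_cst.
apply/funext => n; rewrite -(ip_sub measurableT (lsi n t0 se) (lsi n s0 se) lxm).
exact: (simple_int_mart_L2 FG BW).
Qed.

Lemma ito_simple e h M t : adapted_pieces G e -> L2 Q TD Pred h -> {ae Q, forall x, TD x ->
  h x = pieces_process e x} ->
  ito h M -> 0 <= t -> {ae P, forall w, simple_int W e t w = M t w}.
Proof.
move=> se lh he hM t0.
have ld : L2 Q TD MQ (fun x => h x - pieces_process e x).
  by apply: L2_subr => //; [exact: sigma_algebra_M|exact: (L2Q_meas FG)|exact: (@lpr (fun=> e)
    0%N)].
have md : measurable_fun TD (fun x => h x - pieces_process e x) by apply/wrt_measurable_fun => //;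
  case: ld.
have z : ipQ (fun x => h x - pieces_process e x) (fun x => h x - pieces_process e x) = 0.
  rewrite (@ip_ae _ _ _ Q TD mTD _ (fun=> 0)) ?ip0l //.
  by move: he; apply: (@filterS _ _ (ae_Q_filter P)) => x /[apply] ->; rewrite subrr.
apply: (ito_determined (e := fun=> e) hM) => //.
- by split=> //; rewrite z; exact: cvg_cst.
- exact: (@lsi t (fun=> e) 0%N).
- rewrite (@eq_ip _ _ _ P setT _ (fun=> 0) _ (fun=> 0)); try by move=> w _; rewrite subrr.
  by rewrite ip0l; exact: cvg_cst.
Qed.

End one_filtration.

Section two_filtrations.
Variables G G' : R -> set (set T).
Hypotheses (FG : is_filtration P G) (FG' : is_filtration P G').
Hypothesis GG' : forall t, 0 <= t -> G' t `<=` G t.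
Variable W : R -> T -> R.
Hypotheses (BW : is_BM P G W) (BW' : is_BM P G' W).

Lemma adapted_mono e : adapted_pieces G' e -> adapted_pieces G e.
Proof.
elim: e => //= p e IH [[l0 lh mc bc] se]; split; last exact: IH.
by split=> // B mB; apply: (GG' l0); exact: mc.
Qed.

Lemma pred_mono : predictable_sigma G' `<=` predictable_sigma G.
Proof.
apply: smallest_sub; first exact: pred_sigma_algebra.
move=> A [[B GB <-]|[s [t [B [s0 st GB ->]]]]].
  by apply: rect0_pred; exact: GG'.
by apply: rect_pred => //; exact: GG'.
Qed.

Lemma L2_pred_mono h : L2 Q TD (predictable_sigma G') h -> L2 Q TD (predictable_sigma G) h.
Proof. by apply: L2_sub; exact: pred_mono. Qed.

(** Simple integrands for the smaller filtration are simple for the larger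
    one, and the same sequence computes both integrals. *)
Lemma ito_mono h M M' t : L2 Q TD (predictable_sigma G') h ->
  ito_process P G W h M -> ito_process P G' W h M' -> 0 <= t ->
  {ae P, forall w, M' t w = M t w}.
Proof.
move=> lh hM hM' t0; have [e [se he]] := approximating_pieces FG' lh.
have aG : approximates G e h by split=> // n; exact: adapted_mono.
apply: (ito_determined FG BW hM aG t0); first exact: (ito_L2 FG' hM' t0).
by have [_ _ lim] := hM'; exact: lim.
Qed.

End two_filtrations.
End Ito_properties.

(** * Augmented filtrations of Brownian motions *)

Section generated_sigma_fields.
Context {d : measure_display} {T : measurableType d} {R : realType}.
Implicit Types (S : set (set T)).

Lemma generated_sub {K : Type} (J : set K) (f : K -> T -> R) S : sigma_algebra setT S ->
  (forall k, J k -> measurable_wrt setT S (f k)) -> generated_sigma J f `<=` S.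
Proof.
move=> sS mf; apply: smallest_sub => // _ [k Jk [B mB <-]]; exact: mf.
Qed.

Lemma generated_coord {K : Type} (J : set K) (f : K -> T -> R) k : J k ->
  measurable_wrt setT (generated_sigma J f) (f k).
Proof. by move=> Jk B mB; apply: sub_sigma_algebra; exists k => //; exists B. Qed.

Lemma generated_sigma_algebra {K : Type} (J : set K) (f : K -> T -> R) :
  sigma_algebra setT (generated_sigma J f).
Proof. exact: smallest_sigma_algebra. Qed.

Lemma generated_mono {K : Type} (J J' : set K) (f : K -> T -> R) : J `<=` J' ->
  generated_sigma J f `<=` generated_sigma J' f.
Proof.
move=> JJ; apply: generated_sub; first exact: generated_sigma_algebra.
by move=> k /JJ; exact: generated_coord.
Qed.

Lemma sigma_setI S A B : sigma_algebra setT S -> S A -> S B -> S (A `&` B).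
Proof.
move=> sS SA SB; have := @sigma_algebraP _ setT S (fun X _ => @subsetT _ X).
by move=> [+ _] => /(_ sS) [_ _ _]; apply.
Qed.

Lemma sigma_setT S : sigma_algebra setT S -> S setT.
Proof. by move=> [S0 SC _]; have := SC _ S0; rewrite setD0. Qed.

Section complete_measure.
Variable P : probability T R.
Hypothesis Pcomplete : measure_is_complete P.

Lemma negligible_setI A B : P.-negligible A -> P.-negligible (A `&` B).
Proof. by apply: negligibleS; exact: subIsetl. Qed.

Definition completed (G : set (set T)) := <<s G `|` P.-negligible >>.

Lemma completed_sigma G : sigma_algebra setT (completed G).
Proof. exact: smallest_sigma_algebra. Qed.

Lemma completed_measurable G : G `<=` measurable -> completed G `<=` measurable.
Proof.
move=> GM; apply: g_sigma_measurable => // A [/GM //|nA].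
exact: Pcomplete.
Qed.

Lemma sub_completed G : G `<=` completed G.
Proof. by move=> A GA; apply: sub_sigma_algebra; left. Qed.

Lemma negligible_completed G : P.-negligible `<=` completed G.
Proof. by move=> A nA; apply: sub_sigma_algebra; right. Qed.

Lemma completed_sub G S : sigma_algebra setT S -> G `<=` S -> P.-negligible `<=` S ->
  completed G `<=` S.
Proof. by move=> sS GS NS; apply: smallest_sub => // A [/GS|/NS]. Qed.

Lemma completed_mono G G' : G `<=` completed G' -> completed G `<=` completed G'.
Proof.
move=> GG; apply: completed_sub => //; [exact: completed_sigma|exact: negligible_completed].
Qed.

(** Null sets may be added to a pi-system without losing either the stability
    under intersections or the vanishing of integrals. *)
Lemma integral0_completed G (r : T -> R) : setI_closed G -> G `<=` measurable ->
  P.-integrable setT (EFin \o r) -> \int[P]_w r w = 0 ->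
  (forall A, G A -> \int[P]_(w in A) r w = 0) ->
  forall A, completed G A -> \int[P]_(w in A) r w = 0.
Proof.
move=> IG GM ir r0 rG; apply: (integral0_pi_lambda measurableT) => //.
- move=> A B [GA|nA] [GB|nB].
  + by left; exact: IG.
  + by right; rewrite setIC; exact: negligible_setI.
  + by right; exact: negligible_setI.
  + by right; exact: negligible_setI.
- by move=> A [/GM //|/Pcomplete].
- move=> A [/rG //|nA]; have mA : measurable A by exact: Pcomplete.
  have [B [mB PB AB]] := nA.
  rewrite /Rintegral null_set_integral //.
  + by case/integrableP: (integrableS measurableT mA (@subsetT _ A) ir).
  + by apply: (subset_measure0 mA mB AB).
Qed.

End complete_measure.
End generated_sigma_fields.

Section augmented_filtrations.
Context {d : measure_display} {T : measurableType d} {R : realType}.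
Variable P : probability T R.
Hypothesis Pcomplete : measure_is_complete P.

Lemma augmented_is_filtration n (V : R -> T -> 'rV[R[i]]_n) :
  (forall k, 0 <= k.2 -> measurable_fun setT (ccoordinate V k)) ->
  is_filtration P (augmented_filtration P V).
Proof.
move=> mV; split.
- by move=> t t0; exact: smallest_sigma_algebra.
- move=> s t s0 st; apply: completed_mono; apply: subset_trans (@sub_completed _ _ _ P _).
  apply: generated_mono => k /= /andP[k0 ks]; rewrite k0 /=; exact: le_trans st.
- move=> t t0; apply: (completed_measurable Pcomplete); apply: generated_sub.
    exact: sigma_algebra_M.
  by move=> k /= /andP[k0 _]; apply/wrt_measurable_fun => //; exact: mV.
- by move=> t t0; exact: negligible_completed.
Qed.

Section two_processes.
Variables (n : nat) (X Y : R -> T -> 'rV[R]_n).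
Hypotheses (BX : brownian_motion P X) (BY : brownian_motion P Y).
Hypothesis XY : independent_processes P X Y.
Notation F := (augmented_filtration P (conformal X Y)).
Notation FX := (augmented_filtration P (complexify X)).

Lemma coordinate_measurable (V : R -> T -> 'rV[R]_n) k : brownian_motion P V -> 0 <= k.2 ->
  measurable_fun setT (coordinate V k).
Proof. by move=> [mV _ _ _] k0; exact: mV. Qed.

Lemma ccoordinate_conformal k :
  ccoordinate (conformal X Y) k = coordinate (if k.1.2 then X else Y) (k.1.1, k.2).
Proof. by apply/funext => w; rewrite /ccoordinate /coordinate !mxE; case: k.1.2. Qed.

Lemma ccoordinate_complexify k :
  ccoordinate (complexify X) k = if k.1.2 then coordinate X (k.1.1, k.2) else fun=> 0.
Proof. by apply/funext => w; rewrite /ccoordinate /coordinate !mxE; case: k.1.2. Qed.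

Lemma F_filtration : is_filtration P F.
Proof.
apply: augmented_is_filtration => k k0; rewrite ccoordinate_conformal.
by apply: coordinate_measurable => //; case: ifP.
Qed.

Lemma FX_filtration : is_filtration P FX.
Proof.
apply: augmented_is_filtration => k k0; rewrite ccoordinate_complexify.
by case: k.1.2 => //; exact: coordinate_measurable.
Qed.

Lemma X_adapted_F t j : 0 <= t -> measurable_wrt setT (F t) (fun w => X t w ord0 j).
Proof.
move=> t0 B mB; apply: sub_completed.
have := @generated_coord _ _ R _ [set k | 0 <= k.2 <= t] (ccoordinate (conformal X Y)) (j, true, t).
by rewrite ccoordinate_conformal /=; apply => //; rewrite t0 lexx.
Qed.

Lemma Y_adapted_F t j : 0 <= t -> measurable_wrt setT (F t) (fun w => Y t w ord0 j).
Proof.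
move=> t0 B mB; apply: sub_completed.
have := @generated_coord _ _ R _ [set k | 0 <= k.2 <= t] (ccoordinate (conformal X Y)) (j, false,
  t).
by rewrite ccoordinate_conformal /=; apply => //; rewrite t0 lexx.
Qed.

Lemma X_adapted_FX t j : 0 <= t -> measurable_wrt setT (FX t) (fun w => X t w ord0 j).
Proof.
move=> t0 B mB; apply: sub_completed.
have := @generated_coord _ _ R _ [set k | 0 <= k.2 <= t] (ccoordinate (complexify X)) (j, true, t).
by rewrite ccoordinate_complexify /=; apply => //; rewrite t0 lexx.
Qed.

Lemma FX_sub_F t : 0 <= t -> FX t `<=` F t.
Proof.
move=> t0; have sF := filt_sigma F_filtration t0.
apply: completed_sub => //; last exact: (filt_null F_filtration).
apply: generated_sub => // k /= /andP[k0 kt]; rewrite ccoordinate_complexify.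
case: k.1.2; last exact: wrt_cst.
by move=> B mB; apply: (filt_mono F_filtration k0 kt); exact: X_adapted_F.
Qed.

End two_processes.

Section joint_history.
Variables (n : nat) (V W : R -> T -> 'rV[R]_n).

(** A pi-system which, with the null sets, generates the past of (V, W) at
    time s. *)
Definition joint_events s : set (set T) :=
  [set C | exists A B, [/\ history V s A, history W s B & C = A `&` B]].

Lemma joint_setI s : setI_closed (joint_events s).
Proof.
move=> _ _ [A [B [VA WB ->]]] [A' [B' [VA' WB' ->]]].
exists (A `&` A'), (B `&` B'); split; last by rewrite setIACA.
  exact: (sigma_setI (generated_sigma_algebra _ _)).
exact: (sigma_setI (generated_sigma_algebra _ _)).
Qed.

Lemma history_joint s : history V s `<=` joint_events s.
Proof.
move=> A VA; exists A, setT; split=> //; last by rewrite setIT.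
by apply: sigma_setT; exact: generated_sigma_algebra.
Qed.

Lemma history_full s : history V s `<=` full_history V.
Proof. by apply: generated_mono => k /= /andP[]. Qed.

Lemma history_jointr s : history W s `<=` joint_events s.
Proof.
move=> A VA; exists setT, A; split=> //; last by rewrite setTI.
by apply: sigma_setT; exact: generated_sigma_algebra.
Qed.

Hypotheses (BV : brownian_motion P V) (BW : brownian_motion P W).
Hypothesis VW : independent_processes P V W.

Lemma full_measurable (U : R -> T -> 'rV[R]_n) : brownian_motion P U ->
  full_history U `<=` measurable.
Proof.
move=> BU; apply: generated_sub; first exact: sigma_algebra_M.
by move=> k k0; apply/wrt_measurable_fun => //; exact: coordinate_measurable.
Qed.

Lemma joint_measurable s : joint_events s `<=` measurable.
Proof.
move=> _ [A [B [VA WB ->]]]; apply: measurableI.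
  by apply: (full_measurable BV); apply: history_full VA.
by apply: (full_measurable BW); move: WB; apply: generated_mono => k /= /andP[].
Qed.

Let dV j s t w := V t w ord0 j - V s w ord0 j.

Lemma increment_full j s t : 0 <= s -> 0 <= t -> measurable_wrt setT (full_history V) (dV j s t).
Proof.
move=> s0 t0; apply: wrt_sub; first exact: generated_sigma_algebra.
  exact: (@generated_coord _ _ R _ [set k | 0 <= k.2] (coordinate V) (j, t)).
exact: (@generated_coord _ _ R _ [set k | 0 <= k.2] (coordinate V) (j, s)).
Qed.

(** Other coordinates are left unconstrained; they contribute factors 1. *)
Lemma increment_law j s t A B : 0 <= s -> s < t -> history V s A -> measurable B ->
  (P (A `&` dV j s t @^-1` B) = P A * normal_prob 0 (Num.sqrt (t - s)) B)%E.
Proof.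
move=> s0 st VA mB; have [_ _ _ law] := BV.
have := law s t s0 st A (fun j' => if j' == j then B else setT) VA.
have -> : [set w | forall j', (if j' == j then B else setT) (V t w ord0 j' - V s w ord0 j')] = dV
  j s t @^-1` B.
  apply/seteqP; split=> w /= h; first by have := h j; rewrite eqxx.
  by move=> j'; case: eqVneq => // ->.
move=> -> => [|j']; last by case: ifP.
congr (_ * _)%E; rewrite (bigD1 j) //= eqxx big1 ?mule1 // => j' /negbTE ->.
exact: probability_setT.
Qed.

(** For A and B in the pasts of V and W, independence of V and W removes B and
    the definition of Brownian motion treats A; a monotone class argument does
    the rest. *)
Lemma joint_increment_law j s t A B : 0 <= s -> s < t -> completed P (joint_events s) A ->
  measurable B -> (P (A `&` dV j s t @^-1` B) = P A * normal_prob 0 (Num.sqrt (t - s)) B)%E.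
Proof.
move=> s0 st GA mB; have t0 := le_trans s0 (ltW st).
have mdV : measurable_fun setT (dV j s t).
  apply/wrt_measurable_fun => // C mC; apply: (full_measurable BV); exact: increment_full.
pose E := dV j s t @^-1` B.
have mE : measurable E by rewrite -[E]setTI; exact: mdV.
pose q : R := fine (normal_prob 0 (Num.sqrt (t - s)) B).
have qE : normal_prob 0 (Num.sqrt (t - s)) B = q%:E by rewrite fineK // fin_num_measure.
pose r w : R := \1_E w - q.
have iE : P.-integrable setT (EFin \o (\1_E : T -> R)).
  by apply: integrable_indic => //; rewrite setTI fin_num_fun_lty.
have ic C : measurable C -> P.-integrable C (EFin \o (fun=> q : R)).
  by move=> mC; apply: finite_measure_integrable_cst.
have ir : P.-integrable setT (EFin \o r) by have := integrableB measurableT iE (ic _ measurableT).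
have rC C : measurable C -> \int[P]_(w in C) r w = fine (P (C `&` E)) - fine (P C) * q.
  move=> mC; rewrite /r RintegralB //; last 2 first.
  - exact: (integrableS measurableT).
  - exact: ic.
  rewrite /Rintegral integral_indic // integral_cst // setIC fineM ?fin_num_measure //.
  by rewrite mulrC.
have P1 C : measurable C -> P C = (fine (P C))%:E by move=> mC; rewrite fineK // fin_num_measure.
have jl C : joint_events s C -> \int[P]_(w in C) r w = 0.
  move=> JC; have mC := joint_measurable JC; rewrite rC //.
  have [C1 [C2 [VC WC CE]]] := JC.
  have mC1 : measurable C1 by apply: (full_measurable BV); exact: history_full VC.
  have mC2 : measurable C2.
    by apply: (full_measurable BW); move: WC; apply: generated_mono => k /= /andP[].
  have fC1 : full_history V C1 by exact: history_full VC.
  have fC2 : full_history W C2 by move: WC; apply: generated_mono => k /= /andP[].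
  have e1 : (P (C `&` E) = P C1 * q%:E * P C2)%E.
    rewrite CE setIAC VW //; first by rewrite (increment_law j s0 st VC mB) qE.
    apply: (sigma_setI (generated_sigma_algebra _ _)) => //.
    by rewrite -[E]setTI; exact: (increment_full j s0 t0).
  have e2 : (P C = P C1 * P C2)%E by rewrite CE VW.
  rewrite e1 e2 (P1 _ mC1) (P1 _ mC2) -!EFinM /=; ring.
have rT : \int[P]_w r w = 0.
  by apply: jl; apply: history_joint; apply: sigma_setT; exact: generated_sigma_algebra.
have mA : measurable A by apply: completed_measurable GA => //; exact: joint_measurable.
have := integral0_completed Pcomplete (@joint_setI s) (@joint_measurable s) ir rT jl GA.
rewrite rC // => /eqP; rewrite subr_eq0 => /eqP h.
rewrite (P1 _ (measurableI _ _ mA mE)) (P1 _ mA) qE -EFinM; congr EFin; exact: h.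
Qed.

(** Mean and variance over an event of the past are read off the Gaussian law
    of the increment on that event. *)
Lemma brownian_is_BM (G : R -> set (set T)) j :
  (forall t, 0 <= t -> G t `<=` completed P (joint_events t)) ->
  (forall t, 0 <= t -> measurable_wrt setT (G t) (fun w => V t w ord0 j)) ->
  is_BM P G (fun t w => V t w ord0 j).
Proof.
move=> GJ aG.
have mdV s t : 0 <= s -> 0 <= t -> measurable_fun setT (dV j s t).
  move=> s0 t0; apply/wrt_measurable_fun => // C mC; apply: (full_measurable BV);
    exact: increment_full.
have mG t A : 0 <= t -> G t A -> measurable A.
  move=> t0 /(GJ _ t0); apply: completed_measurable => //; exact: joint_measurable.
have quad s t A b : 0 <= s -> s < t -> completed P (joint_events s) A ->
    (\int[P]_(w in A) (dV j s t w ^+ 2 + b * dV j s t w + b ^+ 2)%:E = P A * ((t - s) + b ^+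
      2)%:E)%E.
  move=> s0 st GA; have p : 0 < t - s by rewrite subr_gt0.
  have mA : measurable A by apply: completed_measurable GA => //; exact: joint_measurable.
  have -> : t - s = Num.sqrt (t - s) ^+ 2 by rewrite sqr_sqrtr // ltW.
  apply: gaussian_quadratic => //; first by rewrite sqrtr_gt0.
    by apply: mdV => //; exact: le_trans (ltW st).
  by move=> B mB; exact: joint_increment_law.
have l2 s t : 0 <= s -> s <= t -> L2 P setT measurable (dV j s t).
  move=> s0; rewrite le_eqVlt => /orP[/eqP <-|st].
    apply: L2_eq (L2_0 _ (sigma_algebra_M measurableT)) => w _.
    by rewrite /dV subrr.
  split; first by apply/wrt_measurable_fun => //; apply: mdV => //; exact: le_trans (ltW st).
  have := quad s t setT 0 s0 st (sigma_setT (completed_sigma P _)).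
  rewrite /sqint probability_setT mul1e => E.
  rewrite (_ : (\int[P]_(x in setT) _ = (t - s + 0 ^+ 2)%:E)%E) ?ltry // -E.
  by apply: eq_integral => w _; rewrite mul0r expr0n /= !addr0.
have [_ _ cV _] := BV.
split=> //.
- by apply: filterS cV => w; exact.
- move=> s t A s0; rewrite le_eqVlt => /orP[/eqP <-|st] GA.
    by rewrite -[RHS](ip0l P setT (\1_A)); apply: eq_ip => // w _; rewrite subrr.
  have mA := mG _ _ s0 GA; have ld := l2 _ _ s0 (ltW st).
  rewrite (ip_indic mA ld) setTI.
  have J := GJ _ s0 _ GA.
  have h0 := quad s t A 0 s0 st J; have h1 := quad s t A 1 s0 st J.
  have i1 : P.-integrable A (EFin \o dV j s t).
    have := integrable_mul_set measurableT mA _ ld; rewrite setTI; apply.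
    by rewrite (le_lt_trans (probability_le1 P mA)) // ltry.
  have i2 : P.-integrable A (EFin \o (fun w => dV j s t w ^+ 2)).
    by apply: (integrableS measurableT) => //; exact: integrable_sqr.
  have i3 : P.-integrable A (EFin \o (fun=> 1 : R)) by exact: finite_measure_integrable_cst.
  have e0 : \int[P]_(w in A) (dV j s t w ^+ 2) = fine (P A) * (t - s).
    rewrite /Rintegral; move: h0; rewrite expr0n addr0 => h0.
    rewrite -[RHS](_ : fine (P A * (t - s)%:E)%E = _); last by rewrite fineM // fin_num_measure.
    by rewrite -h0; congr fine; apply: eq_integral => w _; rewrite mul0r !addr0.
  have i12 : P.-integrable A (EFin \o (fun w => dV j s t w ^+ 2 + dV j s t w)).
    by have := integrableD mA i2 i1.
  have e1 : \int[P]_(w in A) (dV j s t w ^+ 2 + dV j s t w + 1) = fine (P A) * (t - s + 1).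
    rewrite /Rintegral; move: h1; rewrite expr1n => h1.
    rewrite -[RHS](_ : fine (P A * (t - s + 1)%:E)%E = _); last by rewrite fineM // fin_num_measure.
    by rewrite -h1; congr fine; apply: eq_integral => w _; rewrite mul1r.
  move: e1; rewrite RintegralD // RintegralD // e0 /Rintegral integral_cst // mul1e.
  by rewrite (mulrDr _ _ 1) mulr1 -addrA => /addrI /eqP; rewrite -subr_eq0 addrK => /eqP.
- move=> s t A s0; rewrite le_eqVlt => /orP[/eqP <-|st] GA.
    by rewrite /Rintegral integral0_eq // => w _; rewrite !subrr expr0n subr0.
  have mA := mG _ _ s0 GA; have ld := l2 _ _ s0 (ltW st).
  have J := GJ _ s0 _ GA.
  have h0 := quad s t A 0 s0 st J.
  have i2 : P.-integrable A (EFin \o (fun w => dV j s t w ^+ 2)).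
    by apply: (integrableS measurableT) => //; exact: integrable_sqr.
  have i3 : P.-integrable A (EFin \o (fun=> t - s : R)) by exact: finite_measure_integrable_cst.
  rewrite RintegralB // /Rintegral integral_cst //.
  rewrite (_ : (\int[P]_(x in A) _ = P A * (t - s)%:E)%E); last first.
    move: h0; rewrite expr0n addr0 => <-.
    by apply: eq_integral => w _; rewrite mul0r !addr0.
  by rewrite muleC subrr.
Qed.

End joint_history.
End augmented_filtrations.

(** * Expectations given the path of X *)

Lemma closed_subspace_cap {d} {U : measurableType d} {R : realType}
  (mu : {measure set U -> \bar R}) (D : set U) (S : set (set U)) {I : Type}
  (K : set (U -> R)) (L : I -> set (U -> R)) : closed_subspace mu D S K ->
  (forall i, closed_subspace mu D S (L i)) ->
  closed_subspace mu D S [set f | K f /\ forall i, L i f].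
Proof.
move=> [KL K0 Klin Kcl] cL; split=> /=.
- by move=> f [/KL].
- by split=> // i; case: (cL i).
- move=> a f g [Kf Lf] [Kg Lg]; split; first exact: Klin.
  by move=> i; have [_ _ + _] := cL i; apply.
- move=> k g Hk lg kg; split; first by apply: Kcl kg => // n; case: (Hk n).
  by move=> i; have [_ _ _] := cL i; apply; [move=> n; case: (Hk n)|exact: lg|exact: kg].
Qed.

Lemma bounded_indic {T : Type} {R : realType} (A : set T) : exists M : R, forall w, `|\1_A w| <= M.
Proof. by exists 1 => w; rewrite indicE; case: (_ \in _); rewrite ?normr1 ?normr0. Qed.

Section conditioning_on_X.
Context {d : measure_display} {T : measurableType d} {R : realType}.
Variable P : probability T R.
Hypothesis Pcomplete : measure_is_complete P.
Variables (n : nat) (X Y : R -> T -> 'rV[R]_n).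
Hypotheses (BX : brownian_motion P X) (BY : brownian_motion P Y).
Hypothesis XY : independent_processes P X Y.
Notation F := (augmented_filtration P (conformal X Y)).
Notation FX := (augmented_filtration P (complexify X)).
Notation Xj j := (fun t w => X t w ord0 j).
Notation Yj j := (fun t w => Y t w ord0 j).
Notation Q := ((@lebesgue_measure R) \x P)%E.
Notation TD := (@time_domain d T R).
Notation L2P := (L2 P setT measurable).
Notation ipP := (ip P setT).
Notation ipQ := (ip Q TD).
Notation MQ := (@measurable _ (measurableTypeR R * T)%type).
Notation Pred := (predictable_sigma F).
Notation PredX := (predictable_sigma FX).
Notation FXoo := (completed P (full_history X)).

Let mTD := @measurable_TD d T R.
Let FF := F_filtration Pcomplete BX BY.
Let FFX := FX_filtration Pcomplete BX.
Let XF t (t0 : 0 <= t) := FX_sub_F Pcomplete BX BY t0.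
Let sM := @sigma_algebra_M d T setT measurableT.
Let MM : (@measurable d T) `<=` measurable. Proof. by []. Qed.
Let sP := @pred_sigma_algebra d T R F.
Let PM := pred_measurable FF.
Let sPX := @pred_sigma_algebra d T R FX.

Lemma independentC : independent_processes P Y X.
Proof. by move=> A B YA XB; rewrite setIC XY // muleC. Qed.

Lemma F_joint t : 0 <= t -> F t `<=` completed P (joint_events X Y t).
Proof.
move=> t0; apply: completed_mono; apply: generated_sub; first exact: completed_sigma.
move=> [[j b] u] /= /andP[u0 ut]; rewrite ccoordinate_conformal => B mB.
apply: sub_completed; case: b => /=; [apply: history_joint|apply: history_jointr];
  by apply: generated_coord => //=; rewrite u0.
Qed.

Lemma F_jointC t : 0 <= t -> F t `<=` completed P (joint_events Y X t).
Proof.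
move=> t0; apply: completed_mono; apply: generated_sub; first exact: completed_sigma.
move=> [[j b] u] /= /andP[u0 ut]; rewrite ccoordinate_conformal => B mB.
apply: sub_completed; case: b => /=; [apply: history_jointr|apply: history_joint];
  by apply: generated_coord => //=; rewrite u0.
Qed.

Lemma FX_joint t : 0 <= t -> FX t `<=` completed P (joint_events X Y t).
Proof. by move=> t0 A /(XF t0); exact: F_joint. Qed.

Lemma X_is_BM_F j : is_BM P F (Xj j).
Proof.
apply: (brownian_is_BM Pcomplete BX BY XY); first exact: F_joint.
by move=> t t0; exact: X_adapted_F.
Qed.

Lemma Y_is_BM_F j : is_BM P F (Yj j).
Proof.
apply: (brownian_is_BM Pcomplete BY BX independentC); first exact: F_jointC.
by move=> t t0; exact: Y_adapted_F.
Qed.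

Lemma X_is_BM_FX j : is_BM P FX (Xj j).
Proof.
apply: (brownian_is_BM Pcomplete BX BY XY); first exact: FX_joint.
by move=> t t0; exact: X_adapted_FX.
Qed.

Let sXoo : sigma_algebra setT FXoo. Proof. exact: completed_sigma. Qed.
Let MXoo : FXoo `<=` measurable.
Proof. by apply: (completed_measurable Pcomplete); exact: (full_measurable BX). Qed.
Let sY : sigma_algebra setT (full_history Y). Proof. exact: generated_sigma_algebra. Qed.
Let MY : full_history Y `<=` measurable. Proof. exact: (full_measurable BY). Qed.

Lemma FX_FXoo t : 0 <= t -> FX t `<=` FXoo.
Proof.
move=> t0; apply: completed_mono; apply: generated_sub; first exact: completed_sigma.
move=> [[j b] u] /= /andP[u0 ut]; rewrite ccoordinate_complexify /=.
case: b; last exact: wrt_cst.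
move=> B mB; apply: sub_completed.
exact: (@generated_coord _ _ R _ [set k | 0 <= k.2] (coordinate X) (j, u)).
Qed.

Lemma history_F_X t : history X t `<=` F t.
Proof.
move=> A HA; apply: sub_completed; move: A HA; apply: generated_sub;
  first exact: generated_sigma_algebra.
move=> [j u] /= ut.
have := @generated_coord _ _ R _ [set k | 0 <= k.2 <= t] (ccoordinate (conformal X Y)) (j, true,
  u) ut.
by rewrite ccoordinate_conformal.
Qed.

Lemma history_F_Y t : history Y t `<=` F t.
Proof.
move=> A HA; apply: sub_completed; move: A HA; apply: generated_sub;
  first exact: generated_sigma_algebra.
move=> [j u] /= ut.
have := @generated_coord _ _ R _ [set k | 0 <= k.2 <= t] (ccoordinate (conformal X Y)) (j, false,
  u) ut.
by rewrite ccoordinate_conformal.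
Qed.

Lemma history_FX t : history X t `<=` FX t.
Proof.
move=> A HA; apply: sub_completed; move: A HA; apply: generated_sub;
  first exact: generated_sigma_algebra.
move=> [j u] /= ut.
have := @generated_coord _ _ R _ [set k | 0 <= k.2 <= t] (ccoordinate (complexify X)) (j, true,
  u) ut.
by rewrite ccoordinate_complexify.
Qed.

Let prob B : R := fine (P B).

Let centred B w : R := \1_B w - prob B.

Let bounded_centred B : bounded (centred B).
Proof.
have [M HM] := @bounded_indic T R B; exists (M + `|prob B|) => w.
by rewrite /centred (le_trans (ler_normB _ _)) // lerD2r.
Qed.

Let int_centred B C : measurable B -> measurable C ->
  \int[P]_(w in C) centred B w = prob (B `&` C) - prob B * prob C.
Proof.
move=> mB mC; rewrite /centred RintegralB //.
- by rewrite /Rintegral integral_indic // integral_cst // fineM // fin_num_measure.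
- by apply: (integrableS measurableT) => //; apply: integrable_indic => //;
  rewrite setTI fin_num_fun_lty.
- exact: finite_measure_integrable_cst.
Qed.

Let wrt_centred S B : sigma_algebra setT S -> S B -> measurable_wrt setT S (centred B).
Proof.
move=> sS SB; apply: wrt_sub => //; last exact: wrt_cst.
by apply: wrt_indic => //; rewrite setTI.
Qed.

Let L2_centred B : measurable B -> L2P (centred B).
Proof. by move=> mB; apply: bounded_L2 => //; exact: wrt_centred. Qed.

Lemma FXoo_independent B C : full_history Y B -> FXoo C -> prob (B `&` C) = prob B * prob C.
Proof.
move=> YB XC; have mB := MY YB; have mC := MXoo XC.
have mA A : full_history X A -> measurable A by exact: (full_measurable BX).
have h A : full_history X A -> \int[P]_(w in A) centred B w = 0.
  move=> XA; have m := mA _ XA.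
  by rewrite int_centred // setIC /prob XY // fineM ?fin_num_measure // mulrC subrr.
have hT : full_history X setT by apply: sigma_setT; exact: generated_sigma_algebra.
have ir : P.-integrable setT (EFin \o centred B).
  by apply: (@integrable_bounded _ _ _ P _ measurable) => //; exact: wrt_centred.
have IG : setI_closed (full_history X).
  by move=> A1 A2; exact: (sigma_setI (generated_sigma_algebra _ _)).
have := integral0_completed Pcomplete IG (full_measurable BX) ir (h _ hT) h XC.
by rewrite int_centred // => /eqP; rewrite subr_eq0 => /eqP.
Qed.

Lemma centred_Y_orth B xi : full_history Y B -> L2 P setT FXoo xi -> ipP (centred B) xi = 0.
Proof.
move=> YB; have mB := MY YB; apply: (orth_sigma sXoo MXoo); first exact: L2_centred.
move=> C XC; have mC := MXoo XC.
by rewrite (ip_indic mC (L2_centred mB)) setTI int_centred // FXoo_independent // subrr.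
Qed.

Lemma centred_X_orth C eta : FXoo C -> L2 P setT (full_history Y) eta -> ipP (centred C) eta = 0.
Proof.
move=> XC; have mC := MXoo XC; apply: (orth_sigma sY MY); first exact: L2_centred.
move=> B YB; have mB := MY YB.
by rewrite (ip_indic mB (L2_centred mC)) setTI int_centred // setIC FXoo_independent // mulrC subrr.
Qed.

(** By pred_orth it suffices to test on ]a, b] x C with C in the past at time
    a; for fixed a and b the sets C that pass the test form a monotone class
    containing the joint events. *)
Lemma joint_orth r : L2 Q TD MQ r ->
  (forall a b A B, 0 <= a -> a <= b -> history X a A -> history Y a B ->
     ipQ r (step a b (\1_(A `&` B))) = 0) ->
  forall k, L2 Q TD Pred k -> ipQ r k = 0.
Proof.
move=> lr r0; apply: (pred_orth FF lr) => a b A a0 ab FA.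
have mI : measurable (`]a, b]%classic : set (measurableTypeR R)) by exact: measurable_itv.
pose I : set (measurableTypeR R * T) := `]a, b] `*` setT.
have mIT : MQ I by exact: measurableX.
have QI : (Q I < +oo)%E.
  by rewrite [X in (X < _)%E](Q_rect P measurableT ab) probability_setT mule1 ltry.
have ITD C : TD `&` (`]a, b] `*` C) = `]a, b] `*` C.
  apply/setIidPr => -[u w] [/=]; rewrite in_itv /= => /andP[au _] _.
  by rewrite /time_domain /= ltW // (le_lt_trans a0).
have stE C : measurable C -> ipQ r (step a b (\1_C)) = \int[Q]_(x in `]a, b] `*` C) r x.
  move=> mC; have mIC : MQ (`]a, b] `*` C) by exact: measurableX.
  have -> : step a b (\1_C) = (\1_(`]a, b] `*` C) : _ -> R).
    by apply/funext => x; rewrite stepE !indicE in_setX; case: (_ \in _); case: (_ \in _);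
      rewrite /=; ring.
  by rewrite (@ip_indic _ (measurableTypeR R * T)%type R Q TD r _ mIC lr) ITD.
pose G := joint_events X Y a `|` P.-negligible.
pose GI : set (set (measurableTypeR R * T)) := [set `]a, b] `*` C | C in G].
have GM : G `<=` measurable.
  by move=> C [|/Pcomplete //]; exact: (joint_measurable BX BY).
have ir : Q.-integrable I (EFin \o r).
  have := @integrable_mul_set _ (measurableTypeR R * T)%type R Q TD mTD r I mIT.
  by rewrite ITD; exact.
have G0 C : G C -> \int[Q]_(x in `]a, b] `*` C) r x = 0.
  move=> GC; case: (GC) => [[A' [B' [XA YB CE]]]|nC].
    by rewrite -stE; [rewrite CE r0|exact: GM].
  have mC := GM _ GC; have mIC : MQ (`]a, b] `*` C) by exact: measurableX.
  rewrite /Rintegral null_set_integral //.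
    have CI : `]a, b] `*` C `<=` I by move=> [u w] [].
    by have /integrableP[] := integrableS mIT mIC CI ir.
  rewrite [LHS](Q_rect P mC ab); have [D [mD PD CD]] := nC.
  by rewrite (subset_measure0 mC mD CD PD) mule0.
have JT : G setT.
  by left; apply: history_joint; apply: sigma_setT; exact: generated_sigma_algebra.
rewrite stE; last exact: (filt_meas FF) FA.
apply: (@integral0_pi_lambda _ (measurableTypeR R * T)%type R Q I mIT GI r) => //.
- move=> _ _ [C GC <-] [D GD <-]; exists (C `&` D); last by rewrite -setXI setIid.
  case: GC => [JC|nC]; last by right; exact: negligible_setI.
  case: GD => [JD|nD]; last by right; rewrite setIC; exact: negligible_setI.
  by left; exact: joint_setI.
- by move=> _ [C GC <-] [u w] [].
- by move=> _ [C GC <-]; apply: measurableX => //; exact: GM.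
- exact: G0.
- by move=> _ [C GC <-]; exact: G0.
- have sI : sigma_algebra I <<s I, GI>> by exact: smallest_sigma_algebra.
  have := F_joint a0 FA; apply: (@smallest_sub _ _ _ [set C | <<s I, GI>> (`]a, b] `*` C)]).
    have [S0 SC SU] := sI; split=> /=.
    + by rewrite setX0.
    + move=> C /SC; congr (<<s _, _>> _).
      apply/seteqP; split=> -[u w] /= [h1 h2]; first by case: h1 => ? _; split=> //;
        split=> // Cw; apply: h2.
      by split=> //; move=> [_ Cw]; case: h2.
    + move=> C HC; rewrite (_ : _ `*` _ = \bigcup_k (`]a, b] `*` C k)); first exact: SU.
      by apply/seteqP; split=> -[u w] /=; [move=> [h [k _ Ck]]; exists k|move=> [k _ [h Ck]];
        split=> //; exists k].
  by move=> C GC; apply: sub_sigma_algebra; exists C.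
Qed.

(** Membership in a closed subspace is proved by showing that the residual of
    the projection is orthogonal to steps over joint events. *)
Lemma joint_density K f : closed_subspace Q TD Pred K -> L2 Q TD Pred f ->
  (forall g, K g -> (forall k, K k -> ipQ (fun x => f x - g x) k = 0) ->
   forall a b A B, 0 <= a -> a <= b -> history X a A -> history Y a B ->
     ipQ (fun x => f x - g x) (step a b (\1_(A `&` B))) = 0) -> K f.
Proof.
move=> cK lf H; have lfm := L2Q_meas FF lf.
have [g [Kg og]] := @projection_exists _ (measurableTypeR R * T)%type R Q TD mTD Pred sP PM K f cK
  lfm.
have [KL _ _ _] := cK.
have lr : L2 Q TD Pred (fun x => f x - g x).
  exact: (@L2_subr _ (measurableTypeR R * T)%type R Q TD mTD Pred sP PM f g lf (KL _ Kg)).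
have z := joint_orth (L2Q_meas FF lr) (H g Kg og) lr.
have := @nsq0_ae _ (measurableTypeR R * T)%type R Q TD mTD _ (L2Q_meas FF lr) z.
move=> ae0; apply: (@closed_subspace_ae _ (measurableTypeR R * T)%type R Q TD mTD Pred PM K f g cK
  Kg lf).
by move: ae0; apply: (@filterS _ _ (ae_Q_filter P)) => x /[apply] /eqP; rewrite subr_eq0 => /eqP.
Qed.

Section kernel.
Variable W : R -> T -> R.
Hypothesis BW : is_BM P F W.
Notation ito := (ito_process P F W).

Lemma ito_dist h h' M M' t : L2 Q TD Pred h -> L2 Q TD Pred h' -> ito h M -> ito h' M' -> 0 <= t ->
  ipP (fun w => M t w - M' t w) (fun w => M t w - M' t w) <= ipQ (fun x => h x - h' x) (fun x =>
    h x - h' x).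
Proof.
move=> lh lh' hM hM' t0.
have ld : L2 Q TD Pred (fun x => h x + (-1) * h' x).
  exact: (@L2_lin _ (measurableTypeR R * T)%type R Q TD mTD Pred sP PM).
have [N hN] := ito_process_exists FF BW ld.
have := ito_norm FF BW ld hN t0.
rewrite (@eq_ip _ _ _ Q TD _ (fun x => h x - h' x) _ (fun x => h x - h' x)); try by move=> x _;
  rewrite mulN1r.
apply: le_trans; rewrite le_eqVlt; apply/orP; left; apply/eqP.
have aeN := ito_lin FF BW lh lh' hM hM' hN t0.
have lM := ito_L2 FF hM t0; have lM' := ito_L2 FF hM' t0; have lN := ito_L2 FF hN t0.
have md : measurable_fun setT (fun w => M t w - M' t w).
  by apply/wrt_measurable_fun => //; have [] := L2_subr measurableT sM MM lM lM'.
have mN : measurable_fun setT (N t) by apply/wrt_measurable_fun => //; case: lN.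
have aeq : {ae P, forall w, setT w -> M t w - M' t w = N t w}.
  by apply: filterS aeN => w -> _; rewrite mulN1r.
rewrite (ip_ae measurableT md mN md aeq) ipC (ip_ae measurableT md mN mN aeq) //.
Qed.

(** The integrands whose integral along W has, at every time, conditional
    expectation zero given the path of X. *)
Definition unseen_integrands : set (R * T -> R) :=
  [set h | L2 Q TD Pred h /\ forall M t C, ito h M -> 0 <= t -> FXoo C -> ipP (M t) (\1_C) = 0].

Let L2C C : FXoo C -> L2P (\1_C : T -> R).
Proof. by move=> XC; apply: indic_L2 => //; exact: MXoo. Qed.

Let ip_aeC f g C : L2P f -> L2P g -> FXoo C -> {ae P, forall w, f w = g w} ->
  ipP f (\1_C) = ipP g (\1_C).
Proof.
move=> lf lg XC fg; apply: ip_ae => //; try by apply/wrt_measurable_fun => //; case: lf.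
- by apply/wrt_measurable_fun => //; case: lg.
- by apply: measurable_indic; exact: MXoo.
- by apply: filterS fg.
Qed.

(** The integral at a fixed time is linear and a contraction. *)
Lemma unseen_closed : closed_subspace Q TD Pred unseen_integrands.
Proof.
split.
- by move=> h [].
- have l0 : L2 Q TD Pred (fun=> 0) by exact: (@L2_0 _ (measurableTypeR R * T)%type R Q TD Pred sP).
  split=> // M t C hM t0 XC.
  have := ito_simple FF BW (e := [::]) I l0 _ hM t0.
  case/(_ _)/Wrap.
    by apply: aeW => x _; rewrite /pieces_process big_nil.
  move=> h; rewrite (@ip_aeC _ (fun=> 0) C (ito_L2 FF hM t0) (L2_0 _ sM) XC) ?ip0l //.
  by apply: filterS h => w <-; rewrite /simple_int big_nil.
- move=> a f g [lf Hf] [lg Hg].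
  have ll := @L2_lin _ (measurableTypeR R * T)%type R Q TD mTD Pred sP PM a f g lf lg.
  split=> // N t C hN t0 XC.
  have [M hM] := ito_process_exists FF BW lf; have [M' hM'] := ito_process_exists FF BW lg.
  have lM := ito_L2 FF hM t0; have lM' := ito_L2 FF hM' t0.
  have h := ito_lin FF BW lf lg hM hM' hN t0.
  rewrite (ip_aeC (ito_L2 FF hN t0) (L2_lin measurableT sM MM a lM lM') XC h).
  by rewrite (ip_lin measurableT a lM lM' (L2C XC)) (Hf M) // (Hg M') // mulr0 addr0.
- move=> k g Hk lg kg; split=> // N t C hN t0 XC.
  have lk m : L2 Q TD Pred (k m) by case: (Hk m).
  pose M m := sval (cid (ito_process_exists FF BW (lk m))).
  have hM m : ito (k m) (M m) := svalP (cid (ito_process_exists FF BW (lk m))).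
  have lM m := ito_L2 FF (hM m) t0.
  have c : ipP (M m t) (\1_C) @[m --> \oo] --> ipP (N t) (\1_C).
    apply: (ip_cvg measurableT lM (ito_L2 FF hN t0) (L2C XC)).
    apply: (@squeeze_cvgr _ _ _ _ (fun=> 0) (fun m => ipQ (fun x => k m x - g x) (fun x =>
      k m x - g x))) => //.
      by near=> m; rewrite ip_ge0 /=; exact: ito_dist.
    exact: cvg_cst.
  rewrite -(cvg_lim _ c) //; apply: cvg_lim => //.
  rewrite (_ : (fun m => _) = fun=> 0); first exact: cvg_cst.
  by apply/funext => m; have [_ ->] := Hk m.
Unshelve. all: by end_near. Qed.

End kernel.

Let L2_step a b (c : T -> R) (S : R -> set (set T)) : is_filtration P S -> 0 <= a -> a <= b ->
  measurable_wrt setT (S a) c -> bounded c -> L2 Q TD (predictable_sigma S) (step a b c).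
Proof. by move=> FS a0 ab mc bc; exact: step_L2. Qed.

(** For 1_]a, b] 1_(A and B) with A in the past of X and B in the past of Y,
    an event C of the path of X splits off together with A, and the mean of an
    increment of Y over B is zero. *)
Lemma Y_unseen j h : L2 Q TD Pred h -> unseen_integrands (Yj j) h.
Proof.
move=> lh; have BYj := Y_is_BM_F j.
apply: (joint_density (unseen_closed BYj) lh) => g Kg og a b A B a0 ab XA YB; apply: og.
have FA := history_F_X XA; have FB := history_F_Y YB.
have FAB : F a (A `&` B) by exact: (filt_I FF).
have mAB : measurable_wrt setT (F a) (\1_(A `&` B) : T -> R).
  by apply: wrt_indic; [exact: (filt_sigma FF)|rewrite setTI].
have bAB := @bounded_indic T R (A `&` B).
have ls := L2_step FF a0 ab mAB bAB.
split=> // M t C hM t0 XC.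
have okp_ : adapted_pieces F [:: Piece a b (\1_(A `&` B))] by [].
have e := ito_simple FF BYj okp_ ls _ hM t0.
have {}e : {ae P, forall w, setT w -> M t w = \1_(A `&` B) w * (Y (Num.min b t) w ord0 j - Y
  (Num.min a t) w ord0 j)}.
  have /e : {ae Q, forall x, TD x -> step a b (\1_(A `&` B)) x = pieces_process [:: Piece a b
    (\1_(A `&` B))] x :> R}.
    by apply: aeW => x _; rewrite /pieces_process big_seq1.
  by apply: filterS => w <- _; rewrite /simple_int big_seq1.
have mMt : measurable_fun setT (M t) by apply/wrt_measurable_fun => //; case: (ito_L2 FF hM t0).
have mC1 : measurable_fun setT (\1_C : T -> R) by apply: measurable_indic; exact: MXoo.
have [ta|/ltW at_] := leP t a.
  rewrite (@ip_ae _ _ _ P setT measurableT _ (fun=> 0)) ?ip0l //.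
  by apply: filterS e => w /[apply] ->; rewrite (min_r (le_trans ta ab)) (min_r ta) subrr mulr0.
rewrite (min_l at_) in e; set u := Num.min b t in e.
have au : a <= u by rewrite le_min ab.
pose eta w := \1_B w * (Y u w ord0 j - Y a w ord0 j).
have u0 := le_trans a0 au.
have fYB : full_history Y B by exact: history_full YB.
have lDY : L2P (fun w => Y u w ord0 j - Y a w ord0 j) := bm_L2 BYj a0 au.
have leta : L2 P setT (full_history Y) eta.
  apply: (L2_mul_bounded sY MY); first by apply: (wrt_indic sY); rewrite setTI.
    exact: bounded_indic.
  split; last by case: lDY.
  exact: (increment_full j a0 u0).
have XAC : FXoo (A `&` C).
  by apply: (sigma_setI sXoo) => //; apply: (FX_FXoo a0); exact: history_FX.
have mAC := MXoo XAC.
have letam := L2_meas MY leta.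
have eta0 : ipP (fun=> 1) eta = 0.
  rewrite -(bm_mean BYj a0 au FB); apply: eq_Rintegral => w _; rewrite /eta; ring.
have := centred_X_orth XAC leta; rewrite /centred.
have l1 : L2P (\1_(A `&` C) : T -> R) by exact: indic_L2.
have lp : L2P (fun=> prob (A `&` C)).
  by apply: bounded_L2 => //; [exact: wrt_cst|exists `|prob (A `&` C)|].
have lo : L2P (fun=> 1).
  by apply: bounded_L2 => //; [exact: wrt_cst|exists `|1|].
rewrite (ip_sub measurableT l1 lp letam).
have -> : ipP (fun=> prob (A `&` C)) eta = 0.
  rewrite (@eq_ip _ _ _ P setT _ (fun w => prob (A `&` C) * 1) _ eta) //; last by move=> w _;
    rewrite mulr1.
  by rewrite (ip_scale measurableT _ lo letam) eta0 mulr0.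
rewrite subr0 => <-.
rewrite (ip_ae measurableT mMt _ mC1 e).
  apply: eq_Rintegral => w _; rewrite /eta !indicE !in_setI.
  by case: (w \in A); case: (w \in B); case: (w \in C); rewrite /= ?mul0r ?mul1r ?mulr0 ?mulr1.
have [ml _] := lDY; apply: measurable_funM; last exact/wrt_measurable_fun.
by apply: measurable_indic; exact: (filt_meas FF) FAB.
Qed.

(** The step 1_]a, b] 1_(A and B) is the sum of P(B) 1_]a, b] 1_A, predictable
    for X, and of 1_]a, b] 1_A (1_B - P(B)). The latter is orthogonal to the
    integrands predictable for X, and its integral carries the factor
    1_B - P(B), which is centred given the path of X. *)
Lemma X_unseen j h : L2 Q TD Pred h -> (forall k, L2 Q TD PredX k -> ipQ h k = 0) ->
  unseen_integrands (Xj j) h.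
Proof.
move=> lh hort; have BXj := X_is_BM_F j.
pose K := [set f | unseen_integrands (Xj j) f /\
  forall k : {k | L2 Q TD PredX k}, L2 Q TD Pred f /\ ipQ (sval k) f = 0].
have LX k : L2 Q TD PredX k -> L2 Q TD Pred k by exact: L2_pred_mono.
have cK : closed_subspace Q TD Pred K.
  apply: (closed_subspace_cap (L := fun k : {k | L2 Q TD PredX k} => [set f | L2 Q TD Pred f /\
    ipQ (sval k) f = 0])).
    exact: unseen_closed.
  move=> [k lk]; apply: (@orth_closed _ R (measurableTypeR R * T)%type Q TD Pred k mTD sP PM).
  by apply: (L2Q_meas FF); exact: LX.
suff [] : K h by [].
apply: (joint_density cK lh) => g [Kg og] oK a b A B a0 ab XA YB.
have FA := history_F_X XA; have FB := history_F_Y YB.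
have FXA := history_FX XA; have XooA := FX_FXoo a0 FXA.
have fYB : full_history Y B by exact: history_full YB.
have lgm : L2 Q TD MQ g by apply: (L2Q_meas FF); case: Kg.
have lhm := L2Q_meas FF lh.
have lhg : L2 Q TD MQ (fun x => h x - g x).
  exact: (@L2_subr _ (measurableTypeR R * T)%type R Q TD mTD MQ (@sigma_algebra_M _
    (measurableTypeR R * T)%type TD mTD) (fun _ x => x)).
pose c w := \1_A w * centred B w.
have mcF : measurable_wrt setT (F a) c.
  have sFa := filt_sigma FF a0.
  apply: wrt_mul => //; last exact: wrt_centred.
  by apply: wrt_indic => //; rewrite setTI.
have bc : bounded c by apply: bounded_mul => //; exact: bounded_indic.
have mAX : measurable_wrt setT (FX a) (\1_A : T -> R).
  by apply: wrt_indic; [exact: (filt_sigma FFX)|rewrite setTI].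
have lsA := L2_step FFX a0 ab mAX (@bounded_indic T R A).
have lsc := L2_step FF a0 ab mcF bc.
have lsAm := L2Q_meas FF (LX _ lsA); have lscm := L2Q_meas FF lsc.
have mc : measurable_fun setT c.
  by apply/wrt_measurable_fun => // D mD; apply: (filt_meas FF a0); exact: mcF.
have oA : ipQ (fun x => h x - g x) (step a b (\1_A)) = 0.
  rewrite (ip_sub mTD lhm lgm lsAm) hort // ipC.
  by have [_ ->] := og (exist _ _ lsA); rewrite subrr.
have Kc : K (step a b c).
  split; last first.
    move=> [k lk]; split=> //=; rewrite ipC.
    apply: (pred_orth FFX lscm) => // s t C s0 st FC.
    have mC : measurable C by exact: (filt_meas FFX) FC.
    rewrite ip_step //; last by exact: bounded_indic.
    rewrite (_ : ipP c (\1_C) = 0) ?mulr0 //.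
    have XC : FXoo (A `&` C) by apply: (sigma_setI sXoo XooA); exact: FX_FXoo FC.
    rewrite -(centred_Y_orth (xi := \1_(A `&` C)) fYB); last exact: indic_L2.
    by apply: eq_Rintegral => w _; rewrite /c !indicE in_setI; case: (w \in A); case: (w \in C);
      rewrite /=; ring.
  split=> // M t C hM t0 XC.
  have okp_ : adapted_pieces F [:: Piece a b c] by [].
  have e := ito_simple FF BXj okp_ lsc _ hM t0.
  have {}e : {ae P, forall w, setT w -> M t w = c w * (X (Num.min b t) w ord0 j - X (Num.min a t)
    w ord0 j)}.
    have /e : {ae Q, forall x, TD x -> step a b c x = pieces_process [:: Piece a b c] x :> R}.
      by apply: aeW => x _; rewrite /pieces_process big_seq1.
    by apply: filterS => w <- _; rewrite /simple_int big_seq1.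
  have mMt : measurable_fun setT (M t) by apply/wrt_measurable_fun => //; case: (ito_L2 FF hM t0).
  have mC1 : measurable_fun setT (\1_C : T -> R) by apply: measurable_indic; exact: MXoo.
  set u := Num.min b t in e; set v := Num.min a t in e.
  have v0 : 0 <= v by rewrite le_min a0.
  have vu : v <= u by rewrite le_min2.
  have u0 := le_trans v0 vu.
  have lD : L2 P setT FXoo (fun w => X u w ord0 j - X v w ord0 j).
    split; last by have [] := bm_L2 BXj v0 vu.
    apply: wrt_sub => // D mD.
      by apply: (FX_FXoo u0); exact: X_adapted_FX.
    by apply: (FX_FXoo v0); exact: X_adapted_FX.
  have XAC : FXoo (A `&` C) by exact: (sigma_setI sXoo).
  have lxi : L2 P setT FXoo (fun w => \1_(A `&` C) w * (X u w ord0 j - X v w ord0 j)).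
    apply: L2_mul_bounded => //; last exact: bounded_indic.
    by apply: wrt_indic => //; rewrite setTI.
  rewrite -(centred_Y_orth fYB lxi) (ip_ae measurableT mMt _ mC1 e).
    by apply: eq_Rintegral => w _; rewrite /c !indicE in_setI; case: (w \in A); case: (w \in C);
      rewrite /=; ring.
  have [ml _] := L2_meas MXoo lD; apply: measurable_funM => //; exact/wrt_measurable_fun.
have sE x : step a b (\1_(A `&` B)) x = step a b c x + prob B * step a b (\1_A) x.
  rewrite /step; case: ifP => _; last by rewrite mulr0 addr0.
  by rewrite /c /centred !indicE in_setI; case: (_ \in A); case: (_ \in B); rewrite /=; ring.
rewrite (@eq_ip _ _ _ Q TD _ (fun x => h x - g x) _ (fun x =>
  step a b c x + prob B * step a b (\1_A) x)) //.
by rewrite (ip_linr mTD _ lscm lsAm lhg) oA oK // mulr0 addr0.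
Qed.

End conditioning_on_X.

(** * Complex integrals from real ones *)

Section complex_components.
Context {R : realType}.
Implicit Types z u : R[i].

Lemma eq_complex_parts z u : complex.Re z = complex.Re u -> complex.Im z = complex.Im u -> z = u.
Proof. by case: z => a b; case: u => c e /= -> ->. Qed.

Lemma cReD z u : complex.Re (z + u) = complex.Re z + complex.Re u.
Proof. by case: z => a b; case: u. Qed.

Lemma cImD z u : complex.Im (z + u) = complex.Im z + complex.Im u.
Proof. by case: z => a b; case: u. Qed.

Lemma cReB z u : complex.Re (z - u) = complex.Re z - complex.Re u.
Proof. by case: z => a b; case: u. Qed.

Lemma cImB z u : complex.Im (z - u) = complex.Im z - complex.Im u.
Proof. by case: z => a b; case: u. Qed.

Lemma cReM z u : complex.Re (z * u) = complex.Re z * complex.Re u - complex.Im z * complex.Im u.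
Proof. by case: z => a b; case: u. Qed.

Lemma cImM z u : complex.Im (z * u) = complex.Re z * complex.Im u + complex.Im z * complex.Re u.
Proof. by case: z => a b; case: u. Qed.

Lemma cRe_sum {I : Type} (r : seq I) (f : I -> R[i]) :
  complex.Re (\sum_(i <- r) f i) = \sum_(i <- r) complex.Re (f i).
Proof. by elim: r => [|i r IH]; rewrite ?big_nil // !big_cons cReD IH. Qed.

Lemma cIm_sum {I : Type} (r : seq I) (f : I -> R[i]) :
  complex.Im (\sum_(i <- r) f i) = \sum_(i <- r) complex.Im (f i).
Proof. by elim: r => [|i r IH]; rewrite ?big_nil // !big_cons cImD IH. Qed.

Lemma normc_sq z : Normc.normc z ^+ 2 = complex.Re z ^+ 2 + complex.Im z ^+ 2.
Proof. by case: z => a b /=; rewrite sqr_sqrtr // addr_ge0 ?sqr_ge0. Qed.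

Lemma normc_Re z : `|complex.Re z| <= Normc.normc z.
Proof.
case: z => a b /=; rewrite -sqrtr_sqr ler_wsqrtr //.
by rewrite lerDl sqr_ge0.
Qed.

Lemma normc_Im z : `|complex.Im z| <= Normc.normc z.
Proof.
case: z => a b /=; rewrite -sqrtr_sqr ler_wsqrtr //.
by rewrite lerDr sqr_ge0.
Qed.

End complex_components.

Section sqint_complex.
Context {d : measure_display} {U : measurableType d} {R : realType}.
Variables (mu : {measure set U -> \bar R}) (D : set U).
Hypothesis mD : measurable D.
Notation L2m := (L2 mu D measurable).
Notation nsq f := (ip mu D f f).

Lemma integral_normc_sq (g : U -> R[i]) : measurable_fun D (fun x => complex.Re (g x)) ->
  measurable_fun D (fun x => complex.Im (g x)) ->
  (\int[mu]_(x in D) (Normc.normc (g x) ^+ 2)%:E =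
   sqint mu D (fun x => complex.Re (g x)) + sqint mu D (fun x => complex.Im (g x)))%E.
Proof.
move=> m1 m2; under eq_integral do rewrite normc_sq EFinD.
rewrite ge0_integralD //.
- by move=> x _; rewrite lee_fin sqr_ge0.
- by apply/measurable_EFinP; exact: measurable_funX.
- by move=> x _; rewrite lee_fin sqr_ge0.
- by apply/measurable_EFinP; exact: measurable_funX.
Qed.

Lemma sqint_ge0 (f : U -> R) : (0 <= sqint mu D f)%E.
Proof. by apply: integral_ge0 => x _; rewrite lee_fin sqr_ge0. Qed.

(** A distance to k n that tends to zero is eventually finite, which makes f
    square integrable. *)
Lemma sqint_cvg0 (k : nat -> U -> R) (f : U -> R) : (forall n, L2m (k n)) -> measurable_fun D f ->
  (fun n => sqint mu D (fun x => f x - k n x)%R) @ \oo --> (0 : \bar R)%E ->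
  L2m f /\ nsq (fun x => f x - k n x) @[n --> \oo] --> 0.
Proof.
move=> lk mf c.
have ld n : (sqint mu D (fun x => f x - k n x)%R < +oo)%E -> L2m (fun x => f x - k n x).
  move=> h; split=> //; apply: wrt_sub; first exact: sigma_algebra_M.
    exact/wrt_measurable_fun.
  by case: (lk n).
have lf : L2m f.
  have /fine_cvgP[[N _ HN] _] := c.
  have hN := HN N (leqnn _).
  apply: (L2_eq _ (L2_add mD (sigma_algebra_M mD) (fun _ x => x) (ld N _) (lk N))).
    by move=> x _; rewrite subrK.
  by rewrite ltey_eq hN.
split=> //; have /fine_cvg := c.
apply: cvg_trans; apply: near_eq_cvg; near=> n; rewrite /= sqintE //.
by apply: L2_subr => //; exact: sigma_algebra_M.
Unshelve. all: by end_near. Qed.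

Lemma sqint_cvg (k l : nat -> U -> R) : (forall n, L2m (k n)) -> (forall n, L2m (l n)) ->
  nsq (k n) @[n --> \oo] --> 0 -> nsq (l n) @[n --> \oo] --> 0 ->
  (fun n => sqint mu D (k n) + sqint mu D (l n))%E @ \oo --> (0 : \bar R)%E.
Proof.
move=> lk ll ck cl; under eq_fun do rewrite !sqintE // -EFinD.
apply: cvg_EFin; first by near=> n.
have := cvgD ck cl; rewrite addr0; exact.
Unshelve. all: by end_near. Qed.

Lemma sum_cvg0l (a b : nat -> \bar R) : (forall n, (0 <= a n)%E) -> (forall n, (0 <= b n)%E) ->
  (fun n => a n + b n)%E @ \oo --> (0 : \bar R)%E -> a @ \oo --> (0 : \bar R)%E.
Proof.
move=> a0 b0; apply: squeeze_cvge; last exact: cvg_cst.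
by near=> n; rewrite a0 /= leeDl.
Unshelve. all: by end_near. Qed.

Lemma sum_cvg0r (a b : nat -> \bar R) : (forall n, (0 <= a n)%E) -> (forall n, (0 <= b n)%E) ->
  (fun n => a n + b n)%E @ \oo --> (0 : \bar R)%E -> b @ \oo --> (0 : \bar R)%E.
Proof.
move=> a0 b0 h; apply: (sum_cvg0l b0 a0); apply: cvg_trans h.
by apply: near_eq_cvg; near=> n; rewrite addeC.
Unshelve. all: by end_near. Qed.

End sqint_complex.

Section complex_integrands.
Context {d : measure_display} {T : measurableType d} {R : realType}.
Variable P : probability T R.
Notation Q := ((@lebesgue_measure R) \x P)%E.
Notation TD := (@time_domain d T R).
Notation L2P := (L2 P setT measurable).
Notation ipP := (ip P setT).
Notation ipQ := (ip Q TD).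
Notation MQ := (@measurable _ (measurableTypeR R * T)%type).

Let mTD := @measurable_TD d T R.
Let sM := @sigma_algebra_M d T setT measurableT.
Let MM : (@measurable d T) `<=` measurable. Proof. by []. Qed.

(** Tonelli's theorem, after extension by zero to negative times. *)
Lemma iterated_integral (f : measurableTypeR R * T -> R) : measurable_fun (TD : set
  (measurableTypeR R * T)) f ->
  (forall x, 0 <= f x) ->
  (\int[P]_w \int[lebesgue_measure]_(t in `[0%R, +oo[) (f (t,
    w))%:E = \int[Q]_(x in TD) (f x)%:E)%E.
Proof.
move=> mf f0.
have mE : measurable_fun setT ((EFin \o f) \_ TD) by apply/(measurable_restrictT _ mTD);
  exact/measurable_EFinP.
rewrite [RHS]integral_mkcond fubini_tonelli2 //; last first.
  by move=> x; rewrite patchE; case: ifP => // _; rewrite lee_fin.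
apply: eq_integral => w _; rewrite integral_mkcond; apply: eq_integral => t _.
rewrite !patchE; have -> : ((t, w) \in TD) = (0 <= t) by apply/idP/idP; rewrite inE.
by rewrite mem_setE in_itv /= andbT.
Qed.

Lemma iterated_normc_sq (g : R -> T -> R[i]) :
  measurable_fun (TD : set (measurableTypeR R * T)) (fun x => complex.Re (g x.1 x.2)) ->
  measurable_fun (TD : set (measurableTypeR R * T)) (fun x => complex.Im (g x.1 x.2)) ->
  (\int[P]_w \int[lebesgue_measure]_(t in `[0%R, +oo[) (Normc.normc (g t w) ^+ 2)%:E =
   sqint Q TD (fun x => complex.Re (g x.1 x.2)) + sqint Q TD (fun x => complex.Im (g x.1 x.2)))%E.
Proof.
move=> m1 m2; rewrite -(@integral_normc_sq _ (measurableTypeR R * T)%type R Q TD mTD (fun x =>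
  g x.1 x.2)) //.
rewrite -(iterated_integral (f := fun x => Normc.normc (g x.1 x.2) ^+ 2)) //.
  by under eq_fun do rewrite normc_sq; apply: measurable_funD; exact: measurable_funX.
by move=> x; exact: sqr_ge0.
Qed.

Section real_parts.
Variable e : simple_integrand (T := T) (R := R).

Definition re_pieces : seq piece :=
  [seq Piece (lo k) (hi k) (fun w => complex.Re (coef k w)) | k <- enum 'I_(pieces e)].

Definition im_pieces : seq piece :=
  [seq Piece (lo k) (hi k) (fun w => complex.Im (coef k w)) | k <- enum 'I_(pieces e)].

Lemma adapted_re G : adapted_simple G e -> adapted_pieces G re_pieces.
Proof.
move=> ae; rewrite /re_pieces; elim: (enum _) => //= k r IH; split=> //.
have [l0 lh [mr mi] [M HM]] := ae k; split=> //=.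
by exists M => w; apply: le_trans (normc_Re _) (HM w).
Qed.

Lemma adapted_im G : adapted_simple G e -> adapted_pieces G im_pieces.
Proof.
move=> ae; rewrite /im_pieces; elim: (enum _) => //= k r IH; split=> //.
have [l0 lh [mr mi] [M HM]] := ae k; split=> //=.
by exists M => w; apply: le_trans (normc_Im _) (HM w).
Qed.

Lemma Re_simple_process t w : complex.Re (simple_process e t w) = pieces_process re_pieces (t, w).
Proof.
rewrite /simple_process cRe_sum /pieces_process big_map big_enum /=; apply: eq_bigr => k _.
by rewrite /step /=; case: ifP.
Qed.

Lemma Im_simple_process t w : complex.Im (simple_process e t w) = pieces_process im_pieces (t, w).
Proof.
rewrite /simple_process cIm_sum /pieces_process big_map big_enum /=; apply: eq_bigr => k _.
by rewrite /step /=; case: ifP.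
Qed.

Variables W1 W2 : R -> T -> R.
Let W t w : R[i] := Complex (W1 t w) (W2 t w).

Let simple_int_re W' t w : simple_int W' re_pieces t w =
  \sum_(k < pieces e) complex.Re (coef k w) * (W' (Num.min (hi k) t) w - W' (Num.min (lo k) t) w).
Proof. by rewrite /simple_int big_map big_enum. Qed.

Let simple_int_im W' t w : simple_int W' im_pieces t w =
  \sum_(k < pieces e) complex.Im (coef k w) * (W' (Num.min (hi k) t) w - W' (Num.min (lo k) t) w).
Proof. by rewrite /simple_int big_map big_enum. Qed.

Lemma Re_simple_integral t w : complex.Re (simple_integral e W t w) =
  simple_int W1 re_pieces t w - simple_int W2 im_pieces t w.
Proof.
rewrite /simple_integral cRe_sum simple_int_re simple_int_im -sumrB; apply: eq_bigr => k _.
by rewrite cReM.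
Qed.

Lemma Im_simple_integral t w : complex.Im (simple_integral e W t w) =
  simple_int W1 im_pieces t w + simple_int W2 re_pieces t w.
Proof.
rewrite /simple_integral cIm_sum simple_int_re simple_int_im -big_split; apply: eq_bigr => k _.
by rewrite cImM addrC.
Qed.

End real_parts.

Section mixture.
Variables e1 e2 : seq (@piece d T R).

(** The complex integrand e1 + i e2. *)
Definition mix : simple_integrand (T := T) (R := R) :=
  @SimpleIntegrand d T R (size e1 + size e2)
    (fun k => match fintype.split k with inl i => plo (tnth (in_tuple e1) i) | inr i =>
      plo (tnth (in_tuple e2) i) end)
    (fun k => match fintype.split k with inl i => phi (tnth (in_tuple e1) i) | inr i =>
      phi (tnth (in_tuple e2) i) end)
    (fun k => match fintype.split k with
              | inl i => fun w => Complex (pcf (tnth (in_tuple e1) i) w) 0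
              | inr i => fun w => Complex 0 (pcf (tnth (in_tuple e2) i) w) end).

Lemma mix_sum (f : R -> R -> (T -> R[i]) -> R) : \sum_(k < pieces mix) f (lo k) (hi k) (coef k) =
  \sum_(p <- e1) f (plo p) (phi p) (fun w => Complex (pcf p w) 0) +
  \sum_(p <- e2) f (plo p) (phi p) (fun w => Complex 0 (pcf p w)).
Proof.
rewrite /= big_split_ord /=; congr (_ + _).
  rewrite [RHS]big_tnth; apply: eq_bigr => i _.
  by rewrite (_ : fintype.split _ = inl i) //; exact: (unsplitK (inl i)).
rewrite [RHS]big_tnth; apply: eq_bigr => i _.
by rewrite (_ : fintype.split _ = inr i) //; exact: (unsplitK (inr i)).
Qed.

Lemma adapted_tnth G (e : seq (@piece d T R)) (i : 'I_(size e)) : adapted_pieces G e ->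
  adapted_piece G (tnth (in_tuple e) i).
Proof.
have p0 : @piece d T R by exact: Piece 0 0 (fun=> 0).
rewrite (tnth_nth p0) /=; case: i => i /=.
by elim: e i => //= p e IH [|i] /= ie [okp_ se] //; exact: IH.
Qed.

Lemma mix_adapted G : is_filtration P G -> adapted_pieces G e1 -> adapted_pieces G e2 ->
  adapted_simple G mix.
Proof.
move=> FG s1 s2 k /=; case: (fintype.split k) => i.
  have [l0 lh mc [M HM]] := adapted_tnth i s1; split=> //.
    by split=> //=; apply: wrt_cst; exact: (filt_sigma FG).
  by exists M => w /=; rewrite expr0n addr0 sqrtr_sqr.
have [l0 lh mc [M HM]] := adapted_tnth i s2; split=> //.
  by split=> //=; apply: wrt_cst; exact: (filt_sigma FG).
by exists M => w /=; rewrite expr0n add0r sqrtr_sqr.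
Qed.

Lemma Re_mix_process t w : complex.Re (simple_process mix t w) = pieces_process e1 (t, w).
Proof.
rewrite /simple_process cRe_sum (mix_sum (fun l h c => complex.Re (if l < t <= h then c w else 0))).
rewrite [X in _ + X]big1 ?addr0; last by move=> p _; case: ifP.
by apply: eq_bigr => p _; rewrite /step /=; case: ifP.
Qed.

Lemma Im_mix_process t w : complex.Im (simple_process mix t w) = pieces_process e2 (t, w).
Proof.
rewrite /simple_process cIm_sum (mix_sum (fun l h c => complex.Im (if l < t <= h then c w else 0))).
rewrite [X in X + _]big1 ?add0r; last by move=> p _; case: ifP.
by apply: eq_bigr => p _; rewrite /step /=; case: ifP.
Qed.

Variables W1 W2 : R -> T -> R.
Let W t w : R[i] := Complex (W1 t w) (W2 t w).

Lemma Re_mix_integral t w : complex.Re (simple_integral mix W t w) =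
  simple_int W1 e1 t w - simple_int W2 e2 t w.
Proof.
rewrite /simple_integral cRe_sum.
rewrite (mix_sum (fun l h c => complex.Re (c w * (W (Num.min h t) w - W (Num.min l t) w)))) -sumrN.
by congr (_ + _); apply: eq_bigr => p _; rewrite cReM /=; ring.
Qed.

Lemma Im_mix_integral t w : complex.Im (simple_integral mix W t w) =
  simple_int W1 e2 t w + simple_int W2 e1 t w.
Proof.
rewrite /simple_integral cIm_sum.
rewrite (mix_sum (fun l h c => complex.Im (c w * (W (Num.min h t) w - W (Num.min l t) w)))) addrC.
by congr (_ + _); apply: eq_bigr => p _; rewrite cImM /=; ring.
Qed.

End mixture.

Section complex_ito.
Variable G : R -> set (set T).
Hypothesis FG : is_filtration P G.
Notation Pred := (predictable_sigma G).
Variables W1 W2 : R -> T -> R.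
Hypotheses (sW1 : forall e t, adapted_pieces G e -> 0 <= t -> L2P (simple_int W1 e t))
           (sW2 : forall e t, adapted_pieces G e -> 0 <= t -> L2P (simple_int W2 e t)).
Variable h : R -> T -> R[i].
Let h1 (x : R * T) := complex.Re (h x.1 x.2).
Let h2 (x : R * T) := complex.Im (h x.1 x.2).
Hypotheses (lh1 : L2 Q TD Pred h1) (lh2 : L2 Q TD Pred h2).
Variables M11 M12 M21 M22 : R -> T -> R.
Hypotheses (i11 : ito_process P G W1 h1 M11) (i12 : ito_process P G W1 h2 M12)
  (i21 : ito_process P G W2 h1 M21) (i22 : ito_process P G W2 h2 M22).
Let W t w : R[i] := Complex (W1 t w) (W2 t w).
Let N t w : R[i] := Complex (M11 t w - M22 t w) (M12 t w + M21 t w).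

Let lpr e : adapted_pieces G e -> L2 Q TD MQ (pieces_process e).
Proof. by move=> se; apply: (L2Q_meas FG); exact: (pieces_process_L2 FG). Qed.

Let mh1 : measurable_fun TD (h1 : measurableTypeR R * T -> R).
Proof. by apply/wrt_measurable_fun => //; case: (L2Q_meas FG lh1). Qed.

Let mh2 : measurable_fun TD (h2 : measurableTypeR R * T -> R).
Proof. by apply/wrt_measurable_fun => //; case: (L2Q_meas FG lh2). Qed.

Let mpr e : adapted_pieces G e -> measurable_fun TD (pieces_process e : measurableTypeR R * T -> R).
Proof. by move=> /lpr [m _]; apply/wrt_measurable_fun. Qed.

Let lsubQ f g : L2 Q TD MQ f -> L2 Q TD MQ g -> L2 Q TD MQ (fun x => f x - g x).
Proof. exact: (@L2_subr _ (measurableTypeR R * T)%type R Q TD mTD MQ (@sigma_algebra_M _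
  (measurableTypeR R * T)%type TD mTD) (fun _ x => x)). Qed.

Let lsubP f g : L2P f -> L2P g -> L2P (fun x => f x - g x).
Proof. exact: L2_subr. Qed.

Let laddP f g : L2P f -> L2P g -> L2P (fun x => f x + g x).
Proof. exact: L2_add. Qed.

(** Limits of the real and imaginary parts of complex simple integrals. *)
Let parts_cvg e1 e2 t : approximates P G e1 h1 -> approximates P G e2 h2 -> 0 <= t ->
  ipP (fun w => (M11 t w - M22 t w) - (simple_int W1 (e1 n) t w - simple_int W2 (e2 n) t w))
      (fun w => (M11 t w - M22 t w) - (simple_int W1 (e1 n) t w - simple_int W2 (e2 n) t w))
        @[n --> \oo] --> 0 /\
  ipP (fun w => (M12 t w + M21 t w) - (simple_int W1 (e2 n) t w + simple_int W2 (e1 n) t w))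
      (fun w => (M12 t w + M21 t w) - (simple_int W1 (e2 n) t w + simple_int W2 (e1 n) t w))
        @[n --> \oo] --> 0.
Proof.
move=> [s1 c1] [s2 c2] t0.
have [_ _ l11] := i11; have [_ _ l12] := i12; have [_ _ l21] := i21; have [_ _ l22] := i22.
split.
  have := nsq_lin_cvg measurableT (-1) (fun n => sW1 (s1 n) t0) (fun n => sW2 (s2 n) t0)
   (ito_L2 FG i11 t0) (ito_L2 FG i22 t0) (l11 _ s1 c1 t t0) (l22 _ s2 c2 t t0).
  apply: cvg_trans; apply: near_eq_cvg; near=> n.
  by apply: eq_ip => w _; rewrite !mulN1r.
have := nsq_lin_cvg measurableT 1 (fun n => sW1 (s2 n) t0) (fun n => sW2 (s1 n) t0)
   (ito_L2 FG i12 t0) (ito_L2 FG i21 t0) (l12 _ s2 c2 t t0) (l21 _ s1 c1 t t0).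
apply: cvg_trans; apply: near_eq_cvg; near=> n.
by apply: eq_ip => w _; rewrite !mul1r.
Unshelve. all: by end_near. Qed.

(** (h1 + i h2) d(W1 + i W2) expands into four real integrals. *)
Lemma complex_ito_exists : is_ito_integral P G W h N.
Proof.
have [e1 a1] := approximating_pieces FG lh1; have [e2 a2] := approximating_pieces FG lh2.
have [s1 c1] := a1; have [s2 c2] := a2.
have [l11 p11 _] := i11; have [l12 p12 _] := i12; have [l21 p21 _] := i21; have [l22 p22 _] := i22.
split.
- move=> t t0; have sG := filt_sigma FG t0; split=> /=.
    by apply: wrt_sub => //; [case: (l11 t t0)|case: (l22 t t0)].
  by apply: wrt_add => //; [case: (l12 t t0)|case: (l21 t t0)].
- have pp : {ae P, forall w, cpath (M11 ^~ w) /\ cpath (M22 ^~ w)} by apply: filterS2 p11 p22 =>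
  w; split.
  have qq : {ae P, forall w, cpath (M12 ^~ w) /\ cpath (M21 ^~ w)} by apply: filterS2 p12 p21 =>
    w; split.
  apply: filterS2 pp qq => w [q1 q2] [q3 q4]; split; apply/within_cpath => /=.
    rewrite (_ : (fun t => _) = fun t => 1 * M11 t w + (-1) * M22 t w); first exact: cpath_lin.
    by apply/funext => t; rewrite mul1r mulN1r.
  rewrite (_ : (fun t => _) = fun t => 1 * M12 t w + 1 * M21 t w); first exact: cpath_lin.
  by apply/funext => t; rewrite !mul1r.
- exists (fun n => mix (e1 n) (e2 n)); split.
  + by move=> n; exact: mix_adapted.
  + have E n : (\int[P]_w \int[lebesgue_measure]_(t in `[0%R, +oo[)
        (Normc.normc (h t w - simple_process (mix (e1 n) (e2 n)) t w) ^+ 2)%:E =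
        sqint Q TD (fun x => (h1 x - pieces_process (e1 n) x)%R) + sqint Q TD (fun x =>
          (h2 x - pieces_process (e2 n) x)%R))%E.
      rewrite (iterated_normc_sq (g := fun t w => h t w - simple_process (mix (e1 n) (e2 n)) t w)).
      * congr (_ + _)%E; congr sqint; apply/funext => -[t w].
          by rewrite cReB Re_mix_process.
        by rewrite cImB Im_mix_process.
      * rewrite (_ : (fun x => _) = fun x => h1 x - pieces_process (e1 n) x);
        first by apply: measurable_funB => //; exact: mpr.
        by apply/funext => -[t w]; rewrite cReB Re_mix_process.
      * rewrite (_ : (fun x => _) = fun x => h2 x - pieces_process (e2 n) x);
        first by apply: measurable_funB => //; exact: mpr.
        by apply/funext => -[t w]; rewrite cImB Im_mix_process.
    under eq_fun do rewrite E.
    apply: (@sqint_cvg _ (measurableTypeR R * T)%type R Q TD mTD (fun n x =>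
      h1 x - pieces_process (e1 n) x) (fun n x => h2 x - pieces_process (e2 n) x)) => //.
      by move=> n; apply: lsubQ; [exact: L2Q_meas lh1|exact: lpr].
    by move=> n; apply: lsubQ; [exact: L2Q_meas lh2|exact: lpr].
  + move=> t t0; have [cR cI] := parts_cvg a1 a2 t0.
    have lR n : L2P (fun w => (M11 t w - M22 t w) - (simple_int W1 (e1 n) t w - simple_int W2 (e2
      n) t w)).
      by apply: lsubP; apply: lsubP; [exact: ito_L2 i11 t0|exact: ito_L2 i22 t0|exact: sW1|exact:
        sW2].
    have lI n : L2P (fun w => (M12 t w + M21 t w) - (simple_int W1 (e2 n) t w + simple_int W2 (e1
      n) t w)).
      by apply: lsubP; apply: laddP; [exact: ito_L2 i12 t0|exact: ito_L2 i21 t0|exact: sW1|exact: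
        sW2].
    have := sqint_cvg measurableT lR lI cR cI; apply: cvg_trans; apply: near_eq_cvg; near=> n.
    rewrite integral_normc_sq //.
    * congr (_ + _)%E; congr sqint; apply/funext => w.
        by rewrite cReB Re_mix_integral.
      by rewrite cImB Im_mix_integral.
    * have [/wrt_measurable_fun m _] := lR n.
      rewrite (_ : (fun x => _) = (fun w => (M11 t w - M22 t w) - (simple_int W1 (e1 n) t w -
        simple_int W2 (e2 n) t w))); first exact: m.
      by apply/funext => w; rewrite cReB Re_mix_integral.
    * have [/wrt_measurable_fun m _] := lI n.
      rewrite (_ : (fun x => _) = (fun w => (M12 t w + M21 t w) - (simple_int W1 (e2 n) t w +
        simple_int W2 (e1 n) t w))); first exact: m.
      by apply/funext => w; rewrite cImB Im_mix_integral.
Unshelve. all: by end_near. Qed.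

(** The real and imaginary parts of a complex approximating sequence
    approximate h1 and h2, so they determine the four real limits. *)
Lemma complex_ito_unique M t : is_ito_integral P G W h M -> 0 <= t ->
  {ae P, forall w, M t w = N t w}.
Proof.
move=> [aM _ [e [ae ce cM]]] t0.
have sr n := adapted_re (ae n); have si n := adapted_im (ae n).
have E n : (\int[P]_w \int[lebesgue_measure]_(t in `[0%R, +oo[)
        (Normc.normc (h t w - simple_process (e n) t w) ^+ 2)%:E =
        sqint Q TD (fun x => (h1 x - pieces_process (re_pieces (e n)) x)%R) + sqint Q TD (fun x =>
          (h2 x - pieces_process (im_pieces (e n)) x)%R))%E.
  rewrite (iterated_normc_sq (g := fun t w => h t w - simple_process (e n) t w)).
  - congr (_ + _)%E; congr sqint; apply/funext => -[u w].
      by rewrite cReB Re_simple_process.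
    by rewrite cImB Im_simple_process.
  - rewrite (_ : (fun x => _) = fun x => h1 x - pieces_process (re_pieces (e n)) x);
    first by apply: measurable_funB => //; exact: mpr.
    by apply/funext => -[u w]; rewrite cReB Re_simple_process.
  - rewrite (_ : (fun x => _) = fun x => h2 x - pieces_process (im_pieces (e n)) x);
    first by apply: measurable_funB => //; exact: mpr.
    by apply/funext => -[u w]; rewrite cImB Im_simple_process.
have {}ce : (fun n => sqint Q TD (fun x => (h1 x - pieces_process (re_pieces (e n)) x)%R) + sqint
  Q TD (fun x => (h2 x - pieces_process (im_pieces (e n)) x)%R))%E @ \oo --> (0 : \bar R)%E.
  by apply: cvg_trans ce; apply: near_eq_cvg; near=> n; rewrite E.
have a1 : approximates P G (fun n => re_pieces (e n)) h1.
  split=> //; apply: (@sqint_cvg0 _ (measurableTypeR R * T)%type R Q TD mTD (fun n =>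
    pieces_process (re_pieces (e n))) h1 _ mh1 _).2.
    by move=> n; exact: lpr.
  by apply: sum_cvg0l ce => n; exact: sqint_ge0.
have a2 : approximates P G (fun n => im_pieces (e n)) h2.
  split=> //; apply: (@sqint_cvg0 _ (measurableTypeR R * T)%type R Q TD mTD (fun n =>
    pieces_process (im_pieces (e n))) h2 _ mh2 _).2.
    by move=> n; exact: lpr.
  by apply: sum_cvg0r ce => n; exact: sqint_ge0.
have [cR cI] := parts_cvg a1 a2 t0.
have [mR mI] := aM t t0.
have mMR : measurable_fun setT (fun w => complex.Re (M t w)).
  by apply/wrt_measurable_fun => // B mB; apply: (filt_meas FG t0); exact: mR.
have mMI : measurable_fun setT (fun w => complex.Im (M t w)).
  by apply/wrt_measurable_fun => // B mB; apply: (filt_meas FG t0); exact: mI.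
pose kR n w := simple_int W1 (re_pieces (e n)) t w - simple_int W2 (im_pieces (e n)) t w.
pose kI n w := simple_int W1 (im_pieces (e n)) t w + simple_int W2 (re_pieces (e n)) t w.
have lR n : L2P (kR n) by apply: lsubP; [exact: sW1|exact: sW2].
have lI n : L2P (kI n) by apply: laddP; [exact: sW1|exact: sW2].
have EM n : (\int[P]_w (Normc.normc (M t w - simple_integral (e n) W t w) ^+ 2)%:E =
   sqint P setT (fun w => (complex.Re (M t w) - kR n w)%R) + sqint P setT (fun w =>
     (complex.Im (M t w) - kI n w)%R))%E.
  have m1 : measurable_fun setT (kR n) by apply/wrt_measurable_fun => //; case: (lR n).
  have m2 : measurable_fun setT (kI n) by apply/wrt_measurable_fun => //; case: (lI n).
  rewrite integral_normc_sq //.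
  - congr (_ + _)%E; congr sqint; apply/funext => w.
      by rewrite cReB Re_simple_integral.
    by rewrite cImB Im_simple_integral.
  - have -> : (fun w => complex.Re (M t w - simple_integral (e n) W t w)) = (fun w =>
    complex.Re (M t w) - kR n w).
      by apply/funext => w; rewrite cReB Re_simple_integral.
    exact: (measurable_funB mMR m1).
  - have -> : (fun w => complex.Im (M t w - simple_integral (e n) W t w)) = (fun w =>
    complex.Im (M t w) - kI n w).
      by apply/funext => w; rewrite cImB Im_simple_integral.
    by apply: measurable_funB.
have {}cM : (fun n => sqint P setT (fun w => (complex.Re (M t w) - kR n w)%R) + sqint P setT (fun
  w => (complex.Im (M t w) - kI n w)%R))%E @ \oo --> (0 : \bar R)%E.
  by apply: cvg_trans (cM t t0); apply: near_eq_cvg; near=> n; rewrite EM.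
have c1 := sum_cvg0l (fun n => sqint_ge0 _ _ _) (fun n => sqint_ge0 _ _ _) cM.
have c2 := sum_cvg0r (fun n => sqint_ge0 _ _ _) (fun n => sqint_ge0 _ _ _) cM.
have [lMR cMR] := sqint_cvg0 measurableT lR mMR c1.
have [lMI cMI] := sqint_cvg0 measurableT lI mMI c2.
have lNR : L2P (fun w => M11 t w - M22 t w) by apply: lsubP;
  [exact: ito_L2 i11 t0|exact: ito_L2 i22 t0].
have lNI : L2P (fun w => M12 t w + M21 t w) by apply: laddP;
  [exact: ito_L2 i12 t0|exact: ito_L2 i21 t0].
have h3 := L2_lim_unique measurableT lR lMR lNR cMR cR.
have h4 := L2_lim_unique measurableT lI lMI lNI cMI cI.
by apply: filterS2 h3 h4 => w e1 e2; apply: eq_complex_parts => /=; [exact: e1|exact: e2].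
Unshelve. all: by end_near. Qed.

End complex_ito.
End complex_integrands.

(** * Sampling at predictable times *)

Section dyadic_rounding.
Context {R : realType}.

Lemma dyadicS k n : dyadic k.+1 n = dyadic k n + 2 ^- n :> R.
Proof. by rewrite /dyadic -natr1 mulrDl mul1r. Qed.

(** The integer k is the ceiling of 2^n r. *)
Lemma dyadic_ceil (r : R) n : 0 <= r -> exists k,
  [/\ r <= dyadic k n, (if k is k'.+1 then dyadic k' n < r else True),
      dyadic k n <= r + 2 ^- n & (r <= n%:R)%R -> (k < n.+1 * 2 ^ n)%N].
Proof.
move=> r0; have p : 0 < 2 ^+ n :> R by rewrite exprn_gt0.
have ex : exists k, r <= dyadic k n.
  exists (Num.truncn (r * 2 ^+ n)).+1.
  by rewrite /dyadic ler_pdivlMr // ltW // truncnS_gt.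
case: (ex_minnP ex) => k rk kmin; exists k; split=> //.
- case: k kmin {rk} => // k kmin; rewrite ltNge; apply/negP => /kmin.
  by rewrite ltnn.
- case: k kmin {rk} => [_|k kmin].
    by rewrite /dyadic mul0r addr_ge0 // invr_ge0 ltW.
  rewrite dyadicS lerD2r leNgt; apply/negP => /ltW /kmin.
  by rewrite ltnn.
- move=> rn; have /kmin : r <= dyadic (n * 2 ^ n) n.
    by rewrite /dyadic natrM natrX mulfK // gt_eqF.
  by move=> /leq_ltn_trans; apply; rewrite ltn_pmul2r // expn_gt0.
Qed.

Lemma inv2X_cvg : 2 ^- n @[n --> \oo] --> (0 : R).
Proof. by have := @cvg_inv2X R 1; under eq_fun do rewrite mul1r. Qed.

Lemma cpath_delta (f : R -> R) r e : cpath f -> 0 <= r -> 0 < e ->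
  exists2 del, 0 < del & forall s, 0 <= s -> `|s - r| < del -> `|f r - f s| < e.
Proof.
move=> cf r0 e0; have /cvgrPdist_lt/(_ _ e0) := cf r.
move=> /nbhs_ballP[del /= del0 H]; exists del => // s s0 sr.
by have := H s; rewrite /ball /= distrC => /(_ sr); rewrite !max_r.
Qed.

End dyadic_rounding.

Section square_integrable_martingales.
Context {d : measure_display} {T : measurableType d} {R : realType}.
Variable P : probability T R.
Variable F : R -> set (set T).
Hypothesis FF : is_filtration P F.
Notation L2P := (L2 P setT measurable).
Notation ipP := (ip P setT).

Definition H2martingale (D : R -> T -> R) : Prop :=
  [/\ L2_martingale P F D, (exists C, forall t, 0 <= t -> ipP (D t) (D t) <= C) &
      {ae P, forall w, cpath (D ^~ w)}].

Let lD D t : L2_martingale P F D -> 0 <= t -> L2P (D t).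
Proof. by move=> [h _] t0; exact: (L2G_meas FF t0 (h t t0)). Qed.

Let lsub f g : L2P f -> L2P g -> L2P (fun w => f w - g w).
Proof. by apply: L2_subr => //; exact: sigma_algebra_M. Qed.

Lemma H2martingale_lin D E a : H2martingale D -> H2martingale E ->
  H2martingale (fun t w => D t w + a * E t w).
Proof.
move=> [mD [C HC] cD] [mE [C' HC'] cE]; split.
- split=> [t t0|s t xi s0 st lx].
    by apply: L2_lin => //; [exact: (filt_sigma FF)|exact: (filt_meas FF)|case: mD => + _;
      exact|case: mE => + _; exact].
  have t0 := le_trans s0 st.
  rewrite (@eq_ip _ _ _ P setT _ (fun w => (D t w - D s w) + a * (E t w - E s w)) _ xi) //;
    last by move=> w _; ring.
  have lx' := L2G_meas FF s0 lx.
  rewrite ip_lin //; try by apply: lsub; exact: lD.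
  have [_ ->] := mD => //; have [_ ->] := mE => //.
  by rewrite mulr0 addr0.
- exists (2 * C + 2 * (a ^+ 2 * C')) => t t0.
  have l1 := lD mD t0; have l2 := lD mE t0.
  have l3 : L2P (fun w => a * E t w) by apply: L2_scale => //; exact: sigma_algebra_M.
  apply: le_trans (nsq_add_le measurableT l1 l3) _.
  have -> : ipP (fun w => a * E t w) (fun w => a * E t w) = a ^+ 2 * ipP (E t) (E t).
    by rewrite (ip_scale measurableT a l2 l3) ipC (ip_scale measurableT a l2 l2) mulrA -expr2.
  by rewrite lerD // ler_pM2l // ?HC // ler_wpM2l ?sqr_ge0 ?HC'.
- apply: filterS2 cD cE => w c1 c2.
  rewrite (_ : (fun t => _) = fun t => 1 * D t w + a * E t w); first exact: cpath_lin.
  by apply/funext => t; rewrite mul1r.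
Qed.

Lemma H2martingale0 : H2martingale (fun _ _ => 0).
Proof.
split.
- split=> [t t0|s t xi s0 st lx]; first by apply: L2_0; exact: (filt_sigma FF).
  by rewrite -[RHS](ip0l P setT xi); apply: eq_ip => // w _; rewrite subrr.
- by exists 0 => t t0; rewrite ip0l.
- by apply: aeW => w; exact: cpath0.
Qed.

Lemma H2martingale_sum {I : Type} (r : seq I) (D : I -> R -> T -> R) :
  (forall i, H2martingale (D i)) -> H2martingale (fun t w => \sum_(i <- r) D i t w).
Proof.
move=> HD; elim: r => [|i r IH].
  rewrite (_ : (fun _ _ => _) = (fun _ _ => 0)); first exact: H2martingale0.
  by apply/funext => t; apply/funext => w; rewrite big_nil.
rewrite (_ : (fun _ _ => _) = (fun t w => D i t w + 1 * \sum_(i <- r) D i t w)).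
  exact: H2martingale_lin.
by apply/funext => t; apply/funext => w; rewrite big_cons mul1r.
Qed.

(** Being an L2-martingale depends only on the class of each variable; path
    continuity has to be assumed anew. *)
Lemma H2martingale_modification D D' : H2martingale D ->
  (forall t, 0 <= t -> measurable_wrt setT (F t) (D' t)) ->
  (forall t, 0 <= t -> {ae P, forall w, D' t w = D t w}) ->
  {ae P, forall w, cpath (D' ^~ w)} -> H2martingale D'.
Proof.
move=> [mD [C HC] cD] mD' eD cD'.
have mm t : 0 <= t -> measurable_fun setT (D t).
  by move=> t0; apply/wrt_measurable_fun => //; case: (lD mD t0).
have mm' t : 0 <= t -> measurable_fun setT (D' t).
  by move=> t0; apply/wrt_measurable_fun => // B mB; apply: (filt_meas FF t0); exact: mD'.
have e' t : 0 <= t -> {ae P, forall w, setT w -> D' t w = D t w}.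
  by move=> t0; apply: filterS (eD t t0) => w.
have nE t : 0 <= t -> ipP (D' t) (D' t) = ipP (D t) (D t).
  move=> t0; have m1 := mm _ t0; have m2 := mm' _ t0.
  by rewrite (ip_ae measurableT m2 m1 m2 (e' t t0)) ipC (ip_ae measurableT m2 m1 m1 (e' t t0)).
have lD' t : 0 <= t -> L2 P setT (F t) (D' t).
  move=> t0; split; first exact: mD'.
  have [_] := lD mD t0; rewrite /sqint => h.
  rewrite (ae_eq_integral (fun w => (D t w ^+ 2)%:E)) //.
  - by apply/measurable_EFinP; apply: measurable_funX; exact: mm'.
  - by apply/measurable_EFinP; apply: measurable_funX; exact: mm.
  - by apply: filterS (eD t t0) => w -> _.
split=> //; last by exists C => t t0; rewrite nE // HC.
split=> // s t xi s0 st lx; have t0 := le_trans s0 st.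
have [_ h] := mD; rewrite -(h s t xi s0 st lx).
have lx' := L2G_meas FF s0 lx.
apply: ip_ae => //.
- by apply: measurable_funB; exact: mm'.
- by apply: measurable_funB; exact: mm.
- by apply/wrt_measurable_fun => //; case: lx'.
- by apply: filterS2 (eD t t0) (eD s s0) => w -> ->.
Qed.

Lemma ito_H2martingale W (BW : is_BM P F W) h M :
  L2 ((@lebesgue_measure R) \x P)%E (@time_domain d T R) (predictable_sigma F) h ->
  ito_process P F W h M -> H2martingale M.
Proof.
move=> lh hM; split; [exact: ito_martingale lh hM| |by case: hM].
by exists (ip ((@lebesgue_measure R) \x P)%E (@time_domain d T R) h h) => t t0;
  exact: ito_norm lh hM t0.
Qed.

End square_integrable_martingales.

Section predictable_times.
Context {d : measure_display} {T : measurableType d} {R : realType}.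
Variable P : probability T R.
Hypothesis Pcomplete : measure_is_complete P.
Notation TD := (@time_domain d T R).
Notation ipP := (ip P setT).

Definition real_at (L : R -> T -> R) (tau : T -> \bar R) (w : T) : R :=
  if tau w is r%:E then L r w else 0.

Variable FX : R -> set (set T).
Hypothesis FFX : is_filtration P FX.
Variable tau : T -> \bar R.
Hypothesis stau : stopping_time FX tau.

(** The strict past is generated by events of the filtration at deterministic
    times. *)
Lemma strict_past_sub S : sigma_algebra setT S -> (forall t, 0 <= t -> FX t `<=` S) ->
  strict_past FX tau `<=` S.
Proof.
move=> sS FS; have [tau0 tauF] := stau.
apply: smallest_sub => // A [FA|[t [B [t0 FB ->]]]]; first exact: (FS 0).
rewrite (_ : [set w | _] = ~` [set w | (tau w <= t%:E)%E]); last first.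
  by apply/seteqP; split=> w /=; rewrite ltNge => /negP.
apply: (FS _ t0); apply: (filt_I FFX) => //; apply: (filt_C FFX) => //; exact: tauF.
Qed.

Notation SP := (strict_past FX tau).
Let sSP : sigma_algebra setT SP. Proof. exact: smallest_sigma_algebra. Qed.

Let SPC A : SP A -> SP (~` A).
Proof. by move=> SA; rewrite -setTD; have [_ + _] := sSP; exact. Qed.

Let SPI A B : SP A -> SP B -> SP (A `&` B).
Proof. move=> SA SB; exact: (sigma_setI sSP).
Qed.

Let SPU A B : SP A -> SP B -> SP (A `|` B).
Proof.
by move=> SA SB; rewrite -(setCK (A `|` B)) setCU; apply: SPC; apply: SPI; exact: SPC.
Qed.

Let SPgt t A : 0 <= t -> FX t A -> SP (A `&` [set w | (t%:E < tau w)%E]).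
Proof. by move=> t0 FA; apply: sub_sigma_algebra; right; exists t, A. Qed.

Let SPgtT t : 0 <= t -> SP [set w | (t%:E < tau w)%E].
Proof. by move=> t0; have := SPgt t0 (filt_T FFX t0); rewrite setTI. Qed.

(** The trace on the graph of tau. *)
Let at_tau (C : set (R * T)) : set T := [set w | exists2 r, tau w = r%:E & C (r, w)].

Let SPoo : SP (at_tau TD).
Proof.
have [tau0 _] := stau.
rewrite (_ : at_tau _ = \bigcup_n ~` [set w | ((n%:R : R)%:E < tau w)%E]).
  by have [_ _ SU] := sSP; apply: SU => n; apply: SPC; exact: SPgtT.
apply/seteqP; split=> w.
  move=> [r tr r0]; exists (Num.truncn r).+1 => //=; rewrite tr lte_fin.
  by apply/negP; rewrite -leNgt ltW // truncnS_gt.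
move=> [n _ /= /negP]; rewrite -leNgt; have := tau0 w; case E : (tau w) => [r| |] //=.
by move=> r0 _; exists r.
Qed.

(** On a rectangle ]s, t] x A the trace is the event A and {s < tau} minus
    {t < tau}, and these generate the strict past. *)
Lemma at_tau_predictable C : predictable_sigma FX C -> SP (at_tau C).
Proof.
have [tau0 _] := stau; have [S0 SD SU] := sSP.
apply: (@smallest_sub _ _ _ [set C | SP (at_tau C)]).
  split=> /=.
  - by rewrite (_ : at_tau _ = set0) // -subset0 => w [].
  - move=> A SA; rewrite (_ : at_tau _ = at_tau TD `&` ~` at_tau A); first by apply: SPI => //;
    exact: SPC.
    apply/seteqP; split=> w.
      by move=> [r tr [Dr nA]]; split; [exists r|move=> [r']; rewrite tr => -[<-]].
    by move=> [[r tr Dr] nA]; exists r => //; split=> // Ar; apply: nA; exists r.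
  - move=> A SA; rewrite (_ : at_tau _ = \bigcup_k at_tau (A k)); first exact: SU.
    apply/seteqP; split=> w; first by move=> [r tr [k _ Ak]]; exists k => //; exists r.
    by move=> [k _ [r tr Ak]]; exists r => //; exists k.
move=> _ [[A FA <-]|[s [t [A [s0 st FA ->]]]]] /=.
  rewrite (_ : at_tau _ = A `&` ~` [set w | ((0 : R)%:E < tau w)%E]).
    by apply: SPI; [apply: sub_sigma_algebra; left|apply: SPC; exact: SPgtT].
  apply/seteqP; split=> w; first by move=> [r tr [/= r0 Aw]]; split=> //=; rewrite tr r0 ltxx.
  move=> [Aw /= /negP]; rewrite -leNgt => t0; exists 0 => //.
  by apply/eqP; rewrite eq_le t0 tau0.
rewrite (_ : at_tau _ = (A `&` [set w | (s%:E < tau w)%E]) `&` ~` [set w | (t%:E < tau w)%E]).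
  by apply: SPI; [exact: SPgt|apply: SPC; apply: SPgtT; exact: le_trans st].
apply/seteqP; split=> w.
  move=> [r tr [/=]]; rewrite in_itv /= => /andP[sr rt] Aw; split; first by split=> //=;
    rewrite tr lte_fin.
  by rewrite /= tr lte_fin; apply/negP; rewrite -leNgt.
move=> [[Aw /=] + /negP]; rewrite -leNgt; case E : (tau w) => [r| |] //=.
by rewrite lte_fin lee_fin => sr rt; exists r => //; split=> //=; rewrite in_itv /= sr.
Qed.

Lemma real_at_strict_past (L : R -> T -> R) :
  measurable_wrt TD (predictable_sigma FX) (fun x => L x.1 x.2) ->
  measurable_wrt setT SP (real_at L tau).
Proof.
move=> mL B mB; have [tau0 _] := stau; rewrite setTI.
have SB := at_tau_predictable (mL B mB).
pose E := if pselect (B 0) then ~` at_tau TD else set0.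
rewrite (_ : _ @^-1` _ = at_tau (TD `&` (fun x => L x.1 x.2) @^-1` B) `|` E).
  apply: SPU => //; rewrite /E; case: (pselect (B 0)) => b0; first exact: SPC.
  by have [] := sSP.
apply/seteqP; split=> w /=; rewrite /real_at /E.
  have := tau0 w; case tr : (tau w) => [r| |] //= r0 Bw.
    by left; exists r => //; split.
  by right; case: pselect => // _ [r]; rewrite tr.
move=> [[r -> [/= _ Bw]] //|].
case: pselect => // B0 nt; have := tau0 w.
case tr : (tau w) => [r| |] //= r0; exfalso; apply: nt; exists r => //.
Qed.

Section optional_sampling.
Variable F : R -> set (set T).
Hypothesis FF : is_filtration P F.
Variable D : R -> T -> R.
Hypothesis HD : H2martingale P F D.
Variable S : set (set T).
Hypotheses (sS : sigma_algebra setT S) (SM : S `<=` measurable) (FXS : forall t, 0 <= t ->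
  FX t `<=` S).

(** The time tau is rounded up to the grid of mesh 2^-n; keeping the grid points
    below n + 1 only makes the sampled value a finite sum. *)
Let A n k : set T := [set w | (tau w <= (dyadic k n : R)%:E)%E] `\`
  (if k is k'.+1 then [set w | (tau w <= (dyadic k' n : R)%:E)%E] else set0).
Let N n := (n.+1 * 2 ^ n)%N.
Let Dn n w : R := \sum_(k < N n) \1_(A n k) w * D (dyadic k n) w.

Let SA n k : S (A n k).
Proof.
have [tau0 tauF] := stau.
have h j : S [set w | (tau w <= (dyadic j n : R)%:E)%E].
  by apply: (FXS (dyadic_ge0 j n)); apply: tauF; exact: dyadic_ge0.
have [S0 SC SU] := sS.
have hC B : S B -> S (~` B) by move=> SB; rewrite -setTD; exact: SC.
have hI B C : S B -> S C -> S (B `&` C).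
  exact: (sigma_setI sS).
by rewrite /A setDE; apply: hI => //; apply: hC; case: (k).
Qed.

Let A_disj n k k' w : A n k w -> A n k' w -> k = k'.
Proof.
wlog kk : k k' / (k < k')%N.
  move=> H Ak Ak'; case: (ltngtP k k') => // h; first exact: (H k k').
  by apply/esym; exact: (H k' k).
move=> [/= tk _] [_]; case: k' kk => // k' kk nk; exfalso; apply: nk => /=.
apply: le_trans tk _; rewrite lee_fin /dyadic ler_pM2r ?invr_gt0 ?exprn_gt0 //.
by rewrite ler_nat.
Qed.

Let Dn_at n k w : A n k w -> (k < N n)%N -> Dn n w = D (dyadic k n) w.
Proof.
move=> Ak kN; rewrite /Dn (bigD1 (Ordinal kN)) //= indicE mem_set // mul1r big1 ?addr0 // => j jk.
rewrite indicE memNset ?mul0r // => Aj; move/eqP: jk; apply; apply: val_inj => /=.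
exact: A_disj Aj Ak.
Qed.

Let Dn_cases n w : Dn n w = 0 \/ exists k, Dn n w = D (dyadic k n) w.
Proof.
have [[k [kN Ak]]|nA] := pselect (exists k, (k < N n)%N /\ A n k w).
  by right; exists k; exact: Dn_at.
left; rewrite /Dn big1 // => j _; rewrite indicE memNset ?mul0r // => Aj.
by apply: nA; exists j.
Qed.

Let Dn_cvg w : cpath (D ^~ w) -> Dn n w @[n --> \oo] --> real_at D tau w.
Proof.
move=> cD; have [tau0 _] := stau; have := tau0 w.
rewrite /real_at; case tr : (tau w) => [r| |] //= r0; last first.
  have -> : Dn ^~ w = fun=> 0; last exact: cvg_cst.
  apply/funext => n; rewrite /Dn big1 // => j _; rewrite indicE memNset ?mul0r //.
  by move=> [/=]; rewrite tr.
apply/cvgrPdist_lt => e e0.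
have [del del0 Hd] := cpath_delta cD r0 e0.
have /cvgrPdist_lt/(_ _ del0) c2 := @inv2X_cvg R.
near=> n.
have rn : r <= n%:R.
  by near: n; exists (Num.truncn r).+1 => // n /= h; rewrite (le_trans (ltW (truncnS_gt r))) //
    ler_nat.
have n2 : 2 ^- n < del.
  have : `|0 - 2 ^- n| < del by near: n; exact: c2.
  by rewrite sub0r normrN ger0_norm // invr_ge0 exprn_ge0.
have [k [rk kr k2 kN]] := dyadic_ceil n r0.
have Ak : A n k w.
  split; first by rewrite /= tr lee_fin.
  case: k kr {rk k2 kN} => [_ []|k kr /=].
  by rewrite tr lee_fin leNgt kr.
rewrite (Dn_at Ak (kN rn)); apply: Hd; first exact: dyadic_ge0.
by rewrite ger0_norm ?subr_ge0 //; lra.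
Unshelve. all: by end_near. Qed.

Let lD t : 0 <= t -> L2 P setT measurable (D t).
Proof. by move=> t0; have [[h _] _ _] := HD; exact: (L2G_meas FF t0 (h t t0)). Qed.

Let mD t : 0 <= t -> measurable_fun setT (D t).
Proof. by move=> t0; apply/wrt_measurable_fun => //; case: (lD t0). Qed.

Let mDn n : measurable_fun setT (Dn n).
Proof.
apply: measurable_sum => k; apply: measurable_funM; last by apply: mD; exact: dyadic_ge0.
by apply: measurable_indic; apply: SM; exact: SA.
Qed.

Let real_at_measurable : measurable_fun setT (EFin \o real_at D tau).
Proof.
have [_ _ cD] := HD.
have mw n : measurable_wrt setT measurable (Dn n) by apply/wrt_measurable_fun.
have [g [mg Hg]] := wrt_ae_lim (sigma_algebra_M measurableT) mw.
apply: (ae_measurable_fun Pcomplete (f := EFin \o g)).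
  apply: filterS cD => w cw _ /=; congr EFin.
  have c := Dn_cvg cw; have c' := Hg w Logic.I (cvgP _ c).
  by rewrite -(cvg_lim _ c) // -(cvg_lim _ c').
by apply/measurable_EFinP; apply/wrt_measurable_fun.
Qed.

(** The values of D at dyadic times have an integrable supremum, by Doob's
    inequality, so D may be sampled along the dyadic roundings of tau. *)
Lemma sampling_dominated B : measurable B ->
  P.-integrable setT (EFin \o (fun w => real_at D tau w * \1_B w)) /\
  (\int[P]_w (Dn n w * \1_B w)%:E)%E @[n --> \oo] --> (\int[P]_w (real_at D tau w * \1_B w)%:E)%E.
Proof.
move=> mB; have [mart [C HC] cD] := HD.
have [Z [mZ Z0 IZ HZ]] := doob_sup FF mart HC.
have mB1 : measurable_fun setT (\1_B : T -> R) by exact: measurable_indic.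
have h := @dominated_convergence _ T R P setT measurableT
  (fun n w => (Dn n w * \1_B w)%:E) (fun w => (real_at D tau w * \1_B w)%:E) (fun w => (1 + Z w)%E).
have [] := h.
- by move=> n; apply/measurable_EFinP; apply: measurable_funM.
- by apply/measurable_EFinP; apply: measurable_funM => //; exact/measurable_EFinP.
- apply: filterS cD => w cw _; apply: cvg_EFin; first by near=> n.
  by apply: cvgM; [exact: Dn_cvg|exact: cvg_cst].
- apply: integrableD => //.
    by apply: finite_measure_integrable_cst.
  apply/integrableP; split=> //.
  under eq_integral do rewrite gee0_abs //.
  exact: le_lt_trans IZ (ltry _).
- apply: aeW => w n _; rewrite /= normrM.
  have b1 : `|\1_B w| <= 1 :> R by rewrite indicE; case: (_ \in _); rewrite ?normr1 ?normr0.
  apply: (@le_trans _ _ (1 + Dn n w ^+ 2)%:E).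
    rewrite lee_fin; apply: (@le_trans _ _ `|Dn n w|); first by rewrite ler_piMr.
    rewrite -(real_normK (num_real (Dn n w))); have := sqr_ge0 (`|Dn n w| - 1); nra.
  rewrite EFinD leeD2l //; have [->|[k ->]] := Dn_cases n w; last exact: HZ.
  by rewrite expr0n /=; exact: Z0.
- by move=> i _ c; split.
Unshelve. all: by end_near. Qed.

Lemma real_at_integrable : P.-integrable setT (EFin \o real_at D tau).
Proof.
have [i _] := sampling_dominated measurableT.
by apply: eq_integrable i => // w _ /=; rewrite indicE in_setT mulr1.
Qed.

(** On each level set of the rounded time, D is evaluated at a deterministic
    time. *)
Lemma optional_sampling_zero : (forall t B, 0 <= t -> S B -> ipP (D t) (\1_B) = 0) ->
  forall B, S B -> (\int[P]_(w in B) (real_at D tau w)%:E = 0)%E.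
Proof.
move=> D0 B SB; have mB := SM SB; have [i c] := sampling_dominated mB.
have E : (\int[P]_(w in B) (real_at D tau w)%:E = \int[P]_w (real_at D tau w * \1_B w)%:E)%E.
  rewrite integral_mkcond; apply: eq_integral => w _; rewrite patchE indicE.
  by case: (w \in B); rewrite ?mulr1 ?mulr0.
rewrite E -(cvg_lim _ c) //; apply: cvg_lim => //.
rewrite (_ : (fun n => _) = fun=> 0%E); first exact: cvg_cst.
apply/funext => n.
have SAB k : S (A n k `&` B).
  exact: (sigma_setI sS).
have l1 k : L2 P setT measurable (\1_(A n k `&` B) : T -> R).
  by apply: indic_L2 => //; [exact: sigma_algebra_M|apply: SM].
have ii k := integrable_mul measurableT (lD (dyadic_ge0 k n)) (l1 k).
rewrite (_ : (fun w => (Dn n w * \1_B w)%:E) = fun w => (\sum_(k < N n) (D (dyadic k n) w * \1_(A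
  n k `&` B) w)%:E)%E); last first.
  apply/funext => w; rewrite sumEFin; congr EFin; rewrite /Dn mulr_suml; apply: eq_bigr => k _.
  by rewrite !indicE in_setI; case: (w \in A n k); case: (w \in B); rewrite /=; ring.
rewrite integral_sum //; last by move=> k; exact: ii.
rewrite big1 // => k _; apply: (EFin_Rint0 measurableT (ii k)).
exact: D0 (dyadic_ge0 k n) (SAB k).
Qed.

End optional_sampling.
End predictable_times.

Section continuous_adapted.
Context {d : measure_display} {T : measurableType d} {R : realType}.
Variable P : probability T R.
Variable FX : R -> set (set T).
Hypothesis FFX : is_filtration P FX.
Notation TD := (@time_domain d T R).
Notation Pred := (predictable_sigma FX).

Lemma initial_predictable (c : T -> R) : measurable_wrt setT (FX 0) c ->
  measurable_wrt TD Pred (fun x => if x.1 == 0 then c x.2 else 0).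
Proof.
move=> mc B mB.
have GB : FX 0 (c @^-1` B) by rewrite -[_ @^-1` _]setTI; exact: mc.
have RB := rect0_pred GB; have RT := rect0_pred (filt_T FFX (lexx 0)).
case: (pselect (B 0)) => B0.
  rewrite (_ : _ `&` _ = ([set 0] `*` (c @^-1` B)) `|` (TD `\` ([set 0] `*` setT))).
    by apply: pred_U => //; apply: pred_D => //; exact: pred_T.
  apply/seteqP; split=> [[u w] [Du /= h]|[u w] h].
    by move: h; case: eqP => [-> h|nu _]; [left|right; split=> // -[]].
  have Du : TD (u, w) by case: h => [[/= -> _]|[]//]; exact: lexx.
  split=> //=; case: h => [[/= -> cB]|[_ nh]]; first by rewrite eqxx.
  by case: eqP => // u0; case: nh; split.
rewrite (_ : _ `&` _ = ([set 0] `*` (c @^-1` B))) //.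
apply/seteqP; split=> [[u w] [Du /= h]|[u w] [/= -> h]].
  by move: h; case: eqP => [-> h|].
by split=> /=; [exact: lexx|rewrite eqxx].
Qed.

(** A continuous adapted process is the limit of its left-endpoint
    discretisations, which are combinations of steps. *)
Lemma continuous_adapted_predictable (L : R -> T -> R) :
  (forall t, 0 <= t -> measurable_wrt setT (FX t) (L t)) -> (forall w, cpath (L ^~ w)) ->
  measurable_wrt TD Pred (fun x => L x.1 x.2).
Proof.
move=> mL cL; have sPr := @pred_sigma_algebra d T R FX.
pose f n (x : R * T) := (if x.1 == 0 then L 0 x.2 else 0) +
  \sum_(k <- iota 0 (n.+1 * 2 ^ n)) step (dyadic k n) (dyadic k.+1 n) (L (dyadic k n)) x.
apply: (wrt_lim sPr (f := f)).
  move=> n; apply: wrt_add => //; first by apply: initial_predictable; exact: mL.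
  apply: wrt_sum => // k; apply: (step_pred FFX); first exact: dyadic_ge0.
    by rewrite dyadicS lerDl invr_ge0 exprn_ge0.
  by apply: mL; exact: dyadic_ge0.
move=> [t w] t0; rewrite /time_domain /= in t0.
have [->|tn0] := eqVneq t 0.
  rewrite (_ : f ^~ _ = fun=> L 0 w); first exact: cvg_cst.
  apply/funext => n; rewrite /f /= eqxx big1_seq ?addr0 // => k _.
  by rewrite /step /= ltNge dyadic_ge0.
apply/cvgrPdist_lt => e e0.
have [del del0 Hd] := cpath_delta (cL w) t0 e0.
have /cvgrPdist_lt/(_ _ del0) c2 := @inv2X_cvg R.
near=> n.
have rn : t <= n%:R.
  by near: n; exists (Num.truncn t).+1 => // n /= h; rewrite (le_trans (ltW (truncnS_gt t))) //
    ler_nat.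
have n2 : 2 ^- n < del.
  have : `|0 - 2 ^- n| < del by near: n; exact: c2.
  by rewrite sub0r normrN ger0_norm // invr_ge0 exprn_ge0.
have [k [rk kr k2 kN]] := dyadic_ceil n t0.
case: k rk kr k2 kN => [|k] rk kr k2 kN.
  by move: rk; rewrite /dyadic mul0r => t0'; move: tn0; rewrite eq_le t0 t0'.
have -> : f n (t, w) = L (dyadic k n) w.
  rewrite /f /= (negbTE tn0) add0r.
  have kin : k \in iota 0 (n.+1 * 2 ^ n) by rewrite mem_iota add0n /= (leq_trans _ (kN rn)).
  rewrite (bigD1_seq k) ?iota_uniq //= /step /= kr rk big1 ?addr0 // => j jk.
  case: ifP => // /andP[h1 h2]; exfalso; move/eqP: jk; apply; apply/eqP;
    rewrite eqn_leq -[(j <= k)%N]ltnS -[(k <= j)%N]ltnS.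
  have p : 0 < (2 ^+ n)^-1 :> R by rewrite invr_gt0 exprn_gt0.
  have a1 := lt_le_trans h1 rk; have a2 := lt_le_trans kr h2.
  by move: a1 a2; rewrite /dyadic !ltr_pM2r // !ltr_nat => -> ->.
apply: Hd; first exact: dyadic_ge0.
have := rk; rewrite dyadicS => h.
rewrite distrC ger0_norm; last by rewrite subr_ge0 ltW.
by lra.
Unshelve. all: by end_near. Qed.

Lemma constant_predictable_time (t : R) : 0 <= t -> predictable_time FX (fun=> t%:E).
Proof.
move=> t0; split.
  split=> [w|u u0]; first by rewrite lee_fin.
  case: (leP t u) => tu.
    rewrite (_ : [set w | _] = setT); first exact: (filt_T FFX).
    by apply/seteqP; split=> w //= _; rewrite lee_fin.
  rewrite (_ : [set w | _] = set0); first exact: (filt_0 FFX).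
  by apply/seteqP; split=> w //=; rewrite lee_fin leNgt tu.
move: t0; rewrite le_eqVlt => /orP[/eqP <-|t0].
  rewrite (_ : [set x | _] = TD); first exact: pred_T.
  by apply/seteqP; split=> -[u w] /=; [case|move=> u0; split=> //; rewrite lee_fin].
have s0 n : 0 <= t - t / n.+1%:R by rewrite subr_ge0 ler_pdivrMr // ler_peMr ?ler1n // ltW.
(* [0, t[ consists of 0 and of the intervals ]0, t - t / (n + 1)] *)
rewrite (_ : [set x | _] = TD `\` (([set 0] `*` setT) `|` \bigcup_n (`]0,
  t - t / n.+1%:R] `*` setT))); last first.
  apply/seteqP; split=> -[u w] /=.
    move=> [u0]; rewrite lee_fin => tu; split=> // -[[/= u00 _]|[n _ [/=]]].
      by move: tu; rewrite u00 leNgt t0.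
    rewrite in_itv /= => /andP[_ un] _; have := le_trans tu un.
    by rewrite leNgt gtrBl divr_gt0.
  move=> [u0 nu]; split=> //; rewrite lee_fin leNgt; apply/negP => ut; apply: nu.
  move: u0; rewrite /time_domain /= le_eqVlt => /orP[/eqP <-|u0]; first by left.
  right; have du : 0 < t - u by rewrite subr_gt0.
  exists (Num.truncn (t / (t - u))) => //; split=> //=; rewrite in_itv /= u0 /=.
  rewrite lerBrDl -lerBrDr ler_pdivrMr // mulrC -ler_pdivrMr //.
  by rewrite ltW // truncnS_gt.
apply: pred_D; first exact: pred_T.
apply: (pred_U).
  by apply: rect0_pred; exact: (filt_T FFX).
have [_ _ PU] := @pred_sigma_algebra d T R FX; apply: PU => n.
by apply: rect_pred => //; exact: (filt_T FFX).
Qed.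

End continuous_adapted.

Section uniqueness.
Context {d : measure_display} {T : measurableType d} {R : realType}.
Variable P : probability T R.

(** The difference integrates to zero over every event of S. *)
Lemma cond_exp_unique (S : set (set T)) f g g' : sigma_algebra setT S -> S `<=` measurable ->
  is_cond_exp_real P S f g -> is_cond_exp_real P S f g' -> {ae P, forall w, g w = g' w}.
Proof.
move=> sS SM [_ ig mg eg] [_ ig' mg' eg'].
have ir : P.-integrable setT (EFin \o (fun w => g w - g' w)) by have :=
  integrableB measurableT ig ig'.
have mr : measurable_wrt setT S (fun w => g w - g' w) by exact: wrt_sub.
have r0 A : S A -> \int[P]_(w in A) (g w - g' w) = 0.
  move=> SA; have mA := SM _ SA.
  rewrite RintegralB //; try by apply: (integrableS measurableT).
  by rewrite /Rintegral -eg // -eg' // subrr.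
have := ae0_of_integral0 measurableT sS SM (fun A _ => @subsetT _ A) ir mr r0.
by apply: filterS => w /(_ Logic.I) /eqP; rewrite subr_eq0 => /eqP.
Qed.

End uniqueness.

(** * Vector-valued integrands *)

Section finite_sums.
Context {d : measure_display} {U : measurableType d} {R : realType}.
Variables (mu : {measure set U -> \bar R}) (D : set U).
Hypothesis mD : measurable D.

Lemma integrable_fsum n (f : 'I_n -> U -> R) : (forall i, mu.-integrable D (EFin \o f i)) ->
  mu.-integrable D (EFin \o (fun x => \sum_(i < n) f i x)).
Proof.
move=> fi; rewrite (_ : EFin \o _ = fun x => (\sum_(i < n) (f i x)%:E)%E).
  by apply: integrable_sum => // i _; exact: fi.
by apply/funext => x /=; rewrite sumEFin.
Qed.

Lemma Rintegral_fsum n (f : 'I_n -> U -> R) : (forall i, mu.-integrable D (EFin \o f i)) ->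
  \int[mu]_(x in D) (\sum_(i < n) f i x) = \sum_(i < n) \int[mu]_(x in D) f i x.
Proof.
move=> fi; rewrite /Rintegral; under eq_integral do rewrite -sumEFin.
rewrite integral_sum //.
rewrite (eq_bigr (fun i => (fine (\int[mu]_(x in D) (f i x)%:E))%:E)) => [|i _];
  first by rewrite sumEFin.
by rewrite fineK //; apply: integrable_fin_num => //; exact: fi.
Qed.

Lemma L2_closed (S : set (set U)) : sigma_algebra D S -> S `<=` measurable ->
  closed_subspace mu D S (L2 mu D S).
Proof. by move=> sS SM; split=> //; [exact: L2_0|move=> a f g lf lg; exact: L2_lin]. Qed.

End finite_sums.

Section vector_integrands.
Context {d : measure_display} {T : measurableType d} {R : realType}.
Variable P : probability T R.
Notation Q := ((@lebesgue_measure R) \x P)%E.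
Notation TD := (@time_domain d T R).
Notation ipQ := (ip Q TD).
Notation MQ := (@measurable _ (measurableTypeR R * T)%type).
Variable n : nat.

Definition re_comp (H : R -> T -> 'rV[R[i]]_n) (j : 'I_n) (x : R * T) : R :=
  complex.Re (H x.1 x.2 ord0 j).
Definition im_comp (H : R -> T -> 'rV[R[i]]_n) (j : 'I_n) (x : R * T) : R :=
  complex.Im (H x.1 x.2 ord0 j).

Let mTD := @measurable_TD d T R.

Lemma normsq_comp (H : R -> T -> 'rV[R[i]]_n) x :
  normsq (H x.1 x.2) = \sum_(j < n) (re_comp H j x ^+ 2 + im_comp H j x ^+ 2).
Proof. by apply: eq_bigr => j _; rewrite normc_sq. Qed.

Section one_filtration.
Variable G : R -> set (set T).
Hypothesis FG : is_filtration P G.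
Notation Pred := (predictable_sigma G).

Let MQf (f : R * T -> R) : measurable_wrt TD Pred f -> measurable_fun (TD : set (measurableTypeR
  R * T)) f.
Proof. by move=> mf; apply/wrt_measurable_fun => // B mB; apply: (pred_measurable FG); exact: mf.
  Qed.

Lemma H2_comp H : H2 P G H -> forall j, L2 Q TD Pred (re_comp H j) /\ L2 Q TD Pred (im_comp H j).
Proof.
move=> [pH fH] j.
have mr i : measurable_wrt TD Pred (re_comp H i) by case: (pH i).
have mi i : measurable_wrt TD Pred (im_comp H i) by case: (pH i).
have mn : measurable_fun (TD : set (measurableTypeR R * T)) (fun x => normsq (H x.1 x.2)).
  under eq_fun do rewrite normsq_comp.
  by apply: measurable_sum => i; apply: measurable_funD; apply: measurable_funX; exact: MQf.
have n0 x : 0 <= normsq (H x.1 x.2) by rewrite normsq_comp sumr_ge0 // => i _;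
  rewrite addr_ge0 ?sqr_ge0.
rewrite (iterated_integral P mn n0) in fH.
have le_ f : measurable_wrt TD Pred f -> (forall x, f x ^+ 2 <= normsq (H x.1 x.2)) ->
  L2 Q TD Pred f.
  move=> mf fn; split=> //; apply: le_lt_trans fH; apply: ge0_le_integral => //.
  - by move=> x _; rewrite lee_fin sqr_ge0.
  - by apply/measurable_EFinP; apply: measurable_funX; exact: MQf.
  - exact/measurable_EFinP.
  - by move=> x _; rewrite lee_fin.
have pos x : 0 <= \sum_(i < n | i != j) (re_comp H i x ^+ 2 + im_comp H i x ^+ 2).
  by apply: sumr_ge0 => i _; rewrite addr_ge0 ?sqr_ge0.
split; apply: le_ => // x; rewrite normsq_comp (bigD1 j) //=.
  by rewrite -addrA lerDl addr_ge0 ?sqr_ge0.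
by rewrite addrAC lerDr addr_ge0 ?sqr_ge0.
Qed.

Lemma comp_H2 H : (forall j, L2 Q TD Pred (re_comp H j)) -> (forall j,
  L2 Q TD Pred (im_comp H j)) -> H2 P G H.
Proof.
move=> lr li; split; first by move=> j; split; [case: (lr j)|case: (li j)].
have lrm j := L2Q_meas FG (lr j); have lim j := L2Q_meas FG (li j).
have mn : measurable_fun (TD : set (measurableTypeR R * T)) (fun x => normsq (H x.1 x.2)).
  under eq_fun do rewrite normsq_comp.
  apply: measurable_sum => i; apply: measurable_funD; apply: measurable_funX; apply: MQf.
    by case: (lr i).
  by case: (li i).
have n0 x : 0 <= normsq (H x.1 x.2) by rewrite normsq_comp sumr_ge0 // => i _;
  rewrite addr_ge0 ?sqr_ge0.
rewrite (iterated_integral P mn n0).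
have : Q.-integrable TD (EFin \o (fun x => normsq (H x.1 x.2))).
  under eq_fun do rewrite normsq_comp.
  apply: (@integrable_fsum _ (measurableTypeR R * T)%type R Q TD mTD n) => j.
  have i1 := @integrable_sqr _ (measurableTypeR R * T)%type R Q TD mTD _ (lrm j).
  have i2 := @integrable_sqr _ (measurableTypeR R * T)%type R Q TD mTD _ (lim j).
  by have := integrableD mTD i1 i2.
move=> /integrableP[_]; congr (_ < _)%E; apply: eq_integral => x _.
by rewrite /= ger0_norm.
Qed.

End one_filtration.

Lemma L2inner_comp (U V : R -> T -> 'rV[R[i]]_n) :
  (forall j, L2 Q TD MQ (re_comp U j)) -> (forall j, L2 Q TD MQ (im_comp U j)) ->
  (forall j, L2 Q TD MQ (re_comp V j)) -> (forall j, L2 Q TD MQ (im_comp V j)) ->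
  L2inner P U V = Complex
    (\sum_(j < n) (ipQ (re_comp U j) (re_comp V j) + ipQ (im_comp U j) (im_comp V j)))
    (\sum_(j < n) (ipQ (im_comp U j) (re_comp V j) - ipQ (re_comp U j) (im_comp V j))).
Proof.
move=> u1 u2 v1 v2.
have ii f g := @integrable_mul _ (measurableTypeR R * T)%type R Q TD mTD f g.
have R1 x : complex.Re (inner (U x.1 x.2) (V x.1 x.2)) =
    \sum_(j < n) (re_comp U j x * re_comp V j x + im_comp U j x * im_comp V j x).
  rewrite /inner cRe_sum; apply: eq_bigr => j _; rewrite cReM /re_comp /im_comp.
  by case: (V x.1 x.2 ord0 j) => a b /=; ring.
have I1 x : complex.Im (inner (U x.1 x.2) (V x.1 x.2)) =
    \sum_(j < n) (im_comp U j x * re_comp V j x - re_comp U j x * im_comp V j x).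
  rewrite /inner cIm_sum; apply: eq_bigr => j _; rewrite cImM /re_comp /im_comp.
  by case: (V x.1 x.2 ord0 j) => a b /=; ring.
have iA j := ii _ _ (u1 j) (v1 j); have iB j := ii _ _ (u2 j) (v2 j).
have iC j := ii _ _ (u2 j) (v1 j); have iD j := ii _ _ (u1 j) (v2 j).
rewrite /L2inner; congr Complex.
  under eq_Rintegral do rewrite R1.
  rewrite (@Rintegral_fsum _ (measurableTypeR R * T)%type R Q TD mTD n (fun j x =>
    re_comp U j x * re_comp V j x + im_comp U j x * im_comp V j x)).
    by apply: eq_bigr => j _; rewrite RintegralD.
  by move=> j; have := integrableD mTD (iA j) (iB j).
under eq_Rintegral do rewrite I1.
rewrite (@Rintegral_fsum _ (measurableTypeR R * T)%type R Q TD mTD n (fun j x =>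
  im_comp U j x * re_comp V j x - re_comp U j x * im_comp V j x)).
  by apply: eq_bigr => j _; rewrite RintegralB.
by move=> j; have := integrableB mTD (iC j) (iD j).
Qed.

Section projection.
Variables G G' : R -> set (set T).
Hypotheses (FG : is_filtration P G) (FG' : is_filtration P G').
Hypothesis GG' : forall t, 0 <= t -> G' t `<=` G t.
Variable H : R -> T -> 'rV[R[i]]_n.
Hypothesis HH : H2 P G H.
Notation Pred' := (predictable_sigma G').

Let sP' := @pred_sigma_algebra d T R G'.
Let PM' := pred_measurable FG'.

Let lH1 j : L2 Q TD MQ (re_comp H j). Proof. by apply: (L2Q_meas FG); case: (H2_comp FG HH j). Qed.
Let lH2 j : L2 Q TD MQ (im_comp H j). Proof. by apply: (L2Q_meas FG); case: (H2_comp FG HH j). Qed.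

Let sub_re (K : R -> T -> 'rV[R[i]]_n) j : re_comp (fun t w => H t w - K t w) j = fun x =>
  re_comp H j x - re_comp K j x.
Proof. by apply/funext => x; rewrite /re_comp !mxE cReB. Qed.

Let sub_im (K : R -> T -> 'rV[R[i]]_n) j : im_comp (fun t w => H t w - K t w) j = fun x =>
  im_comp H j x - im_comp K j x.
Proof. by apply/funext => x; rewrite /im_comp !mxE cImB. Qed.

Let lsub f g : L2 Q TD MQ f -> L2 Q TD MQ g -> L2 Q TD MQ (fun x => f x - g x).
Proof. exact: (@L2_subr _ (measurableTypeR R * T)%type R Q TD mTD MQ (@sigma_algebra_M _
  (measurableTypeR R * T)%type TD mTD) (fun _ x => x)). Qed.

(** The componentwise projections of real and imaginary parts show that the
    projection exists, so that its default value is not taken. Testing any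
    projection against g e_j with g real gives back the real orthogonality
    relations. *)
Lemma orthogonal_projection_spec (K := orthogonal_projection P (H2 P G') H) :
  H2 P G' K /\ forall j g, L2 Q TD Pred' g ->
    ipQ (fun x => re_comp H j x - re_comp K j x) g = 0 /\
    ipQ (fun x => im_comp H j x - im_comp K j x) g = 0.
Proof.
have cK := @L2_closed _ (measurableTypeR R * T)%type R Q TD mTD Pred' sP' PM'.
have pe f (lf : L2 Q TD MQ f) := @projection_exists _ (measurableTypeR R * T)%type R Q TD mTD
  Pred' sP' PM' _ f cK lf.
pose k1 j := sval (cid (pe _ (lH1 j))); pose k2 j := sval (cid (pe _ (lH2 j))).
have k1P j := svalP (cid (pe _ (lH1 j))); have k2P j := svalP (cid (pe _ (lH2 j))).
pose K0 t w : 'rV[R[i]]_n := \row_j Complex (k1 j (t, w)) (k2 j (t, w)).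
have K01 j : re_comp K0 j = k1 j by apply/funext => -[t w]; rewrite /re_comp mxE.
have K02 j : im_comp K0 j = k2 j by apply/funext => -[t w]; rewrite /im_comp mxE.
have HK0 : H2 P G' K0.
  by apply: (comp_H2 FG') => j; [rewrite K01; case: (k1P j)|rewrite K02; case: (k2P j)].
have ex : exists K1, [set K1 | H2 P G' K1 /\ forall V, H2 P G' V -> L2inner P (fun t w =>
  H t w - K1 t w) V = 0] K1.
  exists K0; split=> // V HV.
  have lV j := H2_comp FG' HV j; have lK j := H2_comp FG' HK0 j.
  rewrite L2inner_comp.
  - rewrite !big1 // => j _; rewrite sub_re sub_im K01 K02.
      by have [_ ->] := k1P j; [have [_ ->] := k2P j; [rewrite subrr|case: (lV j)]|case: (lV j)].
    by have [_ ->] := k1P j; [have [_ ->] := k2P j; [rewrite addr0|case: (lV j)]|case: (lV j)].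
  - by move=> j; rewrite sub_re; apply: lsub => //; apply: (L2Q_meas FG'); case: (lK j).
  - by move=> j; rewrite sub_im; apply: lsub => //; apply: (L2Q_meas FG'); case: (lK j).
  - by move=> j; apply: (L2Q_meas FG'); case: (lV j).
  - by move=> j; apply: (L2Q_meas FG'); case: (lV j).
have [HK oK] := xgetPex (fun _ _ => 0) ex; rewrite -/(orthogonal_projection _ _ _) -/K in HK oK.
split=> // j g lg.
pose V t w : 'rV[R[i]]_n := \row_i if i == j then Complex (g (t, w)) 0 else 0.
have V1 i : re_comp V i = fun x => if i == j then g x else 0.
  by apply/funext => -[t w]; rewrite /re_comp mxE; case: ifP.
have V2 i : im_comp V i = fun=> 0.
  by apply/funext => -[t w]; rewrite /im_comp mxE; case: ifP.
have l0 : L2 Q TD Pred' (fun=> 0) by exact: (@L2_0 _ (measurableTypeR R * T)%type R Q TD Pred' sP').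
have HV : H2 P G' V.
  by apply: (comp_H2 FG') => i; rewrite ?V2 // V1; case: (i == j).
have lV i := H2_comp FG' HV i; have lK i := H2_comp FG' HK i.
have := oK _ HV; rewrite L2inner_comp.
- move=> /eqP; rewrite eq_complex /= => /andP[/eqP e1 /eqP e2].
  have z f : ipQ f (fun=> 0) = 0 by rewrite ipC ip0l.
  split.
    rewrite -[RHS]e1 (bigD1 j) //= big1 => [|i /negbTE ij].
      by rewrite V1 V2 sub_re eqxx z !addr0.
    by rewrite V1 V2 ij !z addr0.
  rewrite -[RHS]e2 (bigD1 j) //= big1 => [|i /negbTE ij].
    by rewrite V1 V2 sub_im eqxx z subr0 addr0.
  by rewrite V1 V2 ij !z subr0.
- by move=> i; rewrite sub_re; apply: lsub => //; apply: (L2Q_meas FG'); case: (lK i).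
- by move=> i; rewrite sub_im; apply: lsub => //; apply: (L2Q_meas FG'); case: (lK i).
- by move=> i; apply: (L2Q_meas FG'); case: (lV i).
- by move=> i; apply: (L2Q_meas FG'); case: (lV i).
Qed.

End projection.
End vector_integrands.

(** * The predictable projection *)

Section projection_of_real_parts.
Context {d : measure_display} {T : measurableType d} {R : realType}.
Variable P : probability T R.
Hypothesis Pcomplete : measure_is_complete P.
Notation Q := ((@lebesgue_measure R) \x P)%E.
Notation TD := (@time_domain d T R).
Notation ipP := (ip P setT).

(** Integrals along the real process X have an integrator with zero imaginary
    part, whose two integrals in the complex expansion vanish. *)
Lemma ito_process0 (G : R -> set (set T)) (FG : is_filtration P G) h :
  ito_process P G (fun _ _ => 0) h (fun _ _ => 0).
Proof.
split.
- by move=> t t0; apply: L2_0; exact: (filt_sigma FG).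
- by apply: aeW => w; exact: cpath0.
- move=> e _ _ t t0; rewrite (_ : (fun m => _) = fun=> 0); first exact: cvg_cst.
  apply/funext => m; rewrite -[RHS](ip0l P setT (fun=> 0)).
  have z w : simple_int (fun _ _ => 0) (e m) t w = 0 by rewrite /simple_int big1 // => p _;
    rewrite subrr mulr0.
  by apply: eq_ip => w _; rewrite z subr0.
Qed.

Lemma simple_int0_L2 (e : seq (@piece d T R)) t : L2 P setT measurable (simple_int (fun _ _ =>
  0) e t).
Proof.
apply: L2_eq (L2_0 _ (sigma_algebra_M measurableT)) => w _.
by rewrite /simple_int big1 // => p _; rewrite subrr mulr0.
Qed.

(** Paths are replaced by zero on the null set where they are discontinuous;
    this set belongs to every G t. *)
Lemma continuous_version (G : R -> set (set T)) (FG : is_filtration P G) W h M :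
  ito_process P G W h M -> exists L : R -> T -> R,
  [/\ forall t, 0 <= t -> measurable_wrt setT (G t) (L t), forall w, cpath (L ^~ w) &
      {ae P, forall w, forall t, L t w = M t w}].
Proof.
move=> [lM cM _]; pose Om := [set w | cpath (M ^~ w)].
have GOm t : 0 <= t -> G t Om.
  by move=> t0; rewrite -(setCK Om); apply: (filt_C FG) => //; exact: (filt_null FG).
exists (fun t w => \1_Om w * M t w); split.
- move=> t t0; apply: wrt_mul; [exact: (filt_sigma FG)| |by case: (lM t t0)].
  by apply: wrt_indic; [exact: (filt_sigma FG)|rewrite setTI; exact: GOm].
- move=> w; have [Omw|nOm] := pselect (Om w).
    rewrite (_ : (fun t => _) = fun t => 1 * M t w + 0 * 0); first by apply: cpath_lin => //;
      exact: cpath0.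
    by apply/funext => t; rewrite indicE mem_set // mul0r addr0.
  rewrite (_ : (fun t => _) = fun=> 0); first exact: cpath0.
  by apply/funext => t; rewrite indicE memNset // mul0r.
- by apply: filterS cM => w cw t; rewrite indicE mem_set ?mul1r.
Qed.

Lemma Re_value_at (L : R -> T -> R[i]) tau w :
  complex.Re (value_at L tau w) = real_at (fun t w => complex.Re (L t w)) tau w.
Proof. by rewrite /value_at /real_at; case: (tau w). Qed.

Lemma Im_value_at (L : R -> T -> R[i]) tau w :
  complex.Im (value_at L tau w) = real_at (fun t w => complex.Im (L t w)) tau w.
Proof. by rewrite /value_at /real_at; case: (tau w). Qed.

Variables F FX : R -> set (set T).
Hypotheses (FF : is_filtration P F) (FFX : is_filtration P FX).
Variable S : set (set T).
Hypotheses (sS : sigma_algebra setT S) (SM : S `<=` measurable) (FXS : forall t, 0 <= t ->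
  FX t `<=` S).

(** Sampling the martingale M - L, which is orthogonal to S at all times,
    identifies the conditional expectation of the value of M at tau. *)
Lemma real_projection (M L : R -> T -> R) tau : stopping_time FX tau ->
  H2martingale P F M -> H2martingale P F L ->
  measurable_wrt TD (predictable_sigma FX) (fun x => L x.1 x.2) ->
  (forall t B, 0 <= t -> S B -> ipP (fun w => M t w - L t w) (\1_B) = 0) ->
  is_cond_exp_real P (strict_past FX tau) (real_at M tau) (real_at L tau).
Proof.
move=> st hM hL mL ML0.
have iM := real_at_integrable Pcomplete st FF hM sS SM FXS.
have iL := real_at_integrable Pcomplete st FF hL sS SM FXS.
split=> //; first exact: (real_at_strict_past FFX).
move=> A SPA; have SA : S A by exact: (strict_past_sub FFX st sS FXS).
have mA := SM SA.
have hD : H2martingale P F (fun t w => M t w + (-1) * L t w) by exact: H2martingale_lin.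
have D0 t B : 0 <= t -> S B -> ipP (fun w => M t w + (-1) * L t w) (\1_B) = 0.
  by move=> t0 SB; rewrite -(ML0 t B t0 SB); apply: eq_ip => // w _; rewrite mulN1r.
have := optional_sampling_zero Pcomplete st FF hD sS SM FXS D0 SA.
have iMA := integrableS measurableT mA (@subsetT _ A) iM.
have iLA := integrableS measurableT mA (@subsetT _ A) iL.
have -> : (\int[P]_(w in A) (real_at (fun t w => M t w + -1 * L t w) tau w)%:E =
    \int[P]_(w in A) (real_at M tau w)%:E - \int[P]_(w in A) (real_at L tau w)%:E)%E.
  rewrite -integralB_EFin //; apply: eq_integral => w _; rewrite /real_at -EFinB.
  by case: (tau w) => [r| |]; rewrite ?mulN1r ?subrr.
have f1 := integrable_fin_num mA iMA; have f2 := integrable_fin_num mA iLA.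
by move=> /eqP; rewrite sube_eq // add0e => /eqP.
Qed.

End projection_of_real_parts.

Section assembly.
Context {d : measure_display} {T : measurableType d} {R : realType}.
Variable P : probability T R.
Hypothesis Pcomplete : measure_is_complete P.
Variables (n : nat) (X Y : R -> T -> 'rV[R]_n).
Hypotheses (BX : brownian_motion P X) (BY : brownian_motion P Y).
Hypothesis XY : independent_processes P X Y.
Notation Z := (conformal X Y).
Notation XC := (complexify X).
Notation F := (augmented_filtration P Z).
Notation FX := (augmented_filtration P XC).
Notation Xj j := (fun t w => X t w ord0 j).
Notation Yj j := (fun t w => Y t w ord0 j).
Notation Q := ((@lebesgue_measure R) \x P)%E.
Notation TD := (@time_domain d T R).
Notation L2P := (L2 P setT measurable).
Notation ipP := (ip P setT).
Notation ipQ := (ip Q TD).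
Notation Pred := (predictable_sigma F).
Notation PredX := (predictable_sigma FX).
Notation FXoo := (completed P (full_history X)).

Let mTD := @measurable_TD d T R.
Let FF : is_filtration P F := F_filtration Pcomplete BX BY.
Let FFX : is_filtration P FX := FX_filtration Pcomplete BX.
Let XF t : 0 <= t -> FX t `<=` F t. Proof. exact: FX_sub_F. Qed.
Let BXF j : is_BM P F (Xj j). Proof. exact: X_is_BM_F. Qed.
Let BYF j : is_BM P F (Yj j). Proof. exact: Y_is_BM_F. Qed.
Let BXX j : is_BM P FX (Xj j). Proof. exact: X_is_BM_FX Y BX BY XY j. Qed.
Let sXoo : sigma_algebra setT FXoo. Proof. exact: completed_sigma. Qed.
Let MXoo : FXoo `<=` measurable.
Proof. by apply: (completed_measurable Pcomplete); exact: (full_measurable BX). Qed.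
Let FXoo_sub t : 0 <= t -> FX t `<=` FXoo. Proof. exact: FX_FXoo. Qed.
Let sP := @pred_sigma_algebra d T R F.
Let PM := pred_measurable FF.

(** With h = k + (h - k), the difference N - L reduces to the integrals of
    h - k along X and of g along Y, both unseen from the path of X. *)
Lemma orth_part j h k g a MX KX MY N L t B :
  L2 Q TD Pred h -> L2 Q TD PredX k -> L2 Q TD Pred g ->
  (forall u, L2 Q TD PredX u -> ipQ (fun x => h x - k x) u = 0) ->
  ito_process P F (Xj j) h MX -> ito_process P F (Xj j) k KX -> ito_process P F (Yj j) g MY ->
  L2P N -> L2P L -> {ae P, forall w, N w = MX t w + a * MY t w} -> {ae P, forall w, L w = KX t w} ->
  0 <= t -> FXoo B -> ipP (fun w => N w - L w) (\1_B) = 0.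
Proof.
move=> lh lkX lg hk iMX iKX iMY lN lL eN eL t0 XB.
have lk : L2 Q TD Pred k by exact: (L2_pred_mono XF).
have lhk : L2 Q TD Pred (fun x => h x + (-1) * k x).
  exact: (@L2_lin _ (measurableTypeR R * T)%type R Q TD mTD Pred sP PM).
have [V iV] := ito_process_exists FF (BXF j) lhk.
have eV := ito_lin FF (BXF j) lh lk iMX iKX iV t0.
have lV := ito_L2 FF iV t0; have lY := ito_L2 FF iMY t0.
have lB : L2P (\1_B : T -> R) by apply: indic_L2 => //; [exact: sigma_algebra_M|exact: MXoo].
have mm f : L2P f -> measurable_fun setT f by move=> [m _]; apply/wrt_measurable_fun.
have lVY : L2P (fun w => V t w + a * MY t w) by apply: L2_lin => //; exact: sigma_algebra_M.
have lNL : L2P (fun w => N w - L w) by apply: L2_subr => //; exact: sigma_algebra_M.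
have e : {ae P, forall w, setT w -> N w - L w = V t w + a * MY t w}.
  by apply: filterS3 eN eL eV => w -> -> -> _; ring.
rewrite (ip_ae measurableT (mm _ lNL) (mm _ lVY) (mm _ lB) e) (ip_lin measurableT a lV lY lB).
have ort u : L2 Q TD PredX u -> ipQ (fun x => h x + (-1) * k x) u = 0.
  by move=> lu; rewrite -(hk u lu); apply: eq_ip => // x _; rewrite mulN1r.
have [_ UX] := X_unseen Pcomplete BX BY XY j lhk ort.
have [_ UY] := Y_unseen Pcomplete BX BY XY j lg.
by rewrite (UX V) // (UY MY) // mulr0 addr0.
Qed.

Variable H : R -> T -> 'rV[R[i]]_n.
Hypothesis HH : H2 P F H.
Notation K := (orthogonal_projection P (H2 P FX) H).
Notation M j := (ito_integral P F (fun s v => Z s v ord0 j) (fun s v => H s v ord0 j)).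
Notation N j := (ito_integral P F (fun s v => XC s v ord0 j) (fun s v => K s v ord0 j)).

(** L1 and L2 are continuous versions of the integrals of the projected
    integrand in the filtration of X; they agree at each time with the
    integrals taken in the filtration of (X, Y). *)
Lemma component_projection j : exists L1 L2 : R -> T -> R,
  [/\ H2martingale P F (fun t w => complex.Re (M j t w)) /\ H2martingale P F (fun t w =>
    complex.Im (M j t w)),
      H2martingale P F L1 /\ H2martingale P F L2,
      (forall t, 0 <= t -> measurable_wrt setT (FX t) (L1 t) /\
        measurable_wrt setT (FX t) (L2 t)) /\
      (forall w, cpath (L1 ^~ w) /\ cpath (L2 ^~ w)),
      forall t, 0 <= t -> {ae P, forall w, N j t w = Complex (L1 t w) (L2 t w)} &
      forall t B, 0 <= t -> FXoo B -> ipP (fun w => complex.Re (M j t w) - L1 t w) (\1_B) = 0 /\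
        ipP (fun w => complex.Im (M j t w) - L2 t w) (\1_B) = 0].
Proof.
have [HK oK] := orthogonal_projection_spec FF FFX HH.
have [lh1 lh2] := H2_comp FF HH j; have [lk1X lk2X] := H2_comp FFX HK j.
have lk1 := L2_pred_mono XF lk1X; have lk2 := L2_pred_mono XF lk2X.
have [MX1 iMX1] := ito_process_exists FF (BXF j) lh1.
have [MX2 iMX2] := ito_process_exists FF (BXF j) lh2.
have [MY1 iMY1] := ito_process_exists FF (BYF j) lh1.
have [MY2 iMY2] := ito_process_exists FF (BYF j) lh2.
have [KX1 iKX1] := ito_process_exists FF (BXF j) lk1.
have [KX2 iKX2] := ito_process_exists FF (BXF j) lk2.
have [LX1 iLX1] := ito_process_exists FFX (BXX j) lk1X.
have [LX2 iLX2] := ito_process_exists FFX (BXX j) lk2X.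
have [L1 [aL1 cL1 eL1]] := continuous_version FFX iLX1.
have [L2_ [aL2 cL2 eL2]] := continuous_version FFX iLX2.
have sX e t : adapted_pieces F e -> 0 <= t -> L2P (simple_int (Xj j) e t).
  by move=> se t0; apply: (L2G_meas FF t0); exact: (simple_int_L2G FF (BXF j)).
have sY e t : adapted_pieces F e -> 0 <= t -> L2P (simple_int (Yj j) e t).
  by move=> se t0; apply: (L2G_meas FF t0); exact: (simple_int_L2G FF (BYF j)).
have ZE : (fun s v => Z s v ord0 j) = (fun s v => Complex (X s v ord0 j) (Y s v ord0 j)).
  by apply/funext => s; apply/funext => v; rewrite mxE.
have XE : (fun s v => XC s v ord0 j) = (fun s v => Complex (X s v ord0 j) 0).
  by apply/funext => s; apply/funext => v; rewrite mxE.
have iM : is_ito_integral P F (fun s v => Complex (X s v ord0 j) (Y s v ord0 j)) (fun s v =>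
  H s v ord0 j) (M j).
  rewrite -ZE; apply: (@xgetPex _ (fun _ _ => 0) [set M | is_ito_integral P F _ _ M]).
  rewrite ZE; eexists.
  exact: (complex_ito_exists FF sX sY lh1 lh2 iMX1 iMX2 iMY1 iMY2).
have i0 h := ito_process0 FF h.
have s0 e t (_ : adapted_pieces F e) (_ : 0 <= t) := simple_int0_L2 P e t.
have iN : is_ito_integral P F (fun s v => Complex (X s v ord0 j) 0) (fun s v => K s v ord0 j) (N j).
  rewrite -XE; apply: (@xgetPex _ (fun _ _ => 0) [set M | is_ito_integral P F _ _ M]).
  rewrite XE; eexists.
  exact: (complex_ito_exists FF sX s0 lk1 lk2 iKX1 iKX2 (i0 _) (i0 _)).
have uM t t0 := @complex_ito_unique _ _ _ _ _ FF _ _ sX sY _ lh1 lh2 _ _ _ _ iMX1 iMX2 iMY1 iMY2 _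
  t iM t0.
have uN t t0 := @complex_ito_unique _ _ _ _ _ FF _ _ sX s0 _ lk1 lk2 _ _ _ _ iKX1 iKX2 (i0 _) (i0
  _) _ t iN t0.
have [aM cM _] := iM.
have eLK1 t : 0 <= t -> {ae P, forall w, L1 t w = KX1 t w}.
  move=> t0; have := ito_mono FF FFX XF (BXF j) lk1X iKX1 iLX1 t0.
  by apply: filterS2 eL1 => w -> ->.
have eLK2 t : 0 <= t -> {ae P, forall w, L2_ t w = KX2 t w}.
  move=> t0; have := ito_mono FF FFX XF (BXF j) lk2X iKX2 iLX2 t0.
  by apply: filterS2 eL2 => w -> ->.
have aF L t : 0 <= t -> measurable_wrt setT (FX t) (L t) -> measurable_wrt setT (F t) (L t : T ->
  R).
  by move=> t0 m B mB; apply: XF => //; exact: m.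
have hL1 : H2martingale P F L1.
  apply: (H2martingale_modification FF (ito_H2martingale FF (BXF j) lk1 iKX1)) => //.
    by move=> t t0; apply: aF => //; exact: aL1.
  by apply: aeW.
have hL2 : H2martingale P F L2_.
  apply: (H2martingale_modification FF (ito_H2martingale FF (BXF j) lk2 iKX2)) => //.
    by move=> t t0; apply: aF => //; exact: aL2.
  by apply: aeW.
have eR t : 0 <= t -> {ae P, forall w, complex.Re (M j t w) = MX1 t w + (-1) * MY2 t w}.
  by move=> t0; apply: filterS (uM t t0) => w -> /=; rewrite mulN1r.
have eI t : 0 <= t -> {ae P, forall w, complex.Im (M j t w) = MX2 t w + 1 * MY1 t w}.
  by move=> t0; apply: filterS (uM t t0) => w -> /=; rewrite mul1r.
have hR : H2martingale P F (fun t w => complex.Re (M j t w)).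
  apply: (H2martingale_modification FF (H2martingale_lin FF (-1)
    (ito_H2martingale FF (BXF j) lh1 iMX1) (ito_H2martingale FF (BYF j) lh2 iMY2))) => //.
    by move=> t t0; case: (aM t t0).
  by apply: filterS cM => w [/within_cpath].
have hI : H2martingale P F (fun t w => complex.Im (M j t w)).
  apply: (H2martingale_modification FF (H2martingale_lin FF 1
    (ito_H2martingale FF (BXF j) lh2 iMX2) (ito_H2martingale FF (BYF j) lh1 iMY1))) => //.
    by move=> t t0; case: (aM t t0).
  by apply: filterS cM => w [_ /within_cpath].
have hl D t : H2martingale P F D -> 0 <= t -> L2P (D t).
  by move=> [[l _] _ _] t0; exact: (L2G_meas FF t0 (l t t0)).
exists L1, L2_; split=> //.
- by split=> [t t0|w]; split=> //; [exact: aL1|exact: aL2].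
- move=> t t0; apply: filterS3 (uN t t0) (eLK1 t t0) (eLK2 t t0) => w -> -> ->.
  by rewrite subr0 addr0.
- move=> t B t0 XB; split.
    apply: (@orth_part j (re_comp H j) (re_comp K j) (im_comp H j) (-1) MX1 KX1 MY2 _ _ t) => //.
    + by move=> u lu; case: (oK j u lu).
    + exact: (hl _ t hR t0).
    + exact: hl.
    + exact: eR.
    + exact: eLK1.
  apply: (@orth_part j (im_comp H j) (im_comp K j) (re_comp H j) 1 MX2 KX2 MY1 _ _ t) => //.
  + by move=> u lu; case: (oK j u lu).
  + exact: (hl _ t hI t0).
  + exact: hl.
  + exact: eI.
  + exact: eLK2.
Qed.

Lemma orth_fsum (D : 'I_n -> T -> R) B : FXoo B -> (forall j, L2P (D j)) ->
  (forall j, ipP (D j) (\1_B) = 0) -> ipP (fun w => \sum_j D j w) (\1_B) = 0.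
Proof.
move=> XB lD oD.
have lB : L2P (\1_B : T -> R) by apply: indic_L2 => //; [exact: sigma_algebra_M|exact: MXoo].
rewrite /ip; under eq_Rintegral do rewrite mulr_suml.
rewrite (Rintegral_fsum measurableT (f := fun j w => D j w * \1_B w)).
  by rewrite big1 // => j _; exact: oD.
by move=> j; exact: integrable_mul.
Qed.

Lemma projection_exists_ae : exists L0 : R -> T -> R[i],
  predictable_projection P FX (stochastic_integral P F Z H) L0 /\
  forall t, 0 <= t -> {ae P, forall w, L0 t w = stochastic_integral P F XC K t w}.
Proof.
have [L1 L1P] := choice component_projection.
have [L2_ LP] := choice L1P.
have hR j : H2martingale P F (fun t w => complex.Re (M j t w)) by case: (LP j) => -[].
have hI j : H2martingale P F (fun t w => complex.Im (M j t w)) by case: (LP j) => -[].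
have hL1 j : H2martingale P F (L1 j) by case: (LP j) => _ [].
have hL2 j : H2martingale P F (L2_ j) by case: (LP j) => _ [].
have hl D t : H2martingale P F D -> 0 <= t -> L2P (D t).
  by move=> [[l _] _ _] t0; exact: (L2G_meas FF t0 (l t t0)).
have lsub f g : L2P f -> L2P g -> L2P (fun w => f w - g w).
  by apply: L2_subr => //; exact: sigma_algebra_M.
pose L0 t w : R[i] := \sum_j Complex (L1 j t w) (L2_ j t w).
have ReM : (fun t w => complex.Re (stochastic_integral P F Z H t w)) = (fun t w =>
  \sum_j complex.Re (M j t w)).
  by apply/funext => t; apply/funext => w; rewrite /stochastic_integral cRe_sum.
have ImM : (fun t w => complex.Im (stochastic_integral P F Z H t w)) = (fun t w =>
  \sum_j complex.Im (M j t w)).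
  by apply/funext => t; apply/funext => w; rewrite /stochastic_integral cIm_sum.
have ReL : (fun t w => complex.Re (L0 t w)) = (fun t w => \sum_j L1 j t w).
  by apply/funext => t; apply/funext => w; rewrite /L0 cRe_sum.
have ImL : (fun t w => complex.Im (L0 t w)) = (fun t w => \sum_j L2_ j t w).
  by apply/funext => t; apply/funext => w; rewrite /L0 cIm_sum.
have sPX := @pred_sigma_algebra d T R FX.
have p1 : measurable_wrt TD PredX (fun x => \sum_j L1 j x.1 x.2).
  apply: (wrt_sum sPX) => j; apply: (continuous_adapted_predictable FFX).
    by move=> t t0; case: (LP j) => _ _ [m _] _ _; case: (m t t0).
  by move=> w; case: (LP j) => _ _ [_ c] _ _; case: (c w).
have p2 : measurable_wrt TD PredX (fun x => \sum_j L2_ j x.1 x.2).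
  apply: (wrt_sum sPX) => j; apply: (continuous_adapted_predictable FFX).
    by move=> t t0; case: (LP j) => _ _ [m _] _ _; case: (m t t0).
  by move=> w; case: (LP j) => _ _ [_ c] _ _; case: (c w).
exists L0; split; last first.
  move=> t t0; have h : {ae P, forall w, forall j, N j t w = Complex (L1 j t w) (L2_ j t w)}.
    by apply: filter_forall => j; case: (LP j) => _ _ _ e _; exact: e.
  by apply: filterS h => w h; rewrite /L0 /stochastic_integral; apply: eq_bigr => j _; rewrite h.
split.
  split.
    by move: p1; rewrite -[fun x => \sum_j _]/(fun x : R * T => (fun t w =>
      \sum_j L1 j t w) x.1 x.2) -ReL.
  by move: p2; rewrite -[fun x => \sum_j _]/(fun x : R * T => (fun t w =>
    \sum_j L2_ j t w) x.1 x.2) -ImL.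
move=> tau [st _]; exists (value_at L0 tau); split; last by apply: aeW.
have c1 : is_cond_exp_real P (strict_past FX tau) (real_at (fun t w =>
  \sum_j complex.Re (M j t w)) tau)
   (real_at (fun t w => \sum_j L1 j t w) tau).
  apply: (real_projection Pcomplete FF FFX sXoo MXoo FXoo_sub st) => //;
    try exact: H2martingale_sum.
  move=> t B t0 XB.
  rewrite (@eq_ip _ _ _ P setT _ (fun w => \sum_j (complex.Re (M j t w) - L1 j t w)) _ (\1_B)) //;
    last by move=> w _; rewrite sumrB.
  apply: orth_fsum => // j; last by case: (LP j) => _ _ _ _ o; case: (o t B t0 XB).
  by apply: lsub; [exact: (hl _ t (hR j) t0)|exact: hl].
have c2 : is_cond_exp_real P (strict_past FX tau) (real_at (fun t w =>
  \sum_j complex.Im (M j t w)) tau)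
   (real_at (fun t w => \sum_j L2_ j t w) tau).
  apply: (real_projection Pcomplete FF FFX sXoo MXoo FXoo_sub st) => //;
    try exact: H2martingale_sum.
  move=> t B t0 XB.
  rewrite (@eq_ip _ _ _ P setT _ (fun w => \sum_j (complex.Im (M j t w) - L2_ j t w)) _ (\1_B))
    //; last by move=> w _; rewrite sumrB.
  apply: orth_fsum => // j; last by case: (LP j) => _ _ _ _ o; case: (o t B t0 XB).
  by apply: lsub; [exact: (hl _ t (hI j) t0)|exact: hl].
split.
  rewrite (_ : (fun w => _) = real_at (fun t w => complex.Re (stochastic_integral P F Z H t w))
    tau); last first.
    by apply/funext => w; rewrite Re_value_at.
  rewrite [X in is_cond_exp_real _ _ _ X](_ : _ = real_at (fun t w => complex.Re (L0 t w)) tau);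
    last first.
    by apply/funext => w; rewrite Re_value_at.
  by rewrite ReM ReL.
rewrite (_ : (fun w => _) = real_at (fun t w => complex.Im (stochastic_integral P F Z H t w))
  tau); last first.
  by apply/funext => w; rewrite Im_value_at.
rewrite [X in is_cond_exp_real _ _ _ X](_ : _ = real_at (fun t w => complex.Im (L0 t w)) tau);
  last first.
  by apply/funext => w; rewrite Im_value_at.
by rewrite ImM ImL.
Qed.

(** Deterministic times are predictable, and conditional expectations are
    unique. *)
Lemma projection_unique_at M0 L L' t : predictable_projection P FX M0 L ->
  predictable_projection P FX M0 L' -> 0 <= t -> {ae P, forall w, L t w = L' t w}.
Proof.
move=> [_ pL] [_ pL'] t0; have pt := constant_predictable_time FFX t0.
have [g [[cr ci] eg]] := pL _ pt; have [g' [[cr' ci'] eg']] := pL' _ pt.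
have [st _] := pt.
have sSP : sigma_algebra setT (strict_past FX (fun=> t%:E)) by exact: smallest_sigma_algebra.
have SPM : strict_past FX (fun=> t%:E) `<=` measurable.
  by apply: (strict_past_sub FFX st (sigma_algebra_M measurableT)) => u u0; exact: (filt_meas FFX).
have u1 := cond_exp_unique sSP SPM cr cr'; have u2 := cond_exp_unique sSP SPM ci ci'.
have u : {ae P, forall w, g w = g' w} by apply: filterS2 u1 u2 => w; exact: eq_complex_parts.
apply: filterS3 u eg eg' => w gg /(_ (ltry t)) e /(_ (ltry t)) e'.
by move: e e'; rewrite /value_at gg => <- <-.
Qed.

End assembly.
Unset Implicit Arguments.

Theorem theorem2p2 (R : realType) (disp : measure_display)
    (T : measurableType disp) (P : probability T R)
    (d : nat) (X Y : R -> T -> 'rV[R]_d)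
    (Pcomplete : measure_is_complete P)
    (BX : brownian_motion P X) (BY : brownian_motion P Y)
    (XY : independent_processes P X Y)
    (H : R -> T -> 'rV[R[i]]_d)
    (HH : H2 P (augmented_filtration P (conformal X Y)) H) :
  let Z := conformal X Y in
  let XC := complexify X in
  let F := augmented_filtration P Z in
  let FX := augmented_filtration P XC in
  let PiX := orthogonal_projection P (H2 P FX) in
  (exists L, predictable_projection P FX (stochastic_integral P F Z H) L) /\
  (forall L, predictable_projection P FX (stochastic_integral P F Z H) L ->
   forall t, 0 <= t ->
   {ae P, forall w, L t w = stochastic_integral P F XC (PiX H) t w}).
Proof.
move=> Z XC F FX PiX.
have [L0 [pL0 eL0]] := projection_exists_ae Pcomplete BX BY XY HH.
split; first by exists L0.
move=> L pL t t0; have := projection_unique_at Pcomplete BX pL pL0 t0.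
by apply: filterS2 (eL0 t t0) => w <- ->.
Qed.
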